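(* Let $n\ge 1$ and $\ell\in\mathbb{Z}$, and let $\mathcal{Z}=\mathcal{Z}(r;\boldsymbol{\alpha},\boldsymbol{\beta})$ be either of the two functions $\mathcal{Z}_{n\text{-}\mathrm{ann}}$ or $\mathcal{Z}_{n\text{-}\mathrm{cro}}^{(\ell)}$ on $(0,\infty)\times\mathcal{X}_n\times\mathcal{X}_n$ (defined in the context). Then $\mathcal{Z}$ satisfies the following system of equations: for all $j\in\{1,\ldots,n\}$, $$\frac{\partial_r \mathcal{Z}}{\mathcal{Z}}=2\frac{\partial_{\alpha_j}^2 \mathcal{Z}}{\mathcal{Z}}+\sum_{k\neq j}\Big(H_1(r;\alpha_k-\alpha_j)\frac{\partial_{\alpha_k}\mathcal{Z}}{\mathcal{Z}}+\tfrac14\partial_zH_1(r;\alpha_k-\alpha_j)\Big)+\sum_{k=1}^n\Big(H_3(r;\beta_k-\alpha_j)\frac{\partial_{\beta_k}\mathcal{Z}}{\mathcal{Z}}+\tfrac14\partial_zH_3(r;\beta_k-\alpha_j)\Big)+\frac{1}{2r}+\frac34\mathcal{E}(r)+\frac n4,$$ $$\frac{\partial_r \mathcal{Z}}{\mathcal{Z}}=2\frac{\partial_{\beta_j}^2 \mathcal{Z}}{\mathcal{Z}}+\sum_{k\neq j}\Big(H_1(r;\beta_k-\beta_j)\frac{\partial_{\beta_k}\mathcal{Z}}{\mathcal{Z}}+\tfrac14\partial_zH_1(r;\beta_k-\beta_j)\Big)+\sum_{k=1}^n\Big(H_3(r;\alpha_k-\beta_j)\frac{\partial_{\alpha_k}\mathcal{Z}}{\mathcal{Z}}+\tfrac14\partial_zH_3(r;\alpha_k-\beta_j)\Big)+\frac{1}{2r}+\frac34\mathcal{E}(r)+\frac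 n4.$$
   Context: $\mathcal{X}_n=\{(\theta_1,\ldots,\theta_n)\in\mathbb{R}^n:\theta_1<\cdots<\theta_n<\theta_1+2\pi\}$. For $r>0$, $z\in\mathbb{C}$ the rescaled Jacobi theta functions are $$\Theta_1(r;z)=2e^{-r/4}\sin(z/2)\prod_{m\ge1}(1-e^{-2mr})(1-e^{-2mr}e^{iz})(1-e^{-2mr}e^{-iz}),$$ $$\Theta_3(r;z)=\prod_{m\ge1}(1-e^{-2mr})(1-e^{-(2m-1)r}e^{iz})(1-e^{-(2m-1)r}e^{-iz}),$$ and $H_1(r;z)=2\partial_z\log\Theta_1(r;z)$, $H_3(r;z)=2\partial_z\log\Theta_3(r;z)$. Also $$\mathcal{E}(r)=-\frac16+\sum_{k=1}^\infty\frac{1}{\sinh^2(kr)}.$$ For $n\ge1$, $\ell\in\mathbb{Z}$, $r>0$, $\boldsymbol{\alpha},\boldsymbol{\beta}\in\mathcal{X}_n$: $$\mathcal{Z}_{n\text{-}\mathrm{ann}}(r;\boldsymbol{\alpha},\boldsymbol{\beta})=\exp\Big(\frac{nr}{8}-\frac1{8r}\Big(\sum_{j=1}^n(-1)^j(\alpha_j-\beta_j)\Big)^2\Big)\prod_{m\ge1}(1-e^{-2mr})^{\frac{3n}{2}}\prod_{j=1}^n|\Theta_3(r;\beta_j-\alpha_j)|^{-\frac12}$$ $$\times\prod_{1\le i<k\le n}\left(\frac{|\Theta_1(r;\alpha_k-\alpha_i)|\,|\Theta_1(r;\beta_k-\beta_i)|}{|\Theta_3(r;\beta_k-\alpha_i)|\,|\Theta_3(r;\beta_i-\alpha_k)|}\right)^{\frac12(-1)^{k-i}},$$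 $$\mathcal{Z}_{n\text{-}\mathrm{cro}}^{(\ell)}(r;\boldsymbol{\alpha},\boldsymbol{\beta})=\exp\Big(\frac{nr}{8}-\frac1{8r}\Big(\sum_{j=1}^n(\alpha_j-\beta_j)-2n\pi\ell\Big)^2\Big)\prod_{m\ge1}(1-e^{-2mr})^{\frac{3n}{2}}\prod_{j=1}^n|\Theta_3(r;\beta_j-\alpha_j)|^{-\frac12}$$ $$\times\prod_{1\le i<k\le n}\left(\frac{|\Theta_1(r;\alpha_k-\alpha_i)|\,|\Theta_1(r;\beta_k-\beta_i)|}{|\Theta_3(r;\beta_k-\alpha_i)|\,|\Theta_3(r;\beta_i-\alpha_k)|}\right)^{\frac12}.$$ *)

(* Defs.v *)
From Stdlib Require Export Reals.
From mathcomp Require Export all_boot.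
From Coquelicot Require Export Coquelicot.

Set Implicit Arguments.
Unset Strict Implicit.
Unset Printing Implicit Defensive.

Open Scope R_scope.

(* Vectors of R^n are functions on 'I_n, so the coordinate of 1-based index j
   sits at the ordinal of value j - 1. *)
Definition Xn (n : nat) (x : 'I_n -> R) : Prop :=
  (forall i k : 'I_n, (i < k)%N -> x i < x k) /\
  (forall i k : 'I_n, i = 0%N :> nat -> k = n.-1 :> nat -> x k < x i + 2 * PI).

Definition upd (n : nat) (x : 'I_n -> R) (k : 'I_n) (t : R) : 'I_n -> R :=
  fun i => if i == k then t else x i.

Definition ex_partial (n : nat) (f : ('I_n -> R) -> R) (k : 'I_n)
    (x : 'I_n -> R) : Prop :=
  ex_derive (fun t => f (upd x k t)) (x k).

Definition partial (n : nat) (f : ('I_n -> R) -> R) (k : 'I_n)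
    (x : 'I_n -> R) : R :=
  Derive (fun t => f (upd x k t)) (x k).

Definition ex_partial2 (n : nat) (f : ('I_n -> R) -> R) (k : 'I_n)
    (x : 'I_n -> R) : Prop :=
  ex_derive_n (fun t => f (upd x k t)) 2 (x k).

Definition partial2 (n : nat) (f : ('I_n -> R) -> R) (k : 'I_n)
    (x : 'I_n -> R) : R :=
  Derive_n (fun t => f (upd x k t)) 2 (x k).

(* Infinite products over m >= 1.  The complex limit is taken on real and
   imaginary parts separately. *)
Definition Rprod_inf (f : nat -> R) : R :=
  Lim_seq (fun N : nat => \big[Rmult/1]_(1 <= m < N.+1) f m).

Definition Cprod_inf (f : nat -> C) : C :=
  (real (Lim_seq (fun N : nat => Re (\big[Cmult/RtoC 1]_(1 <= m < N.+1) f m))),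
   real (Lim_seq (fun N : nat => Im (\big[Cmult/RtoC 1]_(1 <= m < N.+1) f m)))).

Definition Cexp (z : C) : C :=
  (exp (Re z) * cos (Im z), exp (Re z) * sin (Im z)).

Definition Csin (z : C) : C :=
  ((Cexp (Ci * z) - Cexp (- (Ci * z))) / (2 * Ci))%C.

Definition Theta1 (r : R) (z : C) : C :=
  (2 * exp (- r / 4) * Csin (z / 2) *
   Cprod_inf (fun m =>
     (1 - exp (- 2 * INR m * r)) *
     (1 - exp (- 2 * INR m * r) * Cexp (Ci * z)) *
     (1 - exp (- 2 * INR m * r) * Cexp (- (Ci * z)))))%C.

Definition Theta3 (r : R) (z : C) : C :=
  Cprod_inf (fun m =>
    (1 - exp (- 2 * INR m * r)) *
    (1 - exp (- (2 * INR m - 1) * r) * Cexp (Ci * z)) *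
    (1 - exp (- (2 * INR m - 1) * r) * Cexp (- (Ci * z))))%C.

(* 2 d/dz log Theta is the logarithmic derivative 2 Theta' / Theta, which does
   not depend on a branch of the logarithm.  [C_derive f z] is the complex
   derivative wherever [f] is holomorphic ([is_C_derive_unique]), as here. *)
Definition HTheta1 (r : R) (z : C) : C :=
  (2 * (C_derive (Theta1 r) z / Theta1 r z))%C.

Definition HTheta3 (r : R) (z : C) : C :=
  (2 * (C_derive (Theta3 r) z / Theta3 r z))%C.

Definition Eis (r : R) : R :=
  - (1 / 6) + Series (fun k => 1 / (sinh (INR k.+1 * r)) ^ 2).

(* [Rpower] is the real power for positive bases; every base below is positive
   when r > 0 and a, b are in Xn. *)
Definition Zann (n : nat) (r : R) (a b : 'I_n -> R) : R :=
  exp (INR n * r / 8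
       - 1 / (8 * r) *
         (\big[Rplus/0]_(j < n) ((-1) ^ j.+1 * (a j - b j))) ^ 2) *
  Rprod_inf (fun m => Rpower (1 - exp (- 2 * INR m * r)) (3 * INR n / 2)) *
  \big[Rmult/1]_(j < n)
    Rpower (Cmod (Theta3 r (RtoC (b j - a j)))) (- (1 / 2)) *
  \big[Rmult/1]_(i < n) \big[Rmult/1]_(k < n | (i < k)%N)
    Rpower ((Cmod (Theta1 r (RtoC (a k - a i))) *
             Cmod (Theta1 r (RtoC (b k - b i)))) /
            (Cmod (Theta3 r (RtoC (b k - a i))) *
             Cmod (Theta3 r (RtoC (b i - a k)))))
           (1 / 2 * (-1) ^ (k - i)%N).

Definition Zcro (n : nat) (l : Z) (r : R) (a b : 'I_n -> R) : R :=
  exp (INR n * r / 8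
       - 1 / (8 * r) *
         ((\big[Rplus/0]_(j < n) (a j - b j)) - 2 * INR n * PI * IZR l) ^ 2) *
  Rprod_inf (fun m => Rpower (1 - exp (- 2 * INR m * r)) (3 * INR n / 2)) *
  \big[Rmult/1]_(j < n)
    Rpower (Cmod (Theta3 r (RtoC (b j - a j)))) (- (1 / 2)) *
  \big[Rmult/1]_(i < n) \big[Rmult/1]_(k < n | (i < k)%N)
    Rpower ((Cmod (Theta1 r (RtoC (a k - a i))) *
             Cmod (Theta1 r (RtoC (b k - b i)))) /
            (Cmod (Theta3 r (RtoC (b k - a i))) *
             Cmod (Theta3 r (RtoC (b i - a k)))))
           (1 / 2).

(* Main.v *)
Require Import Defs.
From HB Require Import structures.
From Stdlib Require Import Znat Lra Lia ClassicalEpsilon FunctionalExtensionality.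

Set Implicit Arguments.
Unset Strict Implicit.
Unset Printing Implicit Defensive.

(** Both partition functions are [exp energy] for a Coulomb gas of [2 n] charges
    of square one: the [alpha_j] carry charges [e_j], the [beta_j] carry
    [- e_j], with [e_j = (-1)^j] in the annular and [e_j = 1] in the crossing
    case.  Points [x_a], [x_b] with charges [s_a], [s_b] contribute
    [s_a s_b log |Theta| / 2], where [Theta] is [Theta1] on one side and
    [Theta3] across the sides ([gas_partition]).  One identity,
    [coulomb_identity], therefore proves all the equations of both systems.

    Dividing by the partition function leaves an identity between
    [u = Theta' / Theta] and [H = Theta'' / Theta] at the differences of points.
    Since both theta functions solve the heat equation, [H] is also the
    derivative of [log Theta] in [r].  Terms in the linear statistic cancel
    because [u] is odd.  For every two points other than the given one, the
    remaining products of two [u] are reduced by the addition theorem: when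
    [x + y + z = 0],
      [H(x) + H(y) + H(z) + 2 (u(x) u(y) + u(y) u(z) + u(z) u(x)) = 3/2 Eis]
    ([th_trilinear]).  What is left is linear in [H] and cancels because the
    total charge is zero; the same count of charges fixes the constant term.

    The addition theorem comes from series.  By the triple product
    ([triple_product], the limit of a finite identity for Gaussian binomials)
    both theta functions are sums of [(-1)^k exp (- r (k + h)^2 + i (k + h) z)],
    with [h = 1/2] or [h = 0], and can be differentiated termwise
    ([exp_sum_quad]).  Multiplied by the three theta functions, the addition
    theorem says that the second derivative at [t = 0] of
    [Theta(x + t) Theta(y + t) Theta(z + t)] is [3/2 Eis] times the value.  This
    is a sum over [Z^3], which is cut into lines of direction [(1, 1, 1)]; the
    condition [x + y + z = 0] makes the summand on a line a constant times a
    one-dimensional Gaussian, and the assertion for each line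
    ([theta_const]) says that a theta constant has logarithmic derivative
    [Eis / 2] in [r].  That constant either vanishes or is, by the pentagonal
    number theorem ([pentagonal]), [exp (- r / 12)] times the Euler product,
    whose logarithm is a double series that can be differentiated
    ([is_derive_log_euler]). *)

HB.instance Definition _ := Monoid.isComLaw.Build R 0 Rplus
  (fun x y z => esym (Rplus_assoc x y z)) Rplus_comm Rplus_0_l.
HB.instance Definition _ := Monoid.isComLaw.Build R 1 Rmult
  (fun x y z => esym (Rmult_assoc x y z)) Rmult_comm Rmult_1_l.
HB.instance Definition _ := Monoid.isMulLaw.Build R 0 Rmult Rmult_0_l Rmult_0_r.
HB.instance Definition _ := Monoid.isAddLaw.Build R Rmult Rplus
  Rmult_plus_distr_r Rmult_plus_distr_l.
HB.instance Definition _ := Monoid.isComLaw.Build C (RtoC 0) Cplus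
  Cplus_assoc Cplus_comm Cplus_0_l.
HB.instance Definition _ := Monoid.isComLaw.Build C (RtoC 1) Cmult
  Cmult_assoc Cmult_comm Cmult_1_l.
HB.instance Definition _ := Monoid.isMulLaw.Build C (RtoC 0) Cmult
  Cmult_0_l Cmult_0_r.
HB.instance Definition _ := Monoid.isAddLaw.Build C Cmult Cplus
  Cmult_plus_distr_r Cmult_plus_distr_l.

Lemma Z_eqbP : Equality.axiom Z.eqb.
Proof. by move=> x y; apply: (iffP idP) => /Z.eqb_eq. Qed.
HB.instance Definition _ := hasDecEq.Build Z Z_eqbP.

(** * Unordered sums of complex families *)

Notation Csum s a := (\big[Cplus/RtoC 0]_(i <- s) a i).
Notation Nsum s a := (\big[Rplus/0]_(i <- s) Cmod (a i)).

(** Convergence along finite index sets: the lattice sums below are reindexed and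
    cut into lines, which no enumeration of the indices should obstruct. *)
Definition sums_to (I : eqType) (a : I -> C) (l : C) : Prop :=
  forall eps, 0 < eps -> exists s0 : seq I, forall s, uniq s -> {subset s0 <= s} ->
    Cmod (Csum s a - l) < eps.

Definition absum_le (I : eqType) (a : I -> C) (B : R) : Prop :=
  forall s : seq I, uniq s -> Nsum s a <= B.

Definition absum (I : eqType) (a : I -> C) : Prop := exists B, absum_le a B.

Definition csum (I : eqType) (a : I -> C) : C :=
  epsilon (inhabits (RtoC 0)) (sums_to a).

Lemma Rsum_ge0 (I : Type) (s : seq I) (f : I -> R) :
  (forall i, 0 <= f i) -> 0 <= \big[Rplus/0]_(i <- s) f i.
Proof. by move=> f0; elim/big_ind: _ => //; [lra|move=> *; lra]. Qed.

Lemma Rsum_le (I : Type) (s : seq I) (f g : I -> R) :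
  (forall i, f i <= g i) ->
  \big[Rplus/0]_(i <- s) f i <= \big[Rplus/0]_(i <- s) g i.
Proof. by move=> fg; elim/big_ind2: _ => //; [lra|move=> *; lra]. Qed.

Lemma Csum_norm (I : Type) (s : seq I) (a : I -> C) : Cmod (Csum s a) <= Nsum s a.
Proof.
elim/big_ind2: _ => [|x u y v hx hy|i _]; [rewrite Cmod_0; lra| |lra].
by have := Cmod_triangle u v; lra.
Qed.

Lemma big_uniq_sub (T : Type) (e : T) (op : Monoid.com_law e) (I : eqType)
    (s s0 : seq I) (a : I -> T) :
  uniq s -> uniq s0 -> {subset s0 <= s} ->
  \big[op/e]_(i <- s) a i =
  op (\big[op/e]_(i <- s0) a i) (\big[op/e]_(i <- s | i \notin s0) a i).
Proof.
move=> us us0 ss; rewrite (bigID (mem s0)) /=; congr (op _ _).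
rewrite -big_filter; apply: perm_big; apply: uniq_perm => //; first exact: filter_uniq.
by move=> x; rewrite mem_filter /= andb_idr //; apply: ss.
Qed.

Lemma Rsum_sub (I : eqType) (s t : seq I) (f : I -> R) :
  (forall i, 0 <= f i) -> uniq s -> {subset s <= t} ->
  \big[Rplus/0]_(i <- s) f i <= \big[Rplus/0]_(i <- t) f i.
Proof.
move=> f0; elim: s t => [|x s IH] t /=; first by move=> _ _; rewrite big_nil; apply: Rsum_ge0.
move=> /andP[xs us] st; have xt : x \in t by apply: st; rewrite inE eqxx.
rewrite big_cons (perm_big _ (perm_to_rem xt)) big_cons.
have : forall i, i \in s -> i \in rem x t.
  move=> i si; have : i \in t by apply: st; rewrite inE si orbT.
  by rewrite (perm_mem (perm_to_rem xt)) inE => /orP[/eqP e|//]; rewrite -e si in xs.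
by move=> /(IH _ us) /=; lra.
Qed.

Lemma absum_le_ge0 (I : eqType) (a : I -> C) B : absum_le a B -> 0 <= B.
Proof. by move/(_ [::] isT); rewrite big_nil. Qed.

(** The largest finite sums of absolute values exhaust the supremum, so that
    what lies outside a suitable finite set is small. *)
Lemma absum_tail (I : eqType) (a : I -> C) : absum a ->
  forall eps, 0 < eps -> exists2 s0, uniq s0 & forall t, uniq t ->
    (forall i, i \in t -> i \notin s0) -> Nsum t a < eps.
Proof.
move=> [B aB] eps e0.
pose E x := exists2 s : seq I, uniq s & x = Nsum s a.
have [||m [ub lub]] := completeness E.
- by exists B => x [s us ->]; apply: aB.
- by exists 0, [::]; rewrite ?big_nil.
have [s0 us0 hs0] : exists2 s0, uniq s0 & m - eps < Nsum s0 a.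
  apply: NNPP => hn; have : m <= m - eps; last lra.
  apply: lub => x [s us ->]; apply: Rnot_lt_le => hx; apply: hn; by exists s.
exists s0 => // t ut dis.
have : Nsum (s0 ++ t) a <= m.
  apply: ub; exists (s0 ++ t) => //; rewrite cat_uniq us0 ut andbT /=.
  by apply/hasPn => i; apply: dis.
by rewrite big_cat /=; lra.
Qed.

Lemma sums_to_unique (I : eqType) (a : I -> C) l m :
  sums_to a l -> sums_to a m -> l = m.
Proof.
move=> hl hm; suff h : Cmod (l - m) = 0.
  by rewrite -(Cplus_0_r m) -(Cmod_eq_0 _ h); ring.
apply: Rle_antisym (Cmod_ge_0 _); apply: Rnot_lt_le => h.
have [s1 h1] := hl _ (ltac:(lra) : 0 < Cmod (l - m) / 2).
have [s2 h2] := hm _ (ltac:(lra) : 0 < Cmod (l - m) / 2).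
pose s := undup (s1 ++ s2).
have sub1 : {subset s1 <= s} by move=> x xs; rewrite mem_undup mem_cat xs.
have sub2 : {subset s2 <= s} by move=> x xs; rewrite mem_undup mem_cat xs orbT.
move: (h1 s (undup_uniq _) sub1) (h2 s (undup_uniq _) sub2) => {}h1 {}h2.
have := Cmod_triangle (Csum s a - m) (- (Csum s a - l)).
rewrite Cmod_opp (_ : (_ + - _)%C = (l - m)%C); [lra|ring].
Qed.

Lemma csum_unique (I : eqType) (a : I -> C) l : sums_to a l -> csum a = l.
Proof.
move=> h; apply: sums_to_unique (h).
exact: (epsilon_spec (inhabits (RtoC 0)) (sums_to a) (ex_intro _ l h)).
Qed.

(** The finite index sets form a filter base, along which the partial sums are
    Cauchy by [absum_tail]. *)
Lemma sums_to_cauchy (I : eqType) (a : I -> C) : absum a -> exists l, sums_to a l.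
Proof.
move=> ha.
pose F (P : seq I -> Prop) := exists s0 : seq I, forall s, uniq s -> {subset s0 <= s} -> P s.
have PF : ProperFilter F.
  constructor.
  - move=> P [s0 h]; exists (undup s0); apply: h; first exact: undup_uniq.
    by move=> x; rewrite mem_undup.
  constructor.
  - by exists [::].
  - move=> P Q [s1 h1] [s2 h2]; exists (s1 ++ s2) => s us ss; split.
    + by apply: h1 => // x xs; apply: ss; rewrite mem_cat xs.
    + by apply: h2 => // x xs; apply: ss; rewrite mem_cat xs orbT.
  - by move=> P Q PQ [s0 h]; exists s0 => s us ss; apply/PQ/h.
have [|l hl] := proj1 (@filterlim_locally_cauchy _ (C_CompleteNormedModule) F PF
  (fun s => Csum s a)).
  move=> eps; have [s0 us0 hs0] := absum_tail ha (ltac:(have := cond_pos eps; lra) : 0 < eps / 2).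
  have key s : uniq s -> {subset s0 <= s} -> Cmod (Csum s a - Csum s0 a) < eps / 2.
    move=> us ss; rewrite (big_uniq_sub _ _ us us0 ss) /= -[X in (_ + X)%C]big_filter.
    rewrite (_ : (_ + _ - _)%C = Csum [seq i <- s | i \notin s0] a); last by ring.
    apply: Rle_lt_trans (Csum_norm _ _) _; apply: hs0; first exact: filter_uniq.
    by move=> i; rewrite mem_filter => /andP[].
  exists (fun s => uniq s /\ {subset s0 <= s}); split; first by exists s0 => s us ss; split.
  move=> u v [uu us] [vu vs].
  apply: (@norm_compat1 _ C_NormedModule).
  have := key _ uu us; have := key _ vu vs.
  have := Cmod_triangle (Csum v a - Csum s0 a) (- (Csum u a - Csum s0 a)).
  rewrite Cmod_opp (_ : (_ + - _)%C = (Csum v a - Csum u a)%C); last by ring.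
  rewrite /norm /minus /plus /opp /=; rewrite /Cminus; lra.
exists l => eps e0.
have := hl _ (locally_ball_norm (V := C_NormedModule) l (mkposreal _ e0)).
by case=> s0 h; exists s0 => s us ss; apply: (h s us ss).
Qed.

Lemma csumP (I : eqType) (a : I -> C) : absum a -> sums_to a (csum a).
Proof.
move=> /sums_to_cauchy h.
exact: (epsilon_spec (inhabits (RtoC 0)) (sums_to a) h).
Qed.

Lemma sums_toD (I : eqType) (a b : I -> C) l m : sums_to a l -> sums_to b m ->
  sums_to (fun i => a i + b i)%C (l + m)%C.
Proof.
move=> ha hb eps e0.
have [s1 h1] := ha _ (ltac:(lra) : 0 < eps / 2).
have [s2 h2] := hb _ (ltac:(lra) : 0 < eps / 2).
exists (s1 ++ s2) => s us ss.
have {}h1 := h1 s us (fun x xs => ss x ltac:(by rewrite mem_cat xs)).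
have {}h2 := h2 s us (fun x xs => ss x ltac:(by rewrite mem_cat xs orbT)).
rewrite big_split /=.
have := Cmod_triangle (Csum s a - l) (Csum s b - m).
rewrite (_ : (_ + _)%C = (Csum s a + Csum s b - (l + m))%C); [lra|ring].
Qed.

Lemma sums_toZ (I : eqType) (a : I -> C) l c : sums_to a l ->
  sums_to (fun i => c * a i)%C (c * l)%C.
Proof.
move=> ha eps e0; have c0 := Cmod_ge_0 c.
have [s1 h1] := ha _ (Rdiv_lt_0_compat _ (Cmod c + 1) e0 (ltac:(lra))).
exists s1 => s us ss; have {}h1 := h1 s us ss.
rewrite -big_distrr /= (_ : (_ - _)%C = (c * (Csum s a - l))%C); last by ring.
rewrite Cmod_mult.
have : Cmod (Csum s a - l) * (Cmod c + 1) < eps.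
  by apply: (Rmult_lt_reg_r (/ (Cmod c + 1))); [apply: Rinv_0_lt_compat; lra|field_simplify; lra].
by have := Cmod_ge_0 (Csum s a - l); nra.
Qed.

Lemma sums_to_conj (I : eqType) (a : I -> C) l : sums_to a l ->
  sums_to (fun i => Cconj (a i)) (Cconj l).
Proof.
move=> ha eps e0; have [s1 h1] := ha _ e0; exists s1 => s us ss.
rewrite (_ : \big[_/_]_(_ <- _) _ = Cconj (Csum s a)).
  by rewrite -Cminus_conj Cmod_conj; apply: h1.
elim/big_ind2: _ => // [|x u y v -> ->].
  by rewrite /Cconj /= Ropp_0.
by rewrite Cplus_conj.
Qed.

Lemma absum_dom (I : eqType) (a b : I -> C) (K : R) :
  0 <= K -> (forall i, Cmod (a i) <= K * Cmod (b i)) -> absum b -> absum a.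
Proof.
move=> K0 ab [B hB]; exists (K * B) => s us.
apply: Rle_trans (Rmult_le_compat_l _ _ _ K0 (hB s us)).
by rewrite big_distrr /=; apply: Rsum_le.
Qed.

Lemma absum_ext (I : eqType) (a b : I -> C) : a =1 b -> absum a -> absum b.
Proof. by move=> /functional_extensionality ->. Qed.

Lemma csum_ext (I : eqType) (a b : I -> C) : a =1 b -> csum a = csum b.
Proof. by move=> /functional_extensionality ->. Qed.

Lemma absumD (I : eqType) (a b : I -> C) : absum a -> absum b ->
  absum (fun i => a i + b i)%C.
Proof.
move=> [A hA] [B hB]; exists (A + B) => s us.
apply: Rle_trans (Rplus_le_compat _ _ _ _ (hA s us) (hB s us)).
by rewrite -big_split /=; apply: Rsum_le => i; apply: Cmod_triangle.
Qed.

Lemma absumZ (I : eqType) (a : I -> C) c : absum a -> absum (fun i => c * a i)%C.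
Proof.
apply: (absum_dom (Cmod_ge_0 c)) => i; rewrite Cmod_mult; lra.
Qed.

Lemma csumD (I : eqType) (a b : I -> C) : absum a -> absum b ->
  csum (fun i => a i + b i)%C = (csum a + csum b)%C.
Proof. by move=> ha hb; apply/csum_unique/sums_toD; apply: csumP. Qed.

Lemma csumZ (I : eqType) (a : I -> C) c : absum a ->
  csum (fun i => c * a i)%C = (c * csum a)%C.
Proof. by move=> ha; apply/csum_unique/sums_toZ; apply: csumP. Qed.

Lemma csum_bound (I : eqType) (a : I -> C) B : absum_le a B -> Cmod (csum a) <= B.
Proof.
move=> hB; have /csumP h : absum a by exists B.
apply: Rnot_lt_le => hlt.
have [s0 hs0] := h _ (ltac:(lra) : 0 < Cmod (csum a) - B).
have := hs0 _ (undup_uniq s0) ltac:(by move=> x; rewrite mem_undup).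
have := hB _ (undup_uniq s0); have := Csum_norm (undup s0) a.
have := Cmod_triangle (Csum (undup s0) a) (- (Csum (undup s0) a - csum a)).
rewrite Cmod_opp (_ : (_ + - _)%C = csum a); [lra|ring].
Qed.

Section Reindex.
Variables (I J : eqType) (e : I -> J) (f : J -> I).
Hypotheses (ef : cancel e f) (fe : cancel f e).

Lemma absum_reindex (a : J -> C) : absum a -> absum (fun i => a (e i)).
Proof.
move=> [B hB]; exists B => s us.
rewrite -(big_map e xpredT (fun j => Cmod (a j))).
by apply: (hB (map e s)); rewrite map_inj_uniq //; apply: can_inj ef.
Qed.

Lemma csum_reindex (a : J -> C) : absum a -> csum (fun i => a (e i)) = csum a.
Proof.
move=> ha; apply: csum_unique => eps e0.
have [s0 h] := csumP ha e0; exists (map f s0) => s us ss.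
rewrite -(big_map e xpredT a); apply: h.
  by rewrite map_inj_uniq //; apply: can_inj ef.
by move=> x xs; rewrite -(fe x); apply/map_f/ss/map_f.
Qed.
End Reindex.

Lemma absum_row (I J : eqType) (a : I * J -> C) : absum a ->
  forall i, absum (fun j => a (i, j)).
Proof.
move=> [B hB] i; exists B => s us.
rewrite -(big_map (fun j => (i, j)) xpredT (fun p => Cmod (a p))).
by apply: (hB (map _ s)); rewrite map_inj_uniq // => x y [].
Qed.

Lemma big_pairs (T : Type) (e : T) (op : Monoid.com_law e) (I J : eqType)
    (s : seq I) (t : seq J) (a : I * J -> T) :
  \big[op/e]_(p <- [seq (i, j) | i <- s, j <- t]) a p =
  \big[op/e]_(i <- s) \big[op/e]_(j <- t) a (i, j).
Proof. by rewrite big_allpairs_dep. Qed.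

Lemma pairs_uniq (I J : eqType) (s : seq I) (t : seq J) :
  uniq s -> uniq t -> uniq [seq (i, j) | i <- s, j <- t].
Proof. by move=> us ut; apply: allpairs_uniq => // -[? ?] [? ?] _ _ /=. Qed.

Lemma sums_to0 (I : eqType) : sums_to (fun _ : I => RtoC 0) 0.
Proof.
by move=> eps e0; exists [::] => s _ _; rewrite big1 // /Cminus Cplus_opp_r Cmod_0.
Qed.

Lemma sums_to_sum (I J : eqType) (a : I -> J -> C) (l : I -> C) (s : seq I) :
  (forall i, sums_to (a i) (l i)) ->
  sums_to (fun j => Csum s (fun i => a i j)) (Csum s l).
Proof.
move=> h; elim: s => [|i s IH].
  rewrite big_nil; under [X in sums_to X]functional_extensionality => j do rewrite big_nil.
  exact: sums_to0.
rewrite big_cons; under [X in sums_to X]functional_extensionality => j do rewrite big_cons.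
exact: sums_toD.
Qed.

(** A finite rectangle, tall enough for the chosen rows and containing a finite
    set that carries the total up to [eps / 2], is compared with both sums. *)
Lemma sums_to_fubini (I J : eqType) (a : I * J -> C) : absum a ->
  sums_to (fun i => csum (fun j => a (i, j))) (csum a).
Proof.
move=> ha eps e0.
have [s0 h0] := csumP ha (ltac:(lra) : 0 < eps / 2).
exists (map fst s0) => s us ss.
have [t0 ht] := sums_to_sum s (fun i => csumP (absum_row ha i)) (ltac:(lra) : 0 < eps / 2).
pose t := undup (t0 ++ map snd s0).
have {}ht := ht t (undup_uniq _) ltac:(by move=> x xt; rewrite mem_undup mem_cat xt).
have {}h0 := h0 _ (pairs_uniq us (undup_uniq (t0 ++ map snd s0)))
  ltac:(move=> [i j] ij; apply/allpairsP; exists (i, j); split => //=;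
    [by apply: ss; apply: (map_f fst ij)
    |by rewrite mem_undup mem_cat (map_f snd ij) orbT]).
rewrite big_pairs /= exchange_big /= in h0.
set x := \big[_/_]_(_ <- s) _ in ht *.
set y := \big[_/_]_(_ <- t) _ in ht h0.
have := Cmod_triangle (y - csum a) (- (y - x)).
by rewrite Cmod_opp (_ : (_ + - _)%C = (x - csum a)%C); [lra|ring].
Qed.

Lemma csum_fubini (I J : eqType) (a : I * J -> C) : absum a ->
  csum a = csum (fun i => csum (fun j => a (i, j))).
Proof. by move=> ha; symmetry; apply/csum_unique/sums_to_fubini. Qed.

Lemma absum_prod (I J : eqType) (a : I -> C) (b : J -> C) : absum a -> absum b ->
  absum (fun p : I * J => a p.1 * b p.2)%C.
Proof.
move=> [A hA] [B hB]; exists (A * B) => s us.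
apply: Rle_trans (_ : \big[Rplus/0]_(p <- [seq (i, j) | i <- undup (map fst s),
    j <- undup (map snd s)]) Cmod (a p.1 * b p.2)%C <= _).
  apply: Rsum_sub => //; first by move=> *; apply: Cmod_ge_0.
  move=> [i j] ij; apply/allpairsP; exists (i, j).
  by split => //=; rewrite mem_undup; [apply: (map_f fst ij)|apply: (map_f snd ij)].
rewrite big_pairs /=; under eq_bigr => i _ do under eq_bigr => j _ do rewrite Cmod_mult.
under eq_bigr => i _ do rewrite -big_distrr /=.
rewrite -big_distrl /=.
by apply: Rmult_le_compat; try (by apply: Rsum_ge0 => i; apply: Cmod_ge_0);
  [apply: hA|apply: hB]; apply: undup_uniq.
Qed.

Lemma csum_prod (I J : eqType) (a : I -> C) (b : J -> C) : absum a -> absum b ->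
  csum (fun p : I * J => a p.1 * b p.2)%C = (csum a * csum b)%C.
Proof.
move=> ha hb; rewrite (csum_fubini (absum_prod ha hb)) /=.
rewrite (@csum_ext _ _ (fun i => csum b * a i)%C) ?csumZ //; first by ring.
by move=> i; rewrite csumZ //; ring.
Qed.

Lemma csum0 (I : eqType) : csum (fun _ : I => RtoC 0) = 0.
Proof. exact/csum_unique/sums_to0. Qed.

(** Outside a finite set both families are controlled by the small tail of the
    dominating one; on the finite set convergence is termwise. *)
Lemma csum_dominated (I : eqType) (a : nat -> I -> C) (l b : I -> C) :
  absum b -> (forall n i, Cmod (a n i) <= Cmod (b i)) ->
  (forall i, Cmod (l i) <= Cmod (b i)) ->
  (forall i, is_lim_seq (fun n => Cmod (a n i - l i)%C) 0) ->
  is_lim_seq (fun n => Cmod (csum (a n) - csum l)%C) 0.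
Proof.
move=> hb hab hlb hl.
have abs f : (forall i, Cmod (f i) <= Cmod (b i)) -> absum f.
  by move=> h; apply: (absum_dom (K := 1)) hb; [lra|move=> i; have := h i; lra].
apply/is_lim_seq_spec => eps /=; have e0 := cond_pos eps.
have [s0 us0 hs0] := absum_tail hb (ltac:(lra) : 0 < eps / 4).
have /is_lim_seq_spec : is_lim_seq (fun n => Nsum s0 (fun i => a n i - l i)%C) 0.
  elim: s0 {us0 hs0} => [|i s IH].
    apply: (is_lim_seq_ext (fun _ => 0)) => [n|]; first by rewrite big_nil.
    exact: is_lim_seq_const.
  apply: (is_lim_seq_ext (fun n => Cmod (a n i - l i)%C + Nsum s (fun j => a n j - l j)%C)).
    by move=> n; rewrite big_cons.
  by have := is_lim_seq_plus' _ _ _ _ (hl i) IH; rewrite Rplus_0_r.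
move=> /(_ (mkposreal _ (ltac:(lra) : 0 < eps / 4))) [N hN]; exists N => n nN.
have /= {}hN := hN n nN.
have -> : (csum (a n) - csum l)%C = csum (fun i => a n i + (-1) * l i)%C.
  by rewrite csumD ?csumZ //; try apply: absumZ; try (by apply: abs); ring.
rewrite Rminus_0_r Rabs_pos_eq; last exact: Cmod_ge_0.
rewrite Rminus_0_r Rabs_pos_eq in hN; last by apply: Rsum_ge0 => i; apply: Cmod_ge_0.
apply: Rle_lt_trans (_ : eps / 4 + 2 * (eps / 4) < eps); last lra.
apply: csum_bound => s us.
rewrite (bigID (mem s0)) /=; apply: Rplus_le_compat.
  apply/Rlt_le/(Rle_lt_trans _ _ _ _ hN); rewrite -big_filter.
  have E i : (a n i + -1 * l i)%C = (a n i - l i)%C by ring.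
  under eq_bigr => i _ do rewrite E.
  apply: Rsum_sub; [by move=> *; apply: Cmod_ge_0|exact: filter_uniq|].
  by move=> x; rewrite mem_filter => /andP[].
rewrite -big_filter; set t := filter _ _.
have ht : Nsum t b < eps / 4.
  by apply: hs0; [exact: filter_uniq|move=> i; rewrite mem_filter => /andP[]].
apply: Rle_trans (_ : 2 * Nsum t b <= _); last lra.
rewrite big_distrr /=; apply: Rsum_le => i.
have := Cmod_triangle (a n i) (-1 * l i); rewrite Cmod_mult.
have -> : Cmod (-1) = 1 by rewrite Cmod_R Rabs_left; lra.
by have := hab n i; have := hlb i; lra.
Qed.

Lemma sums_to_nat (a : nat -> C) l : sums_to a l ->
  is_lim_seq (fun N => Cmod (\big[Cplus/RtoC 0]_(0 <= i < N) a i - l)%C) 0.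
Proof.
move=> h; apply/is_lim_seq_spec => eps; have [s0 hs] := h _ (cond_pos eps).
exists (\max_(i <- s0) i).+1 => n nN.
rewrite Rminus_0_r Rabs_pos_eq; last exact: Cmod_ge_0.
apply: hs; first exact: iota_uniq.
move=> x xs; rewrite mem_index_iota /=; move/leP: nN; apply: leq_trans.
by rewrite ltnS; apply: leq_bigmax_seq.
Qed.

(** * The complex exponential *)

Lemma Ceq (z w : C) : Re z = Re w -> Im z = Im w -> z = w.
Proof. by case: z w => [? ?] [? ?] /= -> ->. Qed.

Lemma Cmod_le_parts (z : C) : Cmod z <= Rabs (Re z) + Rabs (Im z).
Proof.
have {1}-> : z = (RtoC (Re z) + Ci * RtoC (Im z))%C.
  by case: z => x y; apply: Ceq => /=; ring.
apply: Rle_trans (Cmod_triangle _ _) _.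
rewrite Cmod_mult !Cmod_R (_ : Cmod Ci = 1); first lra.
by rewrite /Cmod /= !Rmult_0_l !Rmult_1_l Rplus_0_l sqrt_1.
Qed.

Lemma Im_le_Cmod (z : C) : Rabs (Im z) <= Cmod z.
Proof. exact: Rle_trans (Rmax_r _ _) (Rmax_Cmod z). Qed.

Lemma Cexp_add z w : Cexp (z + w) = (Cexp z * Cexp w)%C.
Proof.
case: z w => [x y] [u v]; by apply: Ceq; rewrite /Cexp /= exp_plus ?cos_plus ?sin_plus; ring.
Qed.

Lemma Cexp_RtoC x : Cexp (RtoC x) = RtoC (exp x).
Proof. by apply: Ceq; rewrite /= ?cos_0 ?sin_0; ring. Qed.

Lemma Cexp_0 : Cexp 0 = 1.
Proof. by rewrite Cexp_RtoC exp_0. Qed.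

Lemma Cmod_Cexp z : Cmod (Cexp z) = exp (Re z).
Proof.
rewrite /Cmod /Cexp /= !Rmult_1_r.
have -> : exp (Re z) * cos (Im z) * (exp (Re z) * cos (Im z)) +
  exp (Re z) * sin (Im z) * (exp (Re z) * sin (Im z)) = (exp (Re z))^2.
  have := sin2_cos2 (Im z); rewrite /Rsqr => h.
  by rewrite -(Rmult_1_r (exp _ ^ 2)) -h; ring.
rewrite sqrt_pow2 //; exact/Rlt_le/exp_pos.
Qed.

Lemma Cexp_conj z : Cconj (Cexp z) = Cexp (Cconj z).
Proof. case: z => x y; by apply: Ceq; rewrite /= ?cos_neg ?sin_neg; ring. Qed.

Lemma exp_mono x y : x <= y -> exp x <= exp y.
Proof. by case=> [/exp_increasing|->]; lra. Qed.

Lemma exp_taylor x : Rabs (exp x - 1 - x) <= x ^ 2 * exp (Rabs x).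
Proof.
have h1 := exp_ineq1_le x; have h2 := exp_ineq1_le (- x).
have hx := exp_pos x; have hy := exp_pos (- x).
have e : exp x * exp (- x) = 1 by rewrite -exp_plus Rplus_opp_r exp_0.
rewrite Rabs_pos_eq; last lra.
case: (Rle_dec 0 x) => x0.
  rewrite Rabs_pos_eq //; have : exp x - 1 <= x * exp x by nra.
  by nra.
have : 1 <= exp (Rabs x) by have := exp_ineq1_le (Rabs x); have := Rabs_pos x; lra.
have : exp x * (1 - x) <= 1 by nra.
move=> a b; have : exp x <= 1 + x + x ^ 2 by nra.
by nra.
Qed.

Lemma sin_le_abs y : Rabs (sin y) <= Rabs y.
Proof.
wlog y0 : y / 0 < y.
  move=> H; case: (Rtotal_order y 0) => [h|[->|h]]; last exact: H.
    by have := H (- y) ltac:(lra); rewrite sin_neg !Rabs_Ropp.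
  by rewrite sin_0; lra.
rewrite (Rabs_pos_eq y); last lra.
have := sin_lt_x y y0; have := SIN_bound y; have := PI2_1.
case: (Rle_dec y 1) => h; last by move=> *; apply: Rabs_le; lra.
by move=> *; apply: Rabs_le; have := sin_ge_0 y ltac:(lra) ltac:(lra); lra.
Qed.

Lemma cos_half y : Rabs (cos y - 1) = 2 * Rabs (sin (y / 2)) ^ 2.
Proof.
have -> : cos y - 1 = - (2 * (sin (y / 2)) ^ 2).
  by rewrite {1}(_ : y = 2 * (y / 2)) ?cos_2a_sin; [ring|field].
by rewrite Rabs_Ropp Rabs_pos_eq ?pow2_abs //; nra.
Qed.

Lemma cos_taylor y : Rabs (cos y - 1) <= y ^ 2 /\ Rabs (cos y - 1) <= Rabs y.
Proof.
rewrite cos_half; have := sin_le_abs (y / 2); have := Rabs_pos (sin (y / 2)).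
have : Rabs (sin (y / 2)) <= 1 by apply: Rabs_le; apply: SIN_bound.
rewrite -(pow2_abs y).
have -> : Rabs (y / 2) = Rabs y / 2 by rewrite Rabs_mult (Rabs_pos_eq (/ 2)); lra.
by move=> *; split; nra.
Qed.

(** The mean value theorem reduces this to [cos c - 1], which is bounded by [|c|]. *)
Lemma sin_taylor y : Rabs (sin y - y) <= y ^ 2.
Proof.
have [||c [hc]] := MVT_gen (fun t => sin t - t) 0 y (fun t => cos t - 1).
- by move=> x _; auto_derive => //; ring.
- move=> x _; apply: continuity_pt_minus; first exact: continuity_sin.
  exact: derivable_continuous_pt (derivable_pt_id x).
rewrite sin_0 !Rminus_0_r => ->; rewrite Rabs_mult -(pow2_abs y).
have : Rabs c <= Rabs y.
  by move: hc; rewrite /Rmin /Rmax; case: Rle_dec => _ h; apply: Rabs_le;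
    split_Rabs; lra.
have [_ h] := cos_taylor c; have := Rabs_pos y; nra.
Qed.

(** The constant 5 counts the remainders of the real and imaginary parts. *)
Lemma Cexp_taylor w : Cmod (Cexp w - 1 - w) <= 5 * (Cmod w) ^ 2 * exp (Cmod w).
Proof.
apply: Rle_trans (Cmod_le_parts _) _.
have hx := re_le_Cmod w; have hy := Im_le_Cmod w; have h0 := Cmod_ge_0 w.
case: w hx hy h0 => x y /=; set R0 := Cmod _ => hx hy h0.
have e1 : exp (Rabs x) <= exp R0 by case: hx => [/exp_increasing|->]; lra.
have e2 : 1 <= exp R0 by have := exp_ineq1_le R0; lra.
have e3 : exp x <= exp R0.
  have : x <= R0 by have := Rle_abs x; lra.
  by case=> [/exp_increasing|->]; lra.
have x2 : x ^ 2 <= R0 ^ 2 by rewrite -pow2_abs; have := Rabs_pos x; nra.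
have y2 : y ^ 2 <= R0 ^ 2 by rewrite -pow2_abs; have := Rabs_pos y; nra.
have ex := exp_taylor x; have [cy _] := cos_taylor y; have sy := sin_taylor y.
have sy' := sin_le_abs y.
have E0 := exp_pos x.
have x20 : 0 <= x ^ 2 by nra.
have y20 : 0 <= y ^ 2 by nra.
have R2 : 0 <= R0 ^ 2 by nra.
have A : Rabs (exp x - 1 - x) <= R0 ^ 2 * exp R0.
  by apply: Rle_trans ex _; apply: Rmult_le_compat => //; exact/Rlt_le/exp_pos.
have B : Rabs (exp x * (cos y - 1)) <= R0 ^ 2 * exp R0.
  rewrite Rabs_mult Rmult_comm; apply: Rmult_le_compat; try exact: Rabs_pos; first lra.
  by rewrite Rabs_pos_eq; lra.
have C1 : Rabs ((exp x - 1 - x) * sin y) <= R0 ^ 2 * exp R0.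
  rewrite Rabs_mult -(Rmult_1_r (_ * exp R0)).
  apply: Rmult_le_compat; [exact: Rabs_pos|exact: Rabs_pos|exact: A|].
  by apply: Rabs_le; apply: SIN_bound.
have C2 : Rabs (x * sin y) <= R0 ^ 2 * exp R0.
  rewrite Rabs_mult; have := Rabs_pos x; have := Rabs_pos (sin y) => p1 p2.
  have : Rabs x * Rabs (sin y) <= R0 ^ 2 by nra.
  by nra.
have C3 : Rabs (sin y - y) <= R0 ^ 2 * exp R0.
  by nra.
have -> : exp x * cos y + - (1) + - x = (exp x - 1 - x) + exp x * (cos y - 1) by ring.
have -> : exp x * sin y + - 0 + - y =
  (exp x - 1 - x) * sin y + x * sin y + (sin y - y) by ring.
have := Rabs_triang (exp x - 1 - x) (exp x * (cos y - 1)).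
have := Rabs_triang ((exp x - 1 - x) * sin y + x * sin y) (sin y - y).
have := Rabs_triang ((exp x - 1 - x) * sin y) (x * sin y).
lra.
Qed.

(** * Complex derivatives *)

Lemma C_is_derive_eps (f : C -> C) z l :
  (forall eps, 0 < eps -> exists2 d, 0 < d &
    forall h, Cmod h < d -> Cmod (f (z + h) - f z - h * l)%C <= eps * Cmod h) ->
  is_derive f z l.
Proof.
move=> H; split; first exact: is_linear_scal_l.
move=> x /is_filter_lim_locally_unique <- eps.
have [d d0 hd] := H _ (cond_pos eps).
exists (mkposreal _ d0) => y yx.
have {}yx : Cmod (y - z)%C < d := yx.
have := hd _ yx; by rewrite (_ : (z + (y - z))%C = y); last by ring.
Qed.

(** The codomain of a complex derivative carries the product uniform structure
    while the multiplication rule of the library uses that of the absolute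
    value; only the norm matters for differentiability, so they agree. *)
Lemma C_is_derive_absring (f : C -> C) (z l : C) :
  is_derive (K := C_AbsRing) (V := AbsRing_NormedModule C_AbsRing) f z l <->
  is_derive (K := C_AbsRing) (V := C_NormedModule) f z l.
Proof. by split; move=> [_ h]; split; [exact: is_linear_scal_l|exact: h|exact: is_linear_scal_l|exact: h]. Qed.

Lemma is_derive_Cinv (z : C) : z <> 0 -> is_derive Cinv z (- / (z * z))%C.
Proof.
move=> z0; have m0 : 0 < Cmod z by apply/Cmod_gt_0.
apply: C_is_derive_eps => eps e0.
pose d := Rmin (Cmod z / 2) (eps * Cmod z ^ 3 / 2).
have p3 : 0 < Cmod z ^ 3 by apply: pow_lt.
have d0 : 0 < d by apply: Rmin_pos; [lra|nra].
exists d => // h hd.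
have hd1 : Cmod h < Cmod z / 2 by apply: Rlt_le_trans hd _; apply: Rmin_l.
have hd2 : Cmod h < eps * Cmod z ^ 3 / 2 by apply: Rlt_le_trans hd _; apply: Rmin_r.
have zh : Cmod z / 2 < Cmod (z + h).
  have := Cmod_triangle (z + h) (- h); rewrite Cmod_opp.
  by rewrite (_ : (_ + - _)%C = z); [lra|ring].
have zh0 : (z + h)%C <> 0 by move=> E; rewrite E Cmod_0 in zh; lra.
have -> : (/ (z + h) - / z - h * - / (z * z) = h * (h * / (z * z * (z + h))))%C.
  by field.
rewrite Cmod_mult Rmult_comm; apply: Rmult_le_compat_r; first exact: Cmod_ge_0.
rewrite Cmod_mult Cmod_inv; last by do 2?apply: Cmult_neq_0.
rewrite !Cmod_mult.
have h0 := Cmod_ge_0 h.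
have P : 0 < Cmod z * Cmod z * Cmod (z + h) by repeat apply: Rmult_lt_0_compat; lra.
apply: (Rmult_le_reg_r (Cmod z * Cmod z * Cmod (z + h))) => //.
rewrite Rmult_assoc Rinv_l; last lra.
have : Cmod z ^ 3 / 2 <= Cmod z * Cmod z * Cmod (z + h) by nra.
by nra.
Qed.

Lemma is_derive_Cdiv (f g : C -> C) (z df dg : C) :
  is_derive f z df -> is_derive g z dg -> g z <> 0 ->
  is_derive (fun w => f w / g w)%C z ((df * g z - f z * dg) / (g z * g z))%C.
Proof.
move=> /C_is_derive_absring hf /C_is_derive_absring hg g0.
apply/C_is_derive_absring.
have hi := is_derive_comp (V := AbsRing_NormedModule C_AbsRing) _ _ _ _ _
  (proj2 (C_is_derive_absring _ _ _) (is_derive_Cinv g0)) hg.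
have := is_derive_mult _ _ _ _ _ hf hi Cmult_comm.
congr is_derive; rewrite /plus /mult /scal /= /mult /=.
by field.
Qed.

(** * Exponential sums *)

Lemma absum_inj (I J : eqType) (g : I -> J) (a : I -> C) (b : J -> C) :
  injective g -> (forall i, Cmod (a i) <= Cmod (b (g i))) -> absum b -> absum a.
Proof.
move=> gi ab [B hB]; exists B => s us.
apply: Rle_trans (hB (map g s) _); last by rewrite map_inj_uniq.
by rewrite big_map; apply: Rsum_le.
Qed.

Lemma absum_geom (e : R) : 0 < e -> absum (fun n : nat => RtoC (exp (- (e * INR n)))).
Proof.
move=> e0; pose x := exp (- e).
have x0 : 0 < x by apply: exp_pos.
have x1 : x < 1 by rewrite -exp_0; apply: exp_increasing; lra.
exists (/ (1 - x)) => s us.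
apply: Rle_trans (_ : \big[Rplus/0]_(0 <= i < (\max_(i <- s) i).+1)
  Cmod (RtoC (exp (- (e * INR i)))) <= _).
  apply: Rsum_sub => //; first by move=> *; apply: Cmod_ge_0.
  by move=> n ns; rewrite mem_index_iota ltnS; apply: leq_bigmax_seq.
have E N : \big[Rplus/0]_(0 <= i < N) Cmod (RtoC (exp (- (e * INR i)))) =
    (1 - exp (- (e * INR N))) / (1 - x).
  elim: N => [|N IH].
    by rewrite big_geq //= Rmult_0_r Ropp_0 exp_0; field; lra.
  rewrite big_nat_recr //= IH Cmod_R Rabs_pos_eq; last exact/Rlt_le/exp_pos.
  rewrite -/(INR N.+1) S_INR (_ : - (e * (INR N + 1)) = - (e * INR N) + - e); last by ring.
  by rewrite exp_plus -/x; field; lra.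
rewrite E /Rdiv -{2}(Rmult_1_l (/ _)); apply: Rmult_le_compat_r.
  by apply/Rlt_le/Rinv_0_lt_compat; lra.
by have := exp_pos (- (e * INR (\max_(i <- s) i).+1)); lra.
Qed.

Lemma Rabs_IZR (k : Z) : Rabs (IZR k) = INR (Z.to_nat k) + INR (Z.to_nat (- k)).
Proof.
rewrite !INR_IZR_INZ; case: (Z.le_gt_cases 0 k) => k0.
  rewrite Z2Nat.id // (_ : Z.to_nat (- k) = 0%N); last by lia.
  by rewrite Rabs_pos_eq /=; [ring|apply: IZR_le].
rewrite (_ : Z.to_nat k = 0%N); last by lia.
rewrite Z2Nat.id; last by lia.
by rewrite opp_IZR Rabs_left /=; [ring|apply: IZR_lt].
Qed.

Lemma absum_Zgeom : absum (fun k : Z => RtoC (exp (- Rabs (IZR k)))).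
Proof.
(* An integer is encoded by its positive and negative parts. *)
pose g k := (Z.to_nat k, Z.to_nat (- k)).
have gK : forall k, Z.sub (Z.of_nat (g k).1) (Z.of_nat (g k).2) = k.
  by move=> k; rewrite /g /=; lia.
apply: (@absum_inj _ _ g _ (fun p => RtoC (exp (- (1 * INR p.1))) *
  RtoC (exp (- (1 * INR p.2))))%C); [|move=> k|].
- by move=> x y e; rewrite -(gK x) e gK.
- rewrite -RtoC_mult -exp_plus !Cmod_R !(Rabs_pos_eq (exp _)); try exact/Rlt_le/exp_pos.
  apply: Req_le; congr exp; rewrite /g /= !Rmult_1_l Rabs_IZR; ring.
- by apply: (@absum_prod nat nat (fun n => RtoC (exp (- (1 * INR n))))
    (fun n => RtoC (exp (- (1 * INR n))))); apply: absum_geom; lra.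
Qed.

(** Each factor [|k + h|] is absorbed by [exp |k + h|], at the price of raising
    [M] by one; once [p = 0], complete the square. *)
Lemma absum_gauss (h : R) (p : nat) (r M : R) : 0 < r -> 0 <= M ->
  absum (fun k : Z => RtoC (Rabs (IZR k + h) ^ p *
    exp (- r * (IZR k + h) ^ 2 + M * Rabs (IZR k + h)))).
Proof.
move=> r0; elim: p M => [|p IH] M M0.
  apply: (absum_dom (K := exp ((M + 1) ^ 2 / (4 * r) + Rabs h))) absum_Zgeom.
    exact/Rlt_le/exp_pos.
  move=> k; rewrite !Cmod_R /= Rmult_1_l !(Rabs_pos_eq (exp _)); try exact/Rlt_le/exp_pos.
  rewrite -exp_plus; apply: exp_mono.
  have : Rabs (IZR k) <= Rabs (IZR k + h) + Rabs h.
    have := Rabs_triang (IZR k + h) (- h); rewrite Rabs_Ropp.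
    by rewrite (_ : IZR k + h + - h = IZR k) //; ring.
  rewrite Rmult_1_r -/(Rsqr _) Rsqr_abs /Rsqr; set x := Rabs (_ + _) => hx.
  have : - r * (x * x) + (M + 1) * x <= (M + 1) * ((M + 1) * 1) / (4 * r).
    apply: (Rmult_le_reg_r (4 * r)); first lra.
    rewrite /Rdiv Rmult_assoc Rinv_l; last lra.
    have := pow2_ge_0 (2 * r * x - (M + 1)); nra.
  by lra.
apply: (absum_dom (K := 1)) (IH (M + 1) _); [lra| |lra] => k.
have pos n y : 0 <= Rabs (IZR k + h) ^ n * exp y.
  by apply: Rmult_le_pos; [apply/pow_le/Rabs_pos|exact/Rlt_le/exp_pos].
rewrite !Cmod_R Rmult_1_l (Rabs_pos_eq _ (pos _ _)) (Rabs_pos_eq _ (pos _ _)).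
rewrite /= (Rmult_comm (Rabs _)) Rmult_assoc; apply: Rmult_le_compat_l.
  exact/pow_le/Rabs_pos.
have -> : - r * ((IZR k + h) * ((IZR k + h) * 1)) + (M + 1) * Rabs (IZR k + h) =
  Rabs (IZR k + h) + (- r * ((IZR k + h) * ((IZR k + h) * 1)) + M * Rabs (IZR k + h)).
  by ring.
rewrite [X in _ <= X]exp_plus; apply: Rmult_le_compat_r; first exact/Rlt_le/exp_pos.
by have := exp_ineq1_le (Rabs (IZR k + h)); lra.
Qed.

(** Differentiation under the sum: each remainder [exp (l h) - 1 - l h] is at most
    quadratic in [h].  Stating the estimate rather than a derivative lets the
    same lemma serve a complex variable, for [z], and a real one, for [r]. *)
Lemma exp_sum_quad (I : eqType) (c l : I -> C) (d : R) :
  0 < d -> absum c -> absum (fun i => c i * l i)%C ->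
  absum (fun i => c i * (l i * l i) * RtoC (exp (d * Cmod (l i))))%C ->
  exists2 M, 0 <= M & forall h, Cmod h <= d ->
    absum (fun i => c i * Cexp (l i * h))%C /\
    Cmod (csum (fun i => c i * Cexp (l i * h)) - csum c
          - h * csum (fun i => c i * l i))%C <= M * Cmod h ^ 2.
Proof.
move=> d0 hc hl [B hB]; have B0 := absum_le_ge0 hB.
exists (5 * B); first lra; move=> h hd; have h0 := Cmod_ge_0 h.
pose rest i := (c i * (Cexp (l i * h) - 1 - l i * h))%C.
have hr : absum_le rest (5 * B * Cmod h ^ 2).
  move=> s us; apply: Rle_trans (_ : 5 * Cmod h ^ 2 * Nsum s
    (fun i => c i * (l i * l i) * RtoC (exp (d * Cmod (l i))))%C <= _).
    rewrite big_distrr /=; apply: Rsum_le => i; rewrite /rest !Cmod_mult Cmod_R.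
    rewrite (Rabs_pos_eq (exp _)); last exact/Rlt_le/exp_pos.
    have := Cexp_taylor (l i * h); rewrite Cmod_mult => ht.
    have c0 := Cmod_ge_0 (c i); have l0 := Cmod_ge_0 (l i).
    have : exp (Cmod (l i) * Cmod h) <= exp (d * Cmod (l i)) by apply: exp_mono; nra.
    set x := exp _ in ht *; set y := exp _ => xy.
    apply: Rle_trans (_ : Cmod (c i) * (5 * (Cmod (l i) * Cmod h) ^ 2 * y) <= _).
      apply: Rmult_le_compat_l => //; apply: Rle_trans ht _.
      by apply: Rmult_le_compat_l => //; have := pow2_ge_0 (Cmod (l i) * Cmod h); lra.
    by apply: Req_le; ring.
  have hs := hB s us; have H0 := pow2_ge_0 (Cmod h).
  by have := Rmult_le_compat_l (5 * Cmod h ^ 2) _ _ ltac:(lra) hs; lra.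
have ar : absum rest by exists (5 * B * Cmod h ^ 2).
have E i : (c i * Cexp (l i * h))%C = (rest i + (c i + h * (c i * l i)))%C.
  by rewrite /rest; ring.
have a1 := absumD hc (absumZ h hl).
split; first by apply: absum_ext (absumD ar a1) => i; rewrite E.
rewrite (csum_ext E) csumD // csumD ?csumZ //; last exact: absumZ.
by apply: Rle_trans (csum_bound hr); apply: Req_le; congr Cmod; ring.
Qed.

(** * Theta series with characteristic *)

Definition sgnZ (k : Z) : R := if Z.even k then 1 else -1.

Lemma sgnZ_add k l : sgnZ (k + l) = sgnZ k * sgnZ l.
Proof. by rewrite /sgnZ Z.even_add; case: Z.even; case: Z.even => /=; ring. Qed.

Lemma sgnZ_opp k : sgnZ (- k) = sgnZ k.
Proof. by rewrite /sgnZ Z.even_opp. Qed.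

Lemma sgnZ_norm k : Cmod (sgnZ k) = 1.
Proof.
by rewrite Cmod_R /sgnZ; case: Z.even; [rewrite Rabs_R1|rewrite Rabs_left; lra].
Qed.

(** The characteristic [h] shifts the summation index, and [p] counts derivatives
    in [z]: [h = 0] will give [Theta3], and [h = 1/2] gives [Theta1] up to the
    factor [- i]. *)
Definition theta_term (h : R) (p : nat) (r : R) (z : C) (k : Z) : C :=
  (RtoC (sgnZ k) * (Ci * RtoC (IZR k + h)) ^ p
   * Cexp (RtoC (- r * (IZR k + h) ^ 2) + Ci * RtoC (IZR k + h) * z))%C.

Definition theta (h : R) (p : nat) (r : R) (z : C) : C :=
  csum (theta_term h p r z).

Lemma Cmod_Ci : Cmod Ci = 1.
Proof. by rewrite /Cmod /= !Rmult_0_l !Rmult_1_l Rplus_0_l sqrt_1. Qed.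

Lemma Cmod_pow z n : Cmod (z ^ n)%C = Cmod z ^ n.
Proof. by elim: n => [|n IH] /=; rewrite ?Cmod_1 // Cmod_mult IH. Qed.

Lemma theta_term_le h p r z k : Cmod (theta_term h p r z k) <=
  Rabs (IZR k + h) ^ p * exp (- r * (IZR k + h) ^ 2 + Cmod z * Rabs (IZR k + h)).
Proof.
rewrite /theta_term !Cmod_mult sgnZ_norm Cmod_pow Cmod_mult Cmod_Ci Cmod_R !Rmult_1_l.
apply: Rmult_le_compat_l; first exact/pow_le/Rabs_pos.
rewrite Cmod_Cexp; apply: exp_mono.
set x := IZR k + h.
have -> : Re (RtoC (- r * x ^ 2) + Ci * RtoC x * z)%C = - r * x ^ 2 - x * Im z.
  by case: z => u v /=; ring.
have h1 := Im_le_Cmod z; have := Rabs_pos x.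
have : - (x * Im z) <= Rabs x * Rabs (Im z).
  by rewrite -Rabs_mult; have := Rle_abs (- (x * Im z)); rewrite Rabs_Ropp.
by nra.
Qed.

Lemma absum_gauss_le (a : Z -> C) h p r M : 0 < r -> 0 <= M ->
  (forall k, Cmod (a k) <= Rabs (IZR k + h) ^ p *
    exp (- r * (IZR k + h) ^ 2 + M * Rabs (IZR k + h))) -> absum a.
Proof.
move=> r0 M0 ha; apply: (absum_dom (K := 1)) (absum_gauss h p r0 M0); first lra.
move=> k; rewrite Rmult_1_l Cmod_R; exact: Rle_trans (ha k) (Rle_abs _).
Qed.

Lemma absum_theta h p r z : 0 < r -> absum (theta_term h p r z).
Proof.
move=> r0; exact: (absum_gauss_le r0 (Cmod_ge_0 z) (fun k => theta_term_le h p r z k)).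
Qed.

Lemma theta_z_quad h p r z : 0 < r -> exists2 M, 0 <= M & forall e, Cmod e <= 1 ->
  Cmod (theta h p r (z + e) - theta h p r z - e * theta h p.+1 r z)%C <= M * Cmod e ^ 2.
Proof.
move=> r0; pose l k := (Ci * RtoC (IZR k + h))%C.
have El k : (theta_term h p r z k * l k)%C = theta_term h p.+1 r z k.
  by rewrite /theta_term /l /=; ring.
have [||M M0 hM] := exp_sum_quad (d := 1) (l := l) Rlt_0_1 (absum_theta h p z r0).
- by apply: absum_ext (absum_theta h p.+1 z r0) => k; rewrite El.
- apply: (@absum_gauss_le _ h p.+2 r (Cmod z + 1)) => //.
    by have := Cmod_ge_0 z; lra.
  move=> k; rewrite Cmod_mult (_ : (_ * (_ * _))%C = theta_term h p.+2 r z k); last first.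
    by rewrite /theta_term /l /=; ring.
  rewrite Cmod_R Rabs_pos_eq; last exact/Rlt_le/exp_pos.
  rewrite Rmult_1_l /l Cmod_mult Cmod_Ci Rmult_1_l Cmod_R.
  rewrite Rmult_plus_distr_r Rmult_1_l -Rplus_assoc exp_plus -Rmult_assoc.
  apply: Rmult_le_compat_r; first exact/Rlt_le/exp_pos.
  exact: theta_term_le.
exists M => // e e1; have [_ {}hM] := hM e e1.
rewrite (csum_ext El) in hM; rewrite /theta.
rewrite (@csum_ext _ (theta_term h p r (z + e)) (fun k => theta_term h p r z k * Cexp (l k * e))%C) //.
move=> k; rewrite /theta_term /l -!Cmult_assoc -Cexp_add; congr (_ * (_ * Cexp _))%C.
by ring.
Qed.

(** Two derivatives in [z] multiply a term by [- (k + h) ^ 2], its rate of decay in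
    [r]: this is the heat equation. *)
Lemma theta_r_quad h p r z : 0 < r -> exists2 M, 0 <= M & forall e : R, Rabs e <= r / 2 ->
  Cmod (theta h p (r + e) z - theta h p r z - e * theta h p.+2 r z)%C <= M * Rabs e ^ 2.
Proof.
move=> r0; pose l k := RtoC (- (IZR k + h) ^ 2).
have El k : (theta_term h p r z k * l k)%C = theta_term h p.+2 r z k.
  rewrite /theta_term /l; set y := IZR k + h; set E := Cexp _.
  have -> : RtoC (- y ^ 2) = (Ci * RtoC y * (Ci * RtoC y))%C by apply: Ceq => /=; ring.
  by rewrite /=; ring.
have rd : 0 < r / 2 by lra.
have [||M M0 hM] := exp_sum_quad (l := l) rd (absum_theta h p z r0).
- by apply: absum_ext (absum_theta h p.+2 z r0) => k; rewrite El.
- apply: (@absum_gauss_le _ h p.+4 (r / 2) (Cmod z)) => //; first exact: Cmod_ge_0.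
  move=> k; rewrite Cmod_mult Cmod_mult Cmod_mult /l !Cmod_R.
  rewrite (Rabs_pos_eq (exp _)); last exact/Rlt_le/exp_pos.
  have -> : Rabs (- (IZR k + h) ^ 2) = Rabs (IZR k + h) ^ 2.
    by rewrite Rabs_Ropp RPow_abs.
  have := theta_term_le h p r z k; set x := Rabs _; set y := IZR k + h => ht.
  have xy : x ^ 2 = y ^ 2 by rewrite /x pow2_abs.
  have -> : - (r / 2) * y ^ 2 + Cmod z * x =
    (- r * y ^ 2 + Cmod z * x) + r / 2 * x ^ 2 by rewrite xy; field.
  rewrite [X in _ <= _ * X]exp_plus -[X in _ <= X]Rmult_assoc; apply: Rmult_le_compat_r.
    exact/Rlt_le/exp_pos.
  apply: Rle_trans (Rmult_le_compat_r _ _ _ _ ht) _; last by apply: Req_le => /=; ring.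
  by have := pow2_ge_0 x; nra.
exists M => // e e1; have [|_ {}hM] := hM e; first by rewrite Cmod_R.
rewrite (csum_ext El) Cmod_R in hM; rewrite /theta.
rewrite (@csum_ext _ (theta_term h p (r + e) z) (fun k => theta_term h p r z k * Cexp (l k * e))%C) //.
move=> k; rewrite /theta_term /l -!Cmult_assoc -Cexp_add; congr (_ * (_ * Cexp _))%C.
set x := IZR k + h; set w := (Ci * RtoC x * z)%C.
have -> : - (r + e) * x ^ 2 = - r * x ^ 2 + - x ^ 2 * e by ring.
by rewrite RtoC_plus (RtoC_mult (- x ^ 2)); ring.
Qed.

Lemma is_derive_theta h p r z : 0 < r -> is_derive (theta h p r) z (theta h p.+1 r z).
Proof.
move=> r0; have [M M0 hM] := theta_z_quad h p z r0.
apply: C_is_derive_eps => eps e0.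
have d0 : 0 < eps / (M + 1) by apply: Rdiv_lt_0_compat; lra.
exists (Rmin 1 (eps / (M + 1))); first by apply: Rmin_pos; lra.
move=> e he; have e1 := Rlt_le_trans _ _ _ he (Rmin_l _ _).
have e2 := Rlt_le_trans _ _ _ he (Rmin_r _ _).
apply: Rle_trans (hM e (Rlt_le _ _ e1)) _; have := Cmod_ge_0 e.
have : Cmod e * (M + 1) <= eps.
  apply: (Rmult_le_reg_r (/ (M + 1))); first by apply: Rinv_0_lt_compat; lra.
  by rewrite Rmult_assoc Rinv_r ?Rmult_1_r; lra.
by nra.
Qed.

Lemma is_derive_Re (F : R -> C) (x : R) (l : C) (M d : R) : 0 < d ->
  (forall e, Rabs e <= d -> Cmod (F (Rplus x e) - F x - RtoC e * l)%C <= M * Rabs e ^ 2) ->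
  is_derive (fun t => Re (F t)) x (Re l).
Proof.
move=> d0 hM; split; first exact: is_linear_scal_l.
move=> y /is_filter_lim_locally_unique <- eps; have e0 := cond_pos eps.
have M0 := Rle_abs M; have M1 := Rabs_pos M.
have d1 : 0 < eps / (Rabs M + 1) by apply: Rdiv_lt_0_compat; lra.
have dm : 0 < Rmin d (eps / (Rabs M + 1)) by apply: Rmin_pos; lra.
exists (mkposreal _ dm) => t ht.
have {}ht : Rabs (t - x) < Rmin d (eps / (Rabs M + 1)) := ht.
have e1 := Rlt_le_trans _ _ _ ht (Rmin_l _ _).
have e2 := Rlt_le_trans _ _ _ ht (Rmin_r _ _).
have {hM} := hM _ (Rlt_le _ _ e1); rewrite (_ : x + (t - x) = t); last by ring.
have : Rabs (t - x) * (Rabs M + 1) <= eps.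
  apply: (Rmult_le_reg_r (/ (Rabs M + 1))); first by apply: Rinv_0_lt_compat; lra.
  by rewrite Rmult_assoc Rinv_r ?Rmult_1_r; lra.
have := re_le_Cmod (F t - F x - RtoC (t - x) * l).
rewrite /norm /minus /plus /opp /scal /= /mult /abs /=.
have -> : (F t).1 + - (F x).1 + - ((t - x) * l.1 - 0 * l.2) =
  Re (F t) + - Re (F x) + - ((t + - x) * Re l) by rewrite /Re; ring.
by have := Rabs_pos (t - x); rewrite /Rminus; nra.
Qed.

Lemma Cpow_opp (w : C) p : ((- w) ^ p = RtoC ((-1) ^ p) * w ^ p)%C.
Proof.
elim: p => [|p IH] /=; first by ring.
by rewrite IH RtoC_mult; ring.
Qed.

Lemma Cconj_pow (w : C) p : Cconj (w ^ p) = (Cconj w ^ p)%C.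
Proof.
elim: p => [|p IH] /=; first by apply: Ceq => /=; ring.
by rewrite Cmult_conj IH.
Qed.

(** With [m = 2 h], the reflection [k -> - m - k] changes [k + h] into its
    opposite, and the sign of the term by [sgnZ m]. *)
Lemma theta_opp (m : Z) h p r z : 0 < r -> IZR m = 2 * h ->
  theta h p r (- z) = (RtoC (sgnZ m * (-1) ^ p) * theta h p r z)%C.
Proof.
move=> r0 hm; pose e k := (- m - k)%Z.
have eK : cancel e e by move=> k; rewrite /e; lia.
rewrite /theta -(csum_reindex eK eK (absum_theta h p z r0)) -csumZ; last first.
  exact: (absum_reindex eK (absum_theta h p z r0)).
apply: csum_ext => k; rewrite /theta_term /e.
have -> : IZR (- m - k) + h = - (IZR k + h) by rewrite minus_IZR opp_IZR hm; ring.
rewrite (_ : sgnZ (- m - k) = sgnZ m * sgnZ k); last first.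
  by rewrite -Z.add_opp_r sgnZ_add !sgnZ_opp.
set x := IZR k + h.
have -> : - r * (- x) ^ 2 = - r * x ^ 2 by ring.
have -> : (Ci * RtoC (- x) * z = Ci * RtoC x * - z)%C by rewrite RtoC_opp; ring.
have -> : ((Ci * RtoC (- x)) ^ p = RtoC ((-1) ^ p) * (Ci * RtoC x) ^ p)%C.
  by rewrite -Cpow_opp RtoC_opp; congr Cpow; ring.
have sq (s : R) : s = 1 \/ s = -1 -> s * s = 1 by case=> ->; ring.
have s1 : sgnZ m * sgnZ m = 1 by apply: sq; rewrite /sgnZ; case: Z.even; [left|right].
have s2 : (-1) ^ p * (-1) ^ p = 1.
  by rewrite -Rpow_mult_distr (_ : -1 * -1 = 1) ?pow1 //; ring.
rewrite !RtoC_mult; set E := Cexp _; set P := (_ ^ p)%C.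
transitivity (RtoC (sgnZ m * sgnZ m) * RtoC ((-1) ^ p * (-1) ^ p) * (sgnZ k * P * E))%C.
  by rewrite s1 s2; ring.
by rewrite !RtoC_mult; ring.
Qed.

(** At a real point, conjugation turns a term into the [(-1) ^ p] multiple of the
    term at [- x]; then apply [theta_opp]. *)
Lemma theta_conj (m : Z) h p r x : 0 < r -> IZR m = 2 * h ->
  Cconj (theta h p r (RtoC x)) = (RtoC (sgnZ m) * theta h p r (RtoC x))%C.
Proof.
move=> r0 hm.
transitivity (RtoC ((-1) ^ p) * theta h p r (- RtoC x))%C; last first.
  rewrite (theta_opp _ _ r0 hm) Cmult_assoc -RtoC_mult.
  have -> : (-1) ^ p * (sgnZ m * (-1) ^ p) = sgnZ m * (-1 * -1) ^ p.
    by rewrite Rpow_mult_distr; ring.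
  by rewrite (_ : -1 * -1 = 1) ?pow1 ?Rmult_1_r //; ring.
rewrite /theta -csumZ; last exact: absum_theta.
symmetry; apply: csum_unique.
have := sums_to_conj (csumP (absum_theta h p (RtoC x) r0)).
congr sums_to; apply: functional_extensionality => k.
rewrite /theta_term !Cmult_conj Cexp_conj; set y := IZR k + h.
have -> : Cconj (RtoC (- r * y ^ 2) + Ci * RtoC y * RtoC x)%C =
  (RtoC (- r * y ^ 2) + Ci * RtoC y * - RtoC x)%C by apply: Ceq => /=; ring.
have -> : Cconj (RtoC (sgnZ k)) = RtoC (sgnZ k) by apply: Ceq => /=; ring.
have -> : Cconj ((Ci * RtoC y) ^ p)%C = (RtoC ((-1) ^ p) * (Ci * RtoC y) ^ p)%C.
  rewrite -Cpow_opp Cconj_pow; congr Cpow.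
  by apply: Ceq => /=; ring.
by ring.
Qed.

(** * The logarithm of the Euler product *)

Lemma is_lim_seq_Cmod_Re (u : nat -> C) l :
  is_lim_seq (fun N => Cmod (u N - l)%C) 0 -> is_lim_seq (fun N => Re (u N)) (Re l).
Proof.
move=> h; apply/is_lim_seq_spec => eps; have /is_lim_seq_spec/(_ eps) [N hN] := h.
exists N => n nN; have := hN n nN; rewrite Rminus_0_r Rabs_pos_eq; last exact: Cmod_ge_0.
by apply: Rle_lt_trans; have := re_le_Cmod (u n - l).
Qed.

Lemma is_lim_seq_Cmod_Im (u : nat -> C) l :
  is_lim_seq (fun N => Cmod (u N - l)%C) 0 -> is_lim_seq (fun N => Im (u N)) (Im l).
Proof.
move=> h; apply/is_lim_seq_spec => eps; have /is_lim_seq_spec/(_ eps) [N hN] := h.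
exists N => n nN; have := hN n nN; rewrite Rminus_0_r Rabs_pos_eq; last exact: Cmod_ge_0.
by apply: Rle_lt_trans; have := Im_le_Cmod (u n - l).
Qed.

Lemma C_lim_unique (u : nat -> C) l m : is_lim_seq (fun N => Cmod (u N - l)%C) 0 ->
  is_lim_seq (fun N => Cmod (u N - m)%C) 0 -> l = m.
Proof.
move=> h h'; apply: Ceq.
  have := is_lim_seq_unique _ _ (is_lim_seq_Cmod_Re h).
  by rewrite (is_lim_seq_unique _ _ (is_lim_seq_Cmod_Re h')) => -[].
have := is_lim_seq_unique _ _ (is_lim_seq_Cmod_Im h).
by rewrite (is_lim_seq_unique _ _ (is_lim_seq_Cmod_Im h')) => -[].
Qed.

Lemma csum_shift (a : nat -> C) : absum a ->
  csum a = (a 0%N + csum (fun n => a n.+1))%C.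
Proof.
move=> ha.
have hb : absum (fun n => a n.+1) by apply: (@absum_inj _ _ S _ a) => // [? ? []|i] //; lra.
apply: (@C_lim_unique (fun N => \big[Cplus/RtoC 0]_(0 <= i < N.+1) a i)).
  exact: (proj1 (is_lim_seq_incr_1 _ _) (sums_to_nat (csumP ha))).
apply: is_lim_seq_ext (sums_to_nat (csumP hb)) => N.
by rewrite big_nat_recl //; congr Cmod; ring.
Qed.

Lemma is_series_csum (f : nat -> R) (l : C) :
  sums_to (fun n => RtoC (f n)) l -> is_series f (Re l).
Proof.
move=> /sums_to_nat/is_lim_seq_Cmod_Re h.
apply: (is_lim_seq_ext _ _ _ _ (proj1 (is_lim_seq_incr_1 _ _) h)) => N.
rewrite sum_n_Reals; elim: N => [|N IH] /=; first by rewrite big_nat1.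
by rewrite big_nat_recr //= -IH.
Qed.

Lemma csum_real (I : eqType) (f : I -> R) : absum (fun i => RtoC (f i)) ->
  csum (fun i => RtoC (f i)) = RtoC (Re (csum (fun i => RtoC (f i)))).
Proof.
move=> ha.
have h : csum (fun i => RtoC (f i)) = Cconj (csum (fun i => RtoC (f i))).
  apply: csum_unique; have := sums_to_conj (csumP ha).
  by congr sums_to; apply: functional_extensionality => n; apply: Ceq => /=; ring.
by apply: Ceq => //; move: (f_equal Im h) => /=; rewrite /Im; lra.
Qed.

Lemma is_series_sums_to (f : nat -> R) (l : R) :
  absum (fun n => RtoC (f n)) -> is_series f l -> csum (fun n => RtoC (f n)) = RtoC l.
Proof.
move=> ha hf; apply: Ceq.
  by have := is_series_csum (csumP ha) => /is_series_unique <-; apply: is_series_unique.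
by rewrite csum_real.
Qed.

(** The integral of the geometric series. *)
Lemma is_series_ln x : 0 <= x < 1 ->
  is_series (fun k => x ^ k.+1 / INR k.+1) (- ln (1 - x)).
Proof.
move=> [x0 x1].
pose a (_ : nat) := 1.
have ha : CV_radius a = Finite 1.
  have -> : Finite 1 = Rbar_inv (Finite 1) by rewrite /=; congr Finite; field.
  have -> : CV_radius a = Finite (/ 1); last by [].
  apply: CV_radius_finite_DAlembert => [n||]; [rewrite /a; lra|lra|].
  apply: (is_lim_seq_ext (fun _ => 1)); last exact: is_lim_seq_const.
  by move=> n; rewrite /a Rdiv_diag ?Rabs_R1 //; lra.
have hs t : Rabs t < 1 -> PSeries a t = / (1 - t).
  move=> t1; apply: is_series_unique; apply: is_series_ext (is_series_geom t t1) => n.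
  by rewrite /a Rmult_1_l.
have h1 : is_RInt (PSeries a) 0 x (PSeries (PS_Int a) x).
  by apply: is_RInt_PSeries; rewrite ha /= Rabs_pos_eq.
have h2 : is_RInt (PSeries a) 0 x (- ln (1 - x)).
  apply: (is_RInt_ext (fun t => / (1 - t))).
    move=> t; rewrite Rmin_left // Rmax_right // => ht; rewrite hs //.
    by apply: Rabs_def1; lra.
  have -> : - ln (1 - x) = minus (- ln (1 - x)) (- ln (1 - 0)).
    by rewrite Rminus_0_r ln_1 /minus /plus /opp /=; ring.
  apply: (is_RInt_derive (fun t => - ln (1 - t))) => t;
    rewrite Rmin_left // Rmax_right // => ht.
    by auto_derive; [lra|field; lra].
  apply: ex_derive_continuous; auto_derive; lra.
have e : - ln (1 - x) = PSeries (PS_Int a) x.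
  by rewrite -(is_RInt_unique _ _ _ _ h1) (is_RInt_unique _ _ _ _ h2).
have ex : ex_pseries (PS_Int a) x.
  by apply: CV_radius_inside; rewrite CV_radius_Int ha /= Rabs_pos_eq.
have := PSeries_correct _ _ ex; rewrite -e => /is_pseries_R hp.
have E k : PS_Int a k.+1 * x ^ k.+1 = x ^ k.+1 / INR k.+1.
  by rewrite /PS_Int /a; field; apply: not_0_INR.
apply: is_series_ext E _.
by apply: (is_series_incr_1 (fun n => PS_Int a n * x ^ n)); rewrite /plus /= Rmult_0_l Rplus_0_r.
Qed.

Lemma exp_INR n y : exp (INR n * y) = exp y ^ n.
Proof.
elim: n => [|n IH]; first by rewrite /= Rmult_0_l exp_0.
by rewrite S_INR Rmult_plus_distr_r Rmult_1_l exp_plus IH /=; ring.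
Qed.

Lemma INR_S_ge1 n : 1 <= INR n.+1.
Proof. by rewrite S_INR; have := pos_INR n; lra. Qed.

Lemma INR_SS_ge1 m n : 1 <= INR m.+1 * INR n.+1.
Proof. by have := INR_S_ge1 m; have := INR_S_ge1 n; nra. Qed.

Lemma INR_SS_ge_add m n : INR m + INR n <= INR m.+1 * INR n.+1.
Proof. by rewrite !S_INR; have := pos_INR m; have := pos_INR n; nra. Qed.

(** With [N = (m + 1) (k + 1) >= m + k], half of the exponential absorbs [N ^ 2] and
    the other half is dominated by a product of geometric families. *)
Lemma absum_NN (a : nat * nat -> C) (K r : R) : 0 < r -> 0 <= K ->
  (forall p, Cmod (a p) <= K * (INR p.1.+1 * INR p.2.+1) ^ 2 *
     exp (- (r * (INR p.1.+1 * INR p.2.+1)))) -> absum a.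
Proof.
move=> r0 K0 ha.
have r2 : 0 < r / 2 by lra.
have hb := @absum_prod nat nat _ _ (absum_geom r2) (absum_geom r2).
apply: (absum_dom (K := K * (16 / r ^ 2))) hb.
  by apply: Rmult_le_pos => //; apply/Rlt_le/Rdiv_lt_0_compat; nra.
move=> p; apply: Rle_trans (ha p) _.
rewrite -RtoC_mult -exp_plus Cmod_R Rabs_pos_eq; last exact/Rlt_le/exp_pos.
rewrite (Rmult_assoc K) [X in _ <= X]Rmult_assoc; apply: Rmult_le_compat_l => //.
set N := INR _ * INR _.
have N1 : 1 <= N := INR_SS_ge1 p.1 p.2.
have -> : - (r * N) = - (r / 2 * N) + - (r / 2 * N) by field.
rewrite exp_plus -[X in X <= _]Rmult_assoc; apply: Rmult_le_compat.
- by apply: Rmult_le_pos; [nra|exact/Rlt_le/exp_pos].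
- exact/Rlt_le/exp_pos.
- apply: (Rmult_le_reg_r (exp (r / 2 * N))); first exact: exp_pos.
  rewrite Rmult_assoc -exp_plus Rplus_opp_l exp_0 Rmult_1_r.
  have : (r * N / 4) ^ 2 <= exp (r / 2 * N).
    have -> : r / 2 * N = r * N / 4 + r * N / 4 by field.
    rewrite exp_plus; have := exp_ineq1_le (r * N / 4); have : 0 < r * N / 4 by nra.
    by nra.
  move=> h; apply: (Rmult_le_reg_l (r ^ 2 / 16)); first by nra.
  rewrite -[X in _ <= X]Rmult_assoc (_ : r ^ 2 / 16 * (16 / r ^ 2) = 1); last by field; lra.
  by apply: Rle_trans (_ : (r * N / 4) ^ 2 <= _); lra.
- apply: exp_mono; rewrite -Ropp_plus_distr -Rmult_plus_distr_l.
  apply: Ropp_le_contravar; apply: Rmult_le_compat_l; first lra.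
  exact: INR_SS_ge_add.
Qed.

Definition log_term (r : R) (p : nat * nat) : C :=
  RtoC (- / INR p.2.+1 * exp (-2 * INR p.1.+1 * INR p.2.+1 * r)).

(** The logarithm of the product of all [1 - exp (-2 m r)], as a double series. *)
Definition log_euler (r : R) : R := Re (csum (log_term r)).

Lemma Cmod_log_term r p :
  Cmod (log_term r p) <= exp (- (2 * r * (INR p.1.+1 * INR p.2.+1))).
Proof.
have i0 : 0 <= / INR p.2.+1.
  by apply/Rlt_le/Rinv_0_lt_compat; have := INR_S_ge1 p.2; lra.
rewrite /log_term Cmod_R Rabs_mult Rabs_Ropp (Rabs_pos_eq _ i0) Rabs_pos_eq; last first.
  exact/Rlt_le/exp_pos.
rewrite -[X in _ <= X]Rmult_1_l; apply: Rmult_le_compat => //.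
- exact/Rlt_le/exp_pos.
- by rewrite -[X in _ <= X]Rinv_1; apply: Rinv_le_contravar; have := INR_S_ge1 p.2; lra.
- by apply: Req_le; congr exp; ring.
Qed.

Lemma absum_log_term r : 0 < r -> absum (log_term r).
Proof.
move=> r0; apply: (@absum_NN _ 1 (2 * r)); [lra|lra|move=> p].
apply: Rle_trans (Cmod_log_term r p) _; set N := INR _ * INR _.
have N1 : 1 <= N := INR_SS_ge1 p.1 p.2.
have := exp_pos (- (2 * r * N)); have : 1 <= N ^ 2 by nra.
by nra.
Qed.

Lemma exp_lt1 x : 0 < x -> exp (- x) < 1.
Proof. by move=> h; rewrite -exp_0; apply: exp_increasing; lra. Qed.

Lemma log_row r m : 0 < r ->
  csum (fun k => log_term r (m, k)) = RtoC (ln (1 - exp (- 2 * INR m.+1 * r))).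
Proof.
move=> r0; apply: is_series_sums_to; first exact: (absum_row (absum_log_term r0)).
set x := exp (-2 * INR m.+1 * r).
have hx : 0 <= x < 1.
  split; first exact/Rlt_le/exp_pos.
  rewrite /x (_ : -2 * _ * _ = - (2 * INR m.+1 * r)); last by ring.
  by apply: exp_lt1; have := INR_S_ge1 m; nra.
have := is_series_scal_l (-1) _ _ (is_series_ln hx).
rewrite /= /scal /= /mult /= (_ : -1 * - ln (1 - x) = ln (1 - x)); last by ring.
apply: is_series_ext => k; apply: (@eq_trans R _ (-1 * (x ^ k.+1 / INR k.+1))) => //.
rewrite (_ : -2 * INR m.+1 * INR k.+1 * r = INR k.+1 * (-2 * INR m.+1 * r)); last by ring.
by rewrite exp_INR -/x -[X in - / X]/(INR k.+1); field; apply: not_0_INR.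
Qed.

Lemma log_euler_lim r : 0 < r ->
  is_lim_seq (fun N => \big[Rplus/0]_(1 <= m < N.+1) ln (1 - exp (- 2 * INR m * r)))
    (log_euler r).
Proof.
move=> r0; have := sums_to_fubini (absum_log_term r0).
move=> /sums_to_nat/is_lim_seq_Cmod_Re; apply: is_lim_seq_ext => N.
rewrite big_add1 /=.
elim: N => [|N IH]; first by rewrite !big_geq.
by rewrite !big_nat_recr //= -IH log_row.
Qed.

Lemma csum_geom y : 0 < y ->
  csum (fun n => RtoC (exp (- (y * INR n)))) = RtoC (/ (1 - exp (- y))).
Proof.
move=> y0; have E1 := exp_lt1 y0; have ha := absum_geom y0.
have := csum_shift ha; rewrite (@csum_ext _ (fun n => RtoC (exp (- (y * INR n.+1))))
  (fun n => RtoC (exp (- y)) * RtoC (exp (- (y * INR n))))%C); last first.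
  move=> n; rewrite -RtoC_mult -exp_plus S_INR; congr (RtoC (exp _)); ring.
rewrite csumZ // Rmult_0_r Ropp_0 exp_0; set S := csum _ => hS.
have E2 : RtoC (1 - exp (- y)) <> 0 by move=> /(f_equal Re) /=; lra.
rewrite RtoC_inv; last by lra.
have : (RtoC (1 - exp (- y)) * S = 1)%C.
  by rewrite RtoC_minus; rewrite {1}hS; ring_simplify; rewrite {2}hS; ring.
move=> h; rewrite -(Cmult_1_r (/ _)) -h; by field.
Qed.

Lemma exp_ge_self x : x <= exp x.
Proof. by have := exp_ineq1_le x; lra. Qed.

Lemma absum_geom1 y : 0 < y ->
  absum (fun n : nat => RtoC (INR n.+1 * exp (- (y * INR n.+1)))).
Proof.
move=> y0; have y2 : 0 < y / 2 by lra.
apply: (absum_dom (K := 2 / y)) (absum_geom y2); first by apply/Rlt_le/Rdiv_lt_0_compat; lra.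
move=> n; have n1 := INR_S_ge1 n.
rewrite !Cmod_R (Rabs_pos_eq (exp _)); last exact/Rlt_le/exp_pos.
rewrite Rabs_pos_eq; last by apply: Rmult_le_pos; [lra|exact/Rlt_le/exp_pos].
have -> : - (y * INR n.+1) = - (y / 2 * INR n.+1) + - (y / 2 * INR n.+1) by field.
rewrite exp_plus -Rmult_assoc; apply: Rmult_le_compat.
- by apply: Rmult_le_pos; [lra|exact/Rlt_le/exp_pos].
- exact/Rlt_le/exp_pos.
- apply: (Rmult_le_reg_r (exp (y / 2 * INR n.+1))); first exact: exp_pos.
  rewrite Rmult_assoc -exp_plus Rplus_opp_l exp_0 Rmult_1_r.
  apply: (Rmult_le_reg_l (y / 2)) => //.
  rewrite -[X in _ <= X]Rmult_assoc (_ : y / 2 * (2 / y) = 1); last by field; lra.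
  by rewrite Rmult_1_l; apply: exp_ge_self.
- apply: exp_mono; apply: Ropp_le_contravar; apply: Rmult_le_compat_l; first lra.
  by rewrite S_INR; lra.
Qed.

(** Removing the first term turns this sum [S], with [q = exp (- y)], into
    [q + q S + q ^ 2 / (1 - q)], which determines [S]. *)
Lemma csum_geom1 y : 0 < y ->
  csum (fun n => RtoC (INR n.+1 * exp (- (y * INR n.+1)))) =
  RtoC (exp (- y) / (1 - exp (- y)) ^ 2).
Proof.
move=> y0; have E1 := exp_lt1 y0; have ha := absum_geom1 y0; have hg := absum_geom y0.
have := csum_shift ha.
rewrite (@csum_ext _ (fun n => RtoC (INR n.+2 * exp (- (y * INR n.+2))))
  (fun n => RtoC (exp (- y)) * RtoC (INR n.+1 * exp (- (y * INR n.+1))) +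
     RtoC (exp (- y) ^ 2) * RtoC (exp (- (y * INR n))))%C); last first.
  move=> n; rewrite -!RtoC_mult -RtoC_plus; congr RtoC.
  rewrite !S_INR.
  have -> : - (y * (INR n + 1 + 1)) = - y + - y + - (y * INR n) by ring.
  have -> : - (y * (INR n + 1)) = - y + - (y * INR n) by ring.
  by rewrite !exp_plus; ring.
rewrite csumD ?csumZ //; try exact: absumZ.
rewrite csum_geom // Rmult_1_r Rmult_1_l; set S := csum _; set q := exp (- y) => hS.
have q1 : q < 1 by [].
have E2 : RtoC (1 - q) <> 0 by move=> /(f_equal Re) /=; lra.
have h : (RtoC (1 - q) * S = RtoC (q / (1 - q)))%C.
  have -> : (RtoC (1 - q) * S = S - RtoC q * S)%C by rewrite RtoC_minus; ring.
  rewrite {1}hS.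
  transitivity (RtoC q + RtoC (q ^ 2) * RtoC (/ (1 - q)))%C; first by ring.
  by rewrite -RtoC_mult -RtoC_plus; congr RtoC; field; lra.
have -> : S = (/ RtoC (1 - q) * (RtoC (1 - q) * S))%C by field.
by rewrite h -RtoC_inv -?RtoC_mult; [congr RtoC; field; lra|lra].
Qed.

Lemma sinh_geom r k : 0 < r -> let y := 2 * INR k.+1 * r in
  2 * (exp (- y) / (1 - exp (- y)) ^ 2) = 1 / 2 * (1 / sinh (INR k.+1 * r) ^ 2).
Proof.
move=> r0 y; set x := INR k.+1 * r.
have x0 : 0 < x by rewrite /x; have := INR_S_ge1 k; nra.
have -> : - y = - x + - x by rewrite /y /x; ring.
have h := exp_lt1 x0; have hp := exp_pos (- x).
have h2 : 1 < exp x by rewrite -exp_0; apply: exp_increasing.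
have e : exp x = / exp (- x) by rewrite -exp_Ropp Ropp_involutive.
rewrite /sinh exp_plus e; set q := exp (- x) in h hp *.
have q2 : 0 < 1 - q * q by nra.
field; repeat split; nra.
Qed.

(** The differentiated double series is summed over [m] first; the row of [k] then
    contributes [1 / (2 sinh ^ 2 (k r))]. *)
Lemma is_derive_log_euler r : 0 < r ->
  is_derive log_euler r ((Eis r + 1 / 6) / 2).
Proof.
move=> r0; pose l (p : nat * nat) := RtoC (- (2 * (INR p.1.+1 * INR p.2.+1))).
pose D p := (log_term r p * l p)%C.
have l0 p : Cmod (l p) = 2 * (INR p.1.+1 * INR p.2.+1).
  by rewrite /l Cmod_R Rabs_Ropp Rabs_pos_eq //; have := INR_SS_ge1 p.1 p.2; lra.
have hD : absum D.
  apply: (@absum_NN _ 2 (2 * r)); [lra|lra|move=> p].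
  rewrite /D Cmod_mult l0; have := Cmod_log_term r p.
  set N := INR _ * INR _; have N1 : 1 <= N := INR_SS_ge1 p.1 p.2.
  have := exp_pos (- (2 * r * N)); have : 2 * N <= 2 * N ^ 2 by nra.
  by have := Cmod_ge_0 (log_term r p); nra.
have d0 : 0 < r / 2 by lra.
have [|M M0 hM] := exp_sum_quad d0 (absum_log_term r0) hD.
  apply: (@absum_NN _ 4 r) => //; [lra|move=> p].
  rewrite !Cmod_mult l0 Cmod_R (Rabs_pos_eq (exp _)); last exact/Rlt_le/exp_pos.
  have := Cmod_log_term r p; set N := INR _ * INR _ => h.
  have N1 : 1 <= N := INR_SS_ge1 p.1 p.2.
  have -> : - (r * N) = - (2 * r * N) + r / 2 * (2 * N) by field.
  rewrite exp_plus -[X in _ <= X]Rmult_assoc; apply: Rmult_le_compat_r.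
    exact/Rlt_le/exp_pos.
  rewrite Rmult_comm (_ : 4 * N ^ 2 = 2 * N * (2 * N)); last by ring.
  by apply: Rmult_le_compat_l => //; nra.
have hR : Re (csum D) = (Eis r + 1 / 6) / 2.
  pose sw (p : nat * nat) := (p.2, p.1).
  have swK : cancel sw sw by case.
  rewrite -(csum_reindex swK swK hD).
  have := sums_to_fubini (absum_reindex swK hD).
  have -> : (fun k => csum (fun m => D (sw (k, m)))) =
    (fun k => RtoC (1 / 2 * (1 / sinh (INR k.+1 * r) ^ 2))).
    apply: functional_extensionality => k; rewrite -sinh_geom //.
    set y := 2 * INR k.+1 * r.
    have y0 : 0 < y by rewrite /y; have := INR_S_ge1 k; nra.
    rewrite RtoC_mult -csum_geom1 // -csumZ; last exact: absum_geom1.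
    apply: csum_ext => m; rewrite /D /l /log_term /sw -!RtoC_mult; congr RtoC.
    have -> : -2 * INR m.+1 * INR k.+1 * r = - (y * INR m.+1) by rewrite /y; ring.
    have E (u v w : R) : v <> 0 -> - / v * w * - (2 * (u * v)) = 2 * (u * w).
      by move=> v0; field.
    by apply: E; apply: not_0_INR.
  move=> /is_series_csum/is_series_unique <-.
  by rewrite Series_scal_l /Eis; field.
rewrite -hR; apply: (is_derive_Re d0) => e he.
have [|_] := hM (RtoC e); first by rewrite Cmod_R.
rewrite Cmod_R; apply: Rle_trans; apply: Req_le; congr Cmod; congr (_ - _ - _)%C.
apply: csum_ext => p; rewrite /log_term /l -RtoC_mult Cexp_RtoC -RtoC_mult; congr RtoC.
rewrite [RHS]Rmult_assoc -exp_plus; congr (_ * exp _); ring.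
Qed.

(** * The Jacobi triple product *)

Definition qpoch (r : R) (n : nat) : R :=
  \big[Rmult/1]_(1 <= m < n.+1) (1 - exp (- 2 * INR m * r)).

Lemma qpoch0 r : qpoch r 0 = 1.
Proof. by rewrite /qpoch big_geq. Qed.

Lemma qpochS r n : qpoch r n.+1 = qpoch r n * (1 - exp (- 2 * INR n.+1 * r)).
Proof. by rewrite /qpoch big_nat_recr. Qed.

Lemma qfactor r n : 0 < r -> 0 < 1 - exp (- 2 * INR n.+1 * r) < 1.
Proof.
move=> r0; have := exp_pos (- 2 * INR n.+1 * r).
have : exp (- 2 * INR n.+1 * r) < 1.
  rewrite (_ : - 2 * INR n.+1 * r = - (2 * INR n.+1 * r)); last by ring.
  by apply: exp_lt1; have := INR_S_ge1 n; nra.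
lra.
Qed.

Lemma qpoch_gt0 r n : 0 < r -> 0 < qpoch r n.
Proof.
move=> r0; elim: n => [|n IH]; first by rewrite qpoch0; lra.
by rewrite qpochS; apply: Rmult_lt_0_compat => //; have := qfactor n r0; lra.
Qed.

Lemma qpoch_decr r m n : 0 < r -> (m <= n)%N -> qpoch r n <= qpoch r m.
Proof.
move=> r0 /subnK <-; elim: (n - m)%N => [|k IH]; first by rewrite add0n; lra.
rewrite addSn qpochS; have [h1 h2] := qfactor (k + m) r0.
by have := qpoch_gt0 (k + m) r0; nra.
Qed.

Definition euler (r : R) : R := exp (log_euler r).

Lemma qpoch_exp r n : 0 < r ->
  qpoch r n = exp (\big[Rplus/0]_(1 <= m < n.+1) ln (1 - exp (- 2 * INR m * r))).
Proof.
move=> r0; elim: n => [|n IH]; first by rewrite qpoch0 big_geq // exp_0.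
rewrite qpochS big_nat_recr //= exp_plus -IH exp_ln //.
exact: (proj1 (qfactor n r0)).
Qed.

Lemma qpoch_lim r : 0 < r -> is_lim_seq (qpoch r) (euler r).
Proof.
move=> r0; apply: (is_lim_seq_ext (fun n =>
  exp (\big[Rplus/0]_(1 <= m < n.+1) ln (1 - exp (- 2 * INR m * r))))).
  by move=> n; rewrite -qpoch_exp.
apply: is_lim_seq_continuous; last exact: log_euler_lim.
exact/derivable_continuous_pt/derivable_pt_exp.
Qed.

(** The reciprocal of [qpoch r n] extended by [0] to negative [n]: with this
    convention its recurrence holds on all of [Z], which spares the boundary
    cases of the Gaussian binomial coefficients. *)
Definition qinv (r : R) (n : Z) : R :=
  if (n <? 0)%Z then 0 else / qpoch r (Z.to_nat n).

Lemma qinv_pred r n : 0 < r ->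
  qinv r (n - 1) = (1 - exp (- 2 * IZR n * r)) * qinv r n.
Proof.
move=> r0; rewrite /qinv.
case: (Z.ltb_spec n 0) => n0; first by case: Z.ltb_spec => h; [ring|lia].
case: Z.ltb_spec => h.
  have -> : n = 0%Z by lia.
  by rewrite Rmult_0_r Rmult_0_l exp_0; ring.
have [m ->] : exists m, n = Z.of_nat m.+1 by exists (Z.to_nat n).-1; lia.
have -> : Z.to_nat (Z.of_nat m.+1 - 1) = m by lia.
rewrite Nat2Z.id qpochS -INR_IZR_INZ.
have := qfactor m r0; have := qpoch_gt0 m r0 => p q; field; split; lra.
Qed.

(** Cauchy's finite form of the triple product: the Gaussian binomial
    coefficients [qpoch (2 N) qinv (N - k) qinv (N + k)]. *)
Definition qcoef (r : R) (N : nat) (k : Z) : R :=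
  qpoch r (N + N) * qinv r (Z.of_nat N - k) * qinv r (Z.of_nat N + k).

(** After the recurrence of [qinv] this is a polynomial identity in
    [X = exp (-2 (N + 1 - k) r)], [Y = exp (-2 (N + 1 + k) r)] and [exp (2 r)]. *)
Lemma qcoef_rec r N k : 0 < r ->
  let Q := exp (- (2 * INR N.+1 - 1) * r) in
  qcoef r N.+1 k = (1 + Q * Q) * qcoef r N k
    + Q * exp ((2 * IZR k - 1) * r) * qcoef r N (k - 1)
    + Q * exp (- (2 * IZR k + 1) * r) * qcoef r N (k + 1).
Proof.
move=> r0 Q; rewrite /qcoef.
rewrite (_ : (N.+1 + N.+1)%N = (N + N).+2) ?qpochS; last by rewrite addSn addnS.
set J1 := qinv r (Z.of_nat N.+1 - k); set J2 := qinv r (Z.of_nat N.+1 + k).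
pose n := INR N; pose x := IZR k.
have IN : IZR (Z.of_nat N.+1) = n + 1 by rewrite -INR_IZR_INZ S_INR.
pose X := exp (-2 * (n + 1 - x) * r); pose Y := exp (-2 * (n + 1 + x) * r).
pose t := exp (2 * r).
have tp : 0 < t by apply: exp_pos.
have a1 : qinv r (Z.of_nat N - k) = (1 - X) * J1.
  have -> : (Z.of_nat N - k)%Z = (Z.of_nat N.+1 - k - 1)%Z by lia.
  by rewrite qinv_pred // minus_IZR IN.
have a2 : qinv r (Z.of_nat N + k) = (1 - Y) * J2.
  have -> : (Z.of_nat N + k)%Z = (Z.of_nat N.+1 + k - 1)%Z by lia.
  by rewrite qinv_pred // plus_IZR IN.
have a3 : qinv r (Z.of_nat N - (k - 1)) = J1.
  by congr qinv; lia.
have a4 : qinv r (Z.of_nat N + (k + 1)) = J2.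
  by congr qinv; lia.
have a5 : qinv r (Z.of_nat N + (k - 1)) = (1 - t * Y) * ((1 - Y) * J2).
  have -> : (Z.of_nat N + (k - 1))%Z = (Z.of_nat N + k - 1)%Z by lia.
  rewrite qinv_pred // a2 plus_IZR -INR_IZR_INZ -/n -/x /t /Y -exp_plus.
  by congr ((1 - exp _) * _); ring.
have a6 : qinv r (Z.of_nat N - (k + 1)) = (1 - t * X) * ((1 - X) * J1).
  have -> : (Z.of_nat N - (k + 1))%Z = (Z.of_nat N - k - 1)%Z by lia.
  rewrite qinv_pred // a1 minus_IZR -INR_IZR_INZ -/n -/x /t /X -exp_plus.
  by congr ((1 - exp _) * _); ring.
rewrite a1 a2 a3 a4 a5 a6.
have -> : Q * Q = t * X * Y.
  by rewrite /Q /t /X /Y -!exp_plus S_INR -/n; congr exp; ring.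
have -> : Q * exp ((2 * IZR k - 1) * r) = X.
  by rewrite /Q /X -!exp_plus S_INR -/n -/x; congr exp; ring.
have -> : Q * exp (- (2 * IZR k + 1) * r) = Y.
  by rewrite /Q /Y -!exp_plus S_INR -/n -/x; congr exp; ring.
have -> : exp (-2 * INR (N + N).+1 * r) = t * X * Y.
  by rewrite /t /X /Y -!exp_plus S_INR plus_INR -/n; congr exp; ring.
have -> : exp (-2 * INR (N + N).+2 * r) = X * Y.
  by rewrite /X /Y -!exp_plus !S_INR plus_INR -/n; congr exp; ring.
by ring.
Qed.

Lemma qpoch_ratio r m n : 0 < r -> (m <= n)%N -> 0 <= qpoch r n * / qpoch r m <= 1.
Proof.
move=> r0 /(qpoch_decr r0) h; have hm := qpoch_gt0 m r0; have hn := qpoch_gt0 n r0.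
split; first by apply: Rmult_le_pos; [lra|apply/Rlt_le/Rinv_0_lt_compat].
by apply: (Rmult_le_reg_r (qpoch r m)) => //; rewrite Rmult_assoc Rinv_l; lra.
Qed.

Lemma qcoef_bound r N k : 0 < r -> 0 <= qpoch r N * qcoef r N k <= 1.
Proof.
move=> r0; rewrite /qcoef /qinv.
case: Z.ltb_spec => h1; first by lra.
case: Z.ltb_spec => h2; first by lra.
set i := Z.to_nat _; set j := Z.to_nat _.
have mul x y : 0 <= x <= 1 -> 0 <= y <= 1 -> 0 <= x * y <= 1 by move=> ? ?; nra.
have hN2 (m : nat) : (Z.of_nat m <= 2 * Z.of_nat N)%Z -> (m <= N + N)%N.
  by move=> h; apply/leP; rewrite -plusE; lia.
have hN (m : nat) : (Z.of_nat m <= Z.of_nat N)%Z -> (m <= N)%N.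
  by move=> h; apply/leP; lia.
case: (Z.le_gt_cases 0 k) => k0.
  have -> : qpoch r N * (qpoch r (N + N) * / qpoch r i * / qpoch r j) =
    (qpoch r N * / qpoch r i) * (qpoch r (N + N) * / qpoch r j) by ring.
  by apply: mul; apply: qpoch_ratio => //; [apply: hN|apply: hN2]; rewrite /i /j; lia.
have -> : qpoch r N * (qpoch r (N + N) * / qpoch r i * / qpoch r j) =
  (qpoch r N * / qpoch r j) * (qpoch r (N + N) * / qpoch r i) by ring.
by apply: mul; apply: qpoch_ratio => //; [apply: hN|apply: hN2]; rewrite /i /j; lia.
Qed.

Lemma qpoch_lim_shift r (f : nat -> nat) : 0 < r -> (forall M, exists N0, forall N,
  (N0 <= N)%N -> (M <= f N)%N) -> is_lim_seq (fun N => qpoch r (f N)) (euler r).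
Proof.
move=> r0 hf; apply: is_lim_seq_subseq (qpoch_lim r0).
move=> P [M hM]; have [N0 hN] := hf M; exists N0 => n /leP nN.
by apply: hM; apply/leP/hN.
Qed.

Lemma qcoef_lim r k : 0 < r -> is_lim_seq (fun N => qpoch r N * qcoef r N k) 1.
Proof.
move=> r0; have P0 : euler r <> 0 by have := exp_pos (log_euler r); rewrite /euler; lra.
have hinv (f : nat -> Z) : (forall M, exists N0, forall N, (N0 <= N)%N ->
    (Z.of_nat M <= f N)%Z) -> is_lim_seq (fun N => qinv r (f N)) (/ euler r).
  move=> hf.
  have h : is_lim_seq (fun N => / qpoch r (Z.to_nat (f N))) (/ euler r).
    have := is_lim_seq_inv (fun N => qpoch r (Z.to_nat (f N))) (euler r) _ _.
    apply; last by case.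
    apply: qpoch_lim_shift => // M; have [N0 hN] := hf M; exists N0 => N /hN h.
    by apply/leP; lia.
  apply: is_lim_seq_ext_loc h; have [N0 hN] := hf 0%N; exists N0 => N /leP/hN h.
  by rewrite /qinv; case: Z.ltb_spec => //; lia.
have h1 := qpoch_lim r0.
have h2 : is_lim_seq (fun N => qpoch r (N + N)) (euler r).
  apply: qpoch_lim_shift => // M; exists M => N h; exact: leq_trans h (leq_addr _ _).
have h3 : is_lim_seq (fun N => qinv r (Z.of_nat N - k)) (/ euler r).
  by apply: hinv => M; exists (Z.to_nat (Z.of_nat M + Z.abs k)) => N /leP; lia.
have h4 : is_lim_seq (fun N => qinv r (Z.of_nat N + k)) (/ euler r).
  by apply: hinv => M; exists (Z.to_nat (Z.of_nat M + Z.abs k)) => N /leP; lia.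
have := is_lim_seq_mult' _ _ _ _ h1 (is_lim_seq_mult' _ _ _ _
  (is_lim_seq_mult' _ _ _ _ h2 h3) h4).
by rewrite (_ : euler r * _ = 1) //; field.
Qed.

Lemma csum_single (I : eqType) (i0 : I) (a : I -> C) :
  (forall i, i != i0 -> a i = 0) -> csum a = a i0.
Proof.
move=> h; apply: csum_unique => eps e0; exists [:: i0] => s us ss.
rewrite (bigD1_seq i0) //=; last by apply: ss; rewrite inE.
rewrite big1 => [|i]; last exact: h.
by rewrite Cplus_0_r /Cminus Cplus_opp_r Cmod_0.
Qed.

Lemma absum_qcoef r N z : 0 < r ->
  absum (fun k => qcoef r N k * theta_term 0 0 r z k)%C.
Proof.
move=> r0; have hN := qpoch_gt0 N r0.
apply: (absum_dom (K := / qpoch r N)) (absum_theta 0 0 z r0).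
  exact/Rlt_le/Rinv_0_lt_compat.
move=> k; rewrite Cmod_mult; apply: Rmult_le_compat_r; first exact: Cmod_ge_0.
have [h1 h2] := qcoef_bound N k r0; rewrite Cmod_R Rabs_pos_eq.
  by apply: (Rmult_le_reg_l (qpoch r N)) => //; rewrite Rinv_r; lra.
by apply: (Rmult_le_reg_l (qpoch r N)) => //; lra.
Qed.

Lemma theta_term_shift r z k : theta_term 0 0 r z (k + 1) =
  (- (exp (- (2 * IZR k + 1) * r) * Cexp (Ci * z)) * theta_term 0 0 r z k)%C.
Proof.
have c0 (w : C) : (w ^ 0)%C = 1 by [].
rewrite /theta_term sgnZ_add (_ : sgnZ 1 = -1) // plus_IZR !Rplus_0_r !c0.
set x := IZR k.
have -> : (RtoC (- r * (x + 1) ^ 2) + Ci * RtoC (x + 1) * z =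
  RtoC (- (2 * x + 1) * r) + Ci * z + (RtoC (- r * x ^ 2) + Ci * RtoC x * z))%C.
  by apply: Ceq; case: z => u v /=; ring.
by rewrite !Cexp_add Cexp_RtoC RtoC_mult; ring.
Qed.

Lemma Cexp_inv z : (Cexp z * Cexp (- z) = 1)%C.
Proof. by rewrite -Cexp_add Cplus_opp_r Cexp_0. Qed.

(** Multiplication by the next factor combines the coefficients of [k - 1], [k] and
    [k + 1], as [qcoef_rec] does. *)
Lemma triple_product_finite r z N : 0 < r ->
  \big[Cmult/RtoC 1]_(1 <= m < N.+1)
    ((1 - exp (- (2 * INR m - 1) * r) * Cexp (Ci * z)) *
     (1 - exp (- (2 * INR m - 1) * r) * Cexp (- (Ci * z))))%C =
  csum (fun k => qcoef r N k * theta_term 0 0 r z k)%C.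
Proof.
move=> r0; elim: N => [|N IH].
  rewrite big_geq // (@csum_single _ 0%Z).
    rewrite /qcoef /qinv /= qpoch0 /theta_term Rplus_0_r.
    rewrite (_ : (RtoC (- r * 0 ^ 2) + Ci * RtoC 0 * z)%C = 0); last first.
      by apply: Ceq; case: z => u v /=; ring.
    by rewrite Cexp_0 Rinv_1 !Rmult_1_l /sgnZ /=; ring.
  move=> k k0; rewrite /qcoef /qinv /=.
  have : (k < 0)%Z \/ (- k < 0)%Z by move/eqP: k0; lia.
  case=> /Z.ltb_lt ->; first by rewrite Rmult_0_r; ring.
  by rewrite Rmult_0_r Rmult_0_l; ring.
rewrite big_nat_recr //= IH; set Q := exp _; set w := Cexp _; set w' := Cexp _.
set T := theta_term 0 0 r z; set a := qcoef r N.
have ww : (w * w' = 1)%C by apply: Cexp_inv.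
have hT k : T (k + 1)%Z = (- (exp (- (2 * IZR k + 1) * r) * w) * T k)%C.
  exact: theta_term_shift.
have ha : absum (fun k => a k * T k)%C by apply: absum_qcoef.
pose up k := (k + 1)%Z; pose dn k := (k - 1)%Z.
have ud : cancel up dn by move=> k; rewrite /up /dn; lia.
have du : cancel dn up by move=> k; rewrite /up /dn; lia.
have h1 := absum_reindex ud ha; have e1 := csum_reindex ud du ha.
have h2 := absum_reindex du ha; have e2 := csum_reindex du ud ha.
pose b k := (a k * T k)%C.
have E k : (qcoef r N.+1 k * T k = (1 + Q * Q) * b k +
    (- (Q * w) * b (dn k) + - (Q * w') * b (up k)))%C.
  have S (q u v x y t : R) : RtoC ((1 + q * q) * x + q * u * y + q * v * t) =
      ((1 + q * q) * x + (q * y * u + q * t * v))%C.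
    by rewrite !RtoC_plus !RtoC_mult RtoC_plus RtoC_mult; ring.
  rewrite qcoef_rec // -/Q -/a S /b.
  have hu := hT k; have hd := hT (dn k); rewrite (du k : dn k + 1 = k)%Z in hd.
  have e1' : (RtoC (exp ((2 * IZR k - 1) * r)) * T k = - w * T (dn k))%C.
    rewrite hd; have -> : (2 * IZR (dn k) + 1) = 2 * IZR k - 1 by rewrite minus_IZR; ring.
    set u := (2 * IZR k - 1).
    have -> : (exp (u * r) * (- (exp (- u * r) * w) * T (dn k)) =
      (exp (u * r) * exp (- u * r)) * (- w * T (dn k)))%C by ring.
    by rewrite -RtoC_mult -exp_plus (_ : u * r + - u * r = 0) ?exp_0; ring.
  have e2' : (RtoC (exp (- (2 * IZR k + 1) * r)) * T k = - w' * T (up k))%C.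
    rewrite /up hu; set v := RtoC (exp _).
    by transitivity (w * w' * (v * T k))%C; [rewrite ww; ring|ring].
  transitivity ((1 + Q * Q) * (a k * T k) +
    (Q * a (dn k) * (RtoC (exp ((2 * IZR k - 1) * r)) * T k) +
     Q * a (up k) * (RtoC (exp (- (2 * IZR k + 1) * r)) * T k)))%C; first by rewrite /dn /up; ring.
  by rewrite e1' e2'; ring.
rewrite (csum_ext E) csumD; first last.
- by apply: absumD; apply: absumZ.
- exact: absumZ.
rewrite csumD ?csumZ //; try exact: absumZ.
rewrite e1 e2 -/b; set S := csum _.
transitivity ((1 + Q * Q * (w * w') - Q * w - Q * w') * S)%C; first by ring.
by rewrite ww; ring.
Qed.

Lemma Cprod_infE (f : nat -> C) l :
  is_lim_seq (fun N => Cmod (\big[Cmult/RtoC 1]_(1 <= m < N.+1) f m - l)%C) 0 ->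
  Cprod_inf f = l.
Proof.
move=> h; rewrite /Cprod_inf (is_lim_seq_unique _ _ (is_lim_seq_Cmod_Re h)).
by rewrite (is_lim_seq_unique _ _ (is_lim_seq_Cmod_Im h)); case: l h.
Qed.

Definition theta3_factor (r : R) (z : C) (m : nat) : C :=
  ((1 - exp (- 2 * INR m * r)) *
    (1 - exp (- (2 * INR m - 1) * r) * Cexp (Ci * z)) *
    (1 - exp (- (2 * INR m - 1) * r) * Cexp (- (Ci * z))))%C.

Definition theta1_factor (r : R) (z : C) (m : nat) : C :=
  ((1 - exp (- 2 * INR m * r)) *
    (1 - exp (- 2 * INR m * r) * Cexp (Ci * z)) *
    (1 - exp (- 2 * INR m * r) * Cexp (- (Ci * z))))%C.

(** Dominated convergence: the coefficients [qpoch r N * qcoef r N k] lie between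
    0 and 1 and tend to 1. *)
Lemma triple_product r z : 0 < r ->
  is_lim_seq (fun N => Cmod (\big[Cmult/RtoC 1]_(1 <= m < N.+1) theta3_factor r z m
    - theta 0 0 r z)%C) 0.
Proof.
move=> r0.
apply: (is_lim_seq_ext (fun N => Cmod (csum (fun k => RtoC (qpoch r N * qcoef r N k) *
   theta_term 0 0 r z k) - theta 0 0 r z)%C)).
  move=> N; congr (Cmod (_ - _)%C).
  under [RHS]eq_bigr => m _ do rewrite /theta3_factor -Cmult_assoc.
  rewrite big_split /= triple_product_finite // -csumZ; last exact: absum_qcoef.
  apply: csum_ext => k; rewrite RtoC_mult -Cmult_assoc; congr (_ * _)%C.
  by rewrite /qpoch; elim/big_ind2: _ => [|? ? ? ? <- <-|m _];
    rewrite ?RtoC_mult ?RtoC_minus.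
apply: (csum_dominated (absum_theta 0 0 z r0)).
- move=> N k; rewrite Cmod_mult Cmod_R -[X in _ <= X]Rmult_1_l.
  apply: Rmult_le_compat_r; first exact: Cmod_ge_0.
  by have [h1 h2] := qcoef_bound N k r0; rewrite Rabs_pos_eq.
- by move=> k; lra.
move=> k.
have h := is_lim_seq_mult' _ _ _ _ (is_lim_seq_abs _ _ (is_lim_seq_minus' _ _ _ _ (qcoef_lim k r0)
  (is_lim_seq_const 1))) (is_lim_seq_const (Cmod (theta_term 0 0 r z k))).
rewrite Rminus_diag Rabs_R0 Rmult_0_l in h.
apply: is_lim_seq_ext h => N; rewrite -Cmod_R -Cmod_mult; congr Cmod.
by rewrite RtoC_minus; ring.
Qed.

Lemma Theta3E r z : 0 < r -> Theta3 r z = theta 0 0 r z.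
Proof. by move=> r0; apply: Cprod_infE; apply: triple_product. Qed.

(** Shifting [z] by [i r] turns the odd powers of [exp (- r)] into even ones. *)
Lemma theta1_partial r z N :
  (\big[Cmult/RtoC 1]_(1 <= m < N.+1) theta1_factor r z m * (1 - Cexp (- (Ci * z))) =
   \big[Cmult/RtoC 1]_(1 <= m < N.+1) theta3_factor r (z + Ci * r) m *
     (1 - exp (- 2 * INR N * r) * Cexp (- (Ci * z))))%C.
Proof.
elim: N => [|N IH].
  by rewrite !big_geq //= Rmult_0_r Rmult_0_l exp_0; ring.
rewrite !(@big_nat_recr _ _ _ N.+1) //= -/(INR N.+1).
set P1 := \big[_/_]_(_ <= _ < _) _ in IH *; set P3 := \big[_/_]_(_ <= _ < _) _ in IH *.
have e1 : Cexp (Ci * (z + Ci * r)) = (exp (- r) * Cexp (Ci * z))%C.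
  by rewrite -Cexp_RtoC -Cexp_add; congr Cexp; case: z {IH P1 P3} => u v; apply: Ceq => /=; ring.
have e2 : Cexp (- (Ci * (z + Ci * r))) = (exp r * Cexp (- (Ci * z)))%C.
  by rewrite -Cexp_RtoC -Cexp_add; congr Cexp; case: z {IH P1 P3 e1} => u v; apply: Ceq => /=; ring.
rewrite /theta1_factor /theta3_factor e1 e2 !Cmult_assoc -!RtoC_mult -!exp_plus.
have -> : - (2 * INR N.+1 - 1) * r + - r = - 2 * INR N.+1 * r by ring.
have -> : - (2 * INR N.+1 - 1) * r + r = - 2 * INR N * r by rewrite S_INR; ring.
set q := RtoC (exp (-2 * INR N.+1 * r)); set w := Cexp (Ci * z).
set w' := Cexp (- (Ci * z)) in IH *.
transitivity ((P1 * (1 - w')) * ((1 - q) * (1 - q * w) * (1 - q * w')))%C; first by ring.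
by rewrite IH; ring.
Qed.

Lemma C_lim_mult (u v : nat -> C) l m :
  is_lim_seq (fun N => Cmod (u N - l)%C) 0 -> is_lim_seq (fun N => Cmod (v N - m)%C) 0 ->
  is_lim_seq (fun N => Cmod (u N * v N - l * m)%C) 0.
Proof.
move=> hu hv.
apply: (is_lim_seq_le_le (fun _ => 0) _ (fun N => Cmod (u N - l)%C * Cmod (v N - m)%C +
  Cmod m * Cmod (u N - l)%C + Cmod l * Cmod (v N - m)%C)).
- move=> N; split; first exact: Cmod_ge_0.
  have -> : (u N * v N - l * m = (u N - l) * (v N - m) + m * (u N - l) + l * (v N - m))%C.
    by ring.
  apply: Rle_trans (Cmod_triangle _ _) _; rewrite -(Cmod_mult l).
  apply: Rplus_le_compat_r; rewrite -!Cmod_mult; exact: Cmod_triangle.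
- exact: is_lim_seq_const.
have -> : Finite 0 = Finite (0 * 0 + Cmod m * 0 + Cmod l * 0) by congr Finite; ring.
by repeat apply: is_lim_seq_plus'; apply: is_lim_seq_mult' => //; apply: is_lim_seq_const.
Qed.

Lemma exp_lim0 r : 0 < r -> is_lim_seq (fun N => exp (- 2 * INR N * r)) 0.
Proof.
move=> r0; apply: (is_lim_seq_ext (fun N => exp (-2 * r) ^ N)).
  by move=> N; rewrite -exp_INR; congr exp; ring.
apply: is_lim_seq_geom; rewrite Rabs_pos_eq; last exact/Rlt_le/exp_pos.
have -> : -2 * r = - (2 * r) by ring.
by apply: exp_lt1; lra.
Qed.

Lemma theta1_product r z : 0 < r -> Cexp (- (Ci * z)) <> 1 ->
  is_lim_seq (fun N => Cmod (\big[Cmult/RtoC 1]_(1 <= m < N.+1) theta1_factor r z m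
    - theta 0 0 r (z + Ci * r) * (/ (1 - Cexp (- (Ci * z)))))%C) 0.
Proof.
move=> r0 w1; set w' := Cexp _ in w1 *.
have w0 : (1 - w')%C <> 0.
  by move=> h; apply: w1; rewrite -(Cplus_0_r w') -h; ring.
pose u N := (1 - exp (- 2 * INR N * r) * w')%C.
have hu : is_lim_seq (fun N => Cmod (u N * / (1 - w') - / (1 - w'))%C) 0.
  have h := is_lim_seq_mult' _ _ _ _ (exp_lim0 r0) (is_lim_seq_const (Cmod (w' / (1 - w'))%C)).
  rewrite Rmult_0_l in h; apply: is_lim_seq_ext h => N.
  rewrite -{1}(Rabs_pos_eq (exp _)); last exact/Rlt_le/exp_pos.
  rewrite -Cmod_R -Cmod_mult -Cmod_opp /u; congr Cmod; by field.
apply: is_lim_seq_ext (C_lim_mult (triple_product (z + Ci * r) r0) hu) => N.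
by rewrite Cmult_assoc -theta1_partial -/w'; congr (Cmod (_ - _)%C); field.
Qed.

Lemma theta_half r z : 0 < r -> theta (/ 2) 0 r z =
  (exp (- r / 4) * Cexp (Ci * (z / 2)) * theta 0 0 r (z + Ci * r))%C.
Proof.
move=> r0; rewrite /theta -csumZ; last exact: absum_theta.
have c0 (w : C) : (w ^ 0)%C = 1 by [].
apply: csum_ext => k; rewrite /theta_term !c0 Rplus_0_r -Cexp_RtoC; set x := IZR k.
have -> : (RtoC (- r * (x + / 2) ^ 2) + Ci * RtoC (x + / 2) * z =
  RtoC (- r / 4) + (Ci * (z / 2) + (RtoC (- r * x ^ 2) + Ci * RtoC x * (z + Ci * r))))%C.
  have -> : (z / 2 = RtoC (/ 2) * z)%C by rewrite RtoC_inv; [field|lra].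
  by apply: Ceq; case: z => u v /=; field.
by rewrite !Cexp_add; ring.
Qed.

Lemma Csin_half z :
  Csin (z / 2) = (Cexp (Ci * (z / 2)) * (1 - Cexp (- (Ci * z))) / (2 * Ci))%C.
Proof.
rewrite /Csin; congr (_ / _)%C.
have -> : Cexp (- (Ci * (z / 2))) = (Cexp (Ci * (z / 2)) * Cexp (- (Ci * z)))%C.
  by rewrite -Cexp_add; congr Cexp; field.
by ring.
Qed.

Lemma Ci_neq0 : Ci <> 0.
Proof. by move=> /(f_equal Im) /=; lra. Qed.

Lemma Theta1E r z : 0 < r -> Theta1 r z = (- Ci * theta (/ 2) 0 r z)%C.
Proof.
move=> r0; rewrite /Theta1 -/(theta1_factor r z) Csin_half theta_half //.
have i2 : (Ci * Ci = -1)%C by apply: Ceq => /=; ring.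
have i0 := Ci_neq0; have iV : (/ Ci = - Ci)%C.
  by rewrite -(Cmult_1_r (- Ci)) -(Cinv_r Ci) //; transitivity (- (Ci * Ci) * / Ci)%C; [rewrite i2; ring|ring].
case: (classic (Cexp (- (Ci * z)) = 1)) => w1.
  (* The sine vanishes here, and the finite identity forces the series to vanish. *)
  have h : (theta 0 0 r (z + Ci * r) = 0)%C.
    have hu : is_lim_seq (fun N => Cmod (1 - exp (- 2 * INR N * r) *
        Cexp (- (Ci * z)) - 1)%C) 0.
      apply: is_lim_seq_ext (exp_lim0 r0) => N.
      rewrite w1 (_ : (_ - _)%C = (- RtoC (exp (- 2 * INR N * r)))%C); last by ring.
      by rewrite Cmod_opp Cmod_R Rabs_pos_eq //; exact/Rlt_le/exp_pos.
    have := C_lim_mult (triple_product (z + Ci * r) r0) hu.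
    rewrite Cmult_1_r => hl; apply: (C_lim_unique hl).
    apply: (is_lim_seq_ext (fun _ => 0)); last exact: is_lim_seq_const.
    by move=> N; rewrite -theta1_partial w1 (_ : (_ - _)%C = 0) ?Cmod_0 //; ring.
  by rewrite w1 h /Cdiv; ring.
rewrite (Cprod_infE (theta1_product r0 w1)).
have w0 : (1 - Cexp (- (Ci * z)))%C <> 0.
  by move=> h; apply: w1; rewrite -(Cplus_0_r (Cexp _)) -h; ring.
by rewrite -iV; field; split.
Qed.

(** * The theta functions on the real line *)

Lemma Cexp_circle x : Cexp (Ci * RtoC x) = (cos x, sin x).
Proof.
by apply: Ceq; rewrite /= !Rmult_0_l !Rmult_1_l Rminus_0_r exp_0 Rplus_0_l; ring.
Qed.

Lemma Cexp_circleN x : Cexp (- (Ci * RtoC x)) = (cos x, - sin x).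
Proof.
have -> : (- (Ci * RtoC x) = Ci * RtoC (- x))%C by rewrite RtoC_opp; ring.
by rewrite Cexp_circle cos_neg sin_neg.
Qed.

Definition circle_factor (r x : R) (e : nat -> R) (m : nat) : C :=
  ((1 - exp (- 2 * INR m * r)) * (1 - e m * Cexp (Ci * RtoC x))
   * (1 - e m * Cexp (- (Ci * RtoC x))))%C.

(** On the circle [1 - 2 e cos x + e ^ 2 >= (1 - e) ^ 2], so every factor is at least
    the cube of [1 - exp (- m r)], and [exp (- m r) = exp (-2 m (r / 2))].  This
    treats the products of both theta functions at once. *)
Lemma circle_prod_ge r x (e : nat -> R) : 0 < r ->
  (forall m, (0 < m)%N -> 0 <= e m <= exp (- (INR m * r))) ->
  forall N, exists2 g, \big[Cmult/RtoC 1]_(1 <= m < N.+1) circle_factor r x e m = RtoC g &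
    qpoch (r / 2) N ^ 3 <= g.
Proof.
move=> r0 he; have r2 : 0 < r / 2 by lra.
elim=> [|N [g hg gN]]; first by exists 1; rewrite ?big_geq // qpoch0; lra.
pose E := exp (- 2 * INR N.+1 * r); pose a := e N.+1.
exists (g * ((1 - E) * (1 - 2 * a * cos x + a ^ 2))).
  rewrite big_nat_recr //= hg RtoC_mult; congr (_ * _)%C.
  rewrite /circle_factor -/(INR N.+1) -/a -/E Cexp_circle Cexp_circleN; apply: Ceq => /=.
    have -> : (1 - 2 * a * cos x + a * (a * 1)) =
      (1 - 2 * a * cos x + a * a * (sin x * sin x + cos x * cos x)).
      by have := sin2_cos2 x; rewrite /Rsqr => ->; ring.
    by ring.
  by ring.
have [a0 a1] := he N.+1 (ltn0Sn N); rewrite -/a in a0 a1.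
set y := exp (- (INR N.+1 * r)) in a1.
have [q0 q1] := qfactor N r2; have qy : exp (- 2 * INR N.+1 * (r / 2)) = y.
  by congr exp; field.
rewrite qy in q0 q1; rewrite qpochS qy Rpow_mult_distr.
have p0 := qpoch_gt0 N r2.
apply: Rmult_le_compat => //; try (apply: pow_le; lra).
have Ey : E <= y by apply: exp_mono; have := INR_S_ge1 N; nra.
have hc : (1 - y) ^ 2 <= 1 - 2 * a * cos x + a ^ 2.
  have := COS_bound x => -[_ c1]; apply: Rle_trans (_ : (1 - a) ^ 2 <= _); nra.
rewrite -tech_pow_Rmult; apply: Rmult_le_compat; try lra; exact: pow2_ge_0.
Qed.

Lemma circle_prod_lim r x (e : nat -> R) L : 0 < r ->
  (forall m, (0 < m)%N -> 0 <= e m <= exp (- (INR m * r))) ->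
  is_lim_seq (fun N => Cmod (\big[Cmult/RtoC 1]_(1 <= m < N.+1) circle_factor r x e m
    - L)%C) 0 -> L = RtoC (Re L) /\ 0 < Re L.
Proof.
move=> r0 he hL; have hp := circle_prod_ge x r0 he.
have hI : Im L = 0.
  have := is_lim_seq_unique _ _ (is_lim_seq_Cmod_Im hL).
  rewrite (Lim_seq_ext _ (fun _ => 0)) ?Lim_seq_const => [[]|N] //.
  by have [g -> _] := hp N.
split; first by apply: Ceq.
have r2 : 0 < r / 2 by lra.
have hq := is_lim_seq_mult' _ _ _ _ (qpoch_lim r2)
  (is_lim_seq_mult' _ _ _ _ (qpoch_lim r2) (qpoch_lim r2)).
have := is_lim_seq_le _ _ _ _ _ hq (is_lim_seq_Cmod_Re hL).
have h N : qpoch (r / 2) N * (qpoch (r / 2) N * qpoch (r / 2) N) <=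
    Re (\big[Cmult/RtoC 1]_(1 <= m < N.+1) circle_factor r x e m).
  by have [g -> /= hg] := hp N; rewrite Rmult_1_r in hg.
move/(_ h) => /=; have : 0 < euler (r / 2) by apply: exp_pos.
move=> e0; apply: Rlt_le_trans.
by apply: Rmult_lt_0_compat => //; apply: Rmult_lt_0_compat.
Qed.

(** The two theta functions: [true] stands for [Theta1], [false] for [Theta3],
    and [p] counts derivatives in [z]. *)
Definition th_char (t : bool) : R := if t then / 2 else 0.
Definition th_unit (t : bool) : C := if t then (- Ci)%C else 1.

Definition Th (t : bool) (p : nat) (r : R) (z : C) : C :=
  ((th_unit t) * theta (th_char t) p r z)%C.

Definition th (t : bool) (p : nat) (r x : R) : R := Re (Th t p r (RtoC x)).

Lemma Theta1_Th r z : 0 < r -> Theta1 r z = Th true 0 r z.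
Proof. exact: Theta1E. Qed.

Lemma Theta3_Th r z : 0 < r -> Theta3 r z = Th false 0 r z.
Proof. by move=> r0; rewrite Theta3E // /Th /th_unit /th_char; ring. Qed.

Lemma th3_gt0 r x : 0 < r -> 0 < th false 0 r x.
Proof.
move=> r0; rewrite /th -Theta3_Th // Theta3E //.
pose e m := exp (- (2 * INR m - 1) * r).
have [||_ //] := @circle_prod_lim r x e (theta 0 0 r (RtoC x)) r0.
  move=> m m0; split; first exact/Rlt_le/exp_pos.
  by apply: exp_mono; rewrite -(prednK m0); have := INR_S_ge1 m.-1; nra.
exact: (triple_product (RtoC x) r0).
Qed.

Lemma th1_gt0 r x : 0 < r -> 0 < x < 2 * PI -> 0 < th true 0 r x.
Proof.
move=> r0 [x0 x1]; rewrite /th -Theta1_Th // /Theta1.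
have s0 : 0 < sin (x / 2) by apply: sin_gt_0; lra.
have w1 : Cexp (- (Ci * RtoC x))%C <> 1.
  rewrite Cexp_circleN => /(f_equal Re) /= h.
  have := cos_2a_sin (x / 2); rewrite (_ : 2 * (x / 2) = x); last by field.
  by nra.
have hl := theta1_product r0 w1.
pose e m := exp (- 2 * INR m * r).
have [|hL L0] := @circle_prod_lim r x e _ r0 _ hl.
  move=> m m0; split; first exact/Rlt_le/exp_pos.
  by apply: exp_mono; rewrite -(prednK m0); have := INR_S_ge1 m.-1; nra.
rewrite (Cprod_infE hl) hL.
have -> : Csin (RtoC x / 2) = RtoC (sin (x / 2)).
  rewrite /Csin; have -> : (RtoC x / 2 = RtoC (x / 2))%C by rewrite RtoC_div //; lra.
  set y := x / 2.
  have -> : (Cexp (Ci * RtoC y) - Cexp (- (Ci * RtoC y)) = RtoC (sin y) * (2 * Ci))%C.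
    by rewrite Cexp_circle Cexp_circleN; apply: Ceq => /=; ring.
  by field; exact: Ci_neq0.
rewrite -!RtoC_mult /=; repeat apply: Rmult_lt_0_compat => //; [lra|exact: exp_pos].
Qed.

(** The theta series is real for [h = 0] and imaginary for [h = 1/2]. *)
Lemma Th_real t p r x : 0 < r -> Th t p r (RtoC x) = RtoC (th t p r x).
Proof.
move=> r0; apply: Ceq => //=; rewrite /Th.
have : Cconj (theta (th_char t) p r (RtoC x)) =
    (RtoC (sgnZ (if t then 1%Z else 0%Z)) * theta (th_char t) p r (RtoC x))%C.
  by case: t; apply: theta_conj => //; rewrite /th_char; field.
case: theta => u v; rewrite /sgnZ /th_unit; case: t => /= -[h1 h2]; lra.
Qed.

Lemma is_derive_Th t p r z : 0 < r -> is_derive (Th t p r) z (Th t p.+1 r z).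
Proof.
move=> r0.
have := is_derive_theta (th_char t) p z r0.
move=> /C_is_derive_absring/(is_derive_mult _ _ _ _ _
  (@is_derive_const _ (AbsRing_NormedModule C_AbsRing) (th_unit t) z)).
move=> /(_ Cmult_comm) h; apply/C_is_derive_absring.
move: h; congr is_derive.
by rewrite /plus /mult /zero /= /Th; ring.
Qed.

Lemma is_derive_th_x t p r x : 0 < r -> is_derive (th t p r) x (th t p.+1 r x).
Proof.
move=> r0; have [M M0 hM] := theta_z_quad (th_char t) p (RtoC x) r0.
have c1 : Cmod (th_unit t) = 1.
  by case: t {hM}; rewrite /th_unit ?Cmod_opp ?Cmod_Ci ?Cmod_1.
apply: (@is_derive_Re (fun x => Th t p r (RtoC x)) _ _ M 1); first lra.
move=> e he; have := hM (RtoC e); rewrite Cmod_R => /(_ he).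
rewrite /Th RtoC_plus; set c := th_unit t in c1 *.
apply: Rle_trans; rewrite -[X in _ <= X]Rmult_1_l -{1}c1 -Cmod_mult.
by apply: Req_le; congr Cmod; ring.
Qed.

Lemma is_derive_th_r t p r x : 0 < r ->
  is_derive (fun s => th t p s x) r (th t p.+2 r x).
Proof.
move=> r0; have [M M0 hM] := theta_r_quad (th_char t) p (RtoC x) r0.
have c1 : Cmod (th_unit t) = 1.
  by case: t {hM}; rewrite /th_unit ?Cmod_opp ?Cmod_Ci ?Cmod_1.
apply: (@is_derive_Re (fun s => Th t p s (RtoC x)) _ _ M (r / 2)); first lra.
move=> e he; have := hM e he.
rewrite /Th; set c := th_unit t in c1 *.
apply: Rle_trans; rewrite -[X in _ <= X]Rmult_1_l -{1}c1 -Cmod_mult.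
by apply: Req_le; congr Cmod; ring.
Qed.

Lemma th_opp t p r x : 0 < r -> th t p r (- x) = (-1) ^ (t + p) * th t p r x.
Proof.
move=> r0; rewrite /th /Th RtoC_opp.
have -> : theta (th_char t) p r (- RtoC x) =
  (RtoC (sgnZ (if t then 1%Z else 0%Z) * (-1) ^ p) * theta (th_char t) p r (RtoC x))%C.
  by case: t; apply: theta_opp => //; rewrite /th_char; field.
have -> : sgnZ (if t then 1%Z else 0%Z) * (-1) ^ p = (-1) ^ (t + p).
  by case: t; rewrite ?add1n ?add0n /sgnZ /=; ring.
set s := _ ^ _; case: theta => u v; rewrite /th_unit; move: s; case: t => s /=; ring.
Qed.

(** * The trilinear identity *)

Lemma theta_char_shift j h p r z : 0 < r ->
  theta (h + IZR j) p r z = (RtoC (sgnZ j) * theta h p r z)%C.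
Proof.
move=> r0; pose up k := (k + j)%Z; pose dn k := (k - j)%Z.
have ud : cancel up dn by move=> k; rewrite /up /dn; lia.
have du : cancel dn up by move=> k; rewrite /up /dn; lia.
rewrite /theta -(csum_reindex ud du (absum_theta h p z r0)) -csumZ; last first.
  exact: (absum_reindex ud (absum_theta h p z r0)).
apply: csum_ext => k; rewrite /theta_term /up sgnZ_add plus_IZR.
have -> : IZR k + (h + IZR j) = IZR k + IZR j + h by ring.
set x := _ + h; set E := Cexp _.
have s1 : sgnZ j * sgnZ j = 1 by rewrite /sgnZ; case: Z.even; ring.
transitivity (RtoC (sgnZ j * sgnZ j) * (sgnZ k * (Ci * x) ^ p * E))%C.
  by rewrite s1; ring.
by rewrite !RtoC_mult; ring.
Qed.

(** The substitution [k -> - k] at [z = 0]. *)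
Lemma theta_char_opp h p r : 0 < r ->
  theta (- h) p r 0 = (RtoC ((-1) ^ p) * theta h p r 0)%C.
Proof.
move=> r0.
have e2 : cancel Z.opp Z.opp by move=> k; lia.
rewrite /theta -(csum_reindex e2 e2 (absum_theta h p 0 r0)) -csumZ; last first.
  exact: (absum_reindex e2 (absum_theta h p 0 r0)).
apply: csum_ext => k; rewrite /theta_term sgnZ_opp opp_IZR; set x := IZR k.
have -> : - r * (- x + h) ^ 2 = - r * (x + - h) ^ 2 by ring.
have -> : (Ci * RtoC (- x + h) = - (Ci * RtoC (x + - h)))%C.
  rewrite (_ : - x + h = - (x + - h)) ?RtoC_opp; ring.
rewrite Cpow_opp.
have -> : (- (Ci * RtoC (x + - h)) * 0 = Ci * RtoC (x + - h) * 0)%C by ring.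
have s2 : (-1) ^ p * (-1) ^ p = 1.
  by rewrite -Rpow_mult_distr (_ : -1 * -1 = 1) ?pow1 //; ring.
set E := Cexp _; set P := (_ ^ p)%C.
transitivity (RtoC ((-1) ^ p * (-1) ^ p) * (sgnZ k * P * E))%C; first by rewrite s2; ring.
by rewrite !RtoC_mult; ring.
Qed.

(** Euler's pentagonal number theorem, as the triple product for [3 s] at
    [z = i s]: the three factors run through all residues modulo 3. *)
Lemma pentagonal s : 0 < s ->
  theta (/ 6) 0 (3 * s) 0 = RtoC (exp (log_euler s - s / 12)).
Proof.
move=> s0; have s3 : 0 < 3 * s by lra.
have -> : theta (/ 6) 0 (3 * s) 0 = (exp (- s / 12) * theta 0 0 (3 * s) (Ci * s))%C.
  rewrite /theta -csumZ; last exact: absum_theta.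
  have c0 (w : C) : (w ^ 0)%C = 1 by [].
  apply: csum_ext => k; rewrite /theta_term !c0 Rplus_0_r -Cexp_RtoC; set x := IZR k.
  have -> : (RtoC (- (3 * s) * (x + / 6) ^ 2) + Ci * RtoC (x + / 6) * 0 =
    RtoC (- s / 12) + (RtoC (- (3 * s) * x ^ 2) + Ci * RtoC x * (Ci * s)))%C.
    by apply: Ceq => /=; field.
  by rewrite Cexp_add; ring.
have -> : theta 0 0 (3 * s) (Ci * s) = RtoC (euler s).
  have h := triple_product (Ci * s) s3; apply: (C_lim_unique h).
  have hl : is_lim_seq (fun N => Rabs (qpoch s (3 * N) - euler s)) 0.
    have := is_lim_seq_abs _ _ (is_lim_seq_minus' _ _ _ _
      (@qpoch_lim_shift s (fun N => 3 * N)%N s0 _) (is_lim_seq_const (euler s))).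
    rewrite Rminus_diag [Rbar_abs _]/= Rabs_R0; apply=> M; exists M => N /leq_trans; apply.
    exact: leq_pmull.
  apply: is_lim_seq_ext hl => N; rewrite -Cmod_R RtoC_minus; congr (Cmod (_ - _)%C).
  elim: N => [|N IH]; first by rewrite muln0 qpoch0 big_geq.
  rewrite big_nat_recr //= -IH mulnS addnC !addnS addn0 !qpochS -/(INR N.+1).
  have asc (u x y t : R) : u * x * y * t = u * (x * y * t) by ring.
  rewrite asc RtoC_mult; congr (_ * _)%C.
  rewrite /theta3_factor.
  have -> : Cexp (Ci * (Ci * s)) = RtoC (exp (- s)).
    by rewrite -Cexp_RtoC; congr Cexp; apply: Ceq => /=; ring.
  have -> : Cexp (- (Ci * (Ci * s))) = RtoC (exp s).
    by rewrite -Cexp_RtoC; congr Cexp; apply: Ceq => /=; ring.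
  rewrite -!RtoC_mult -!RtoC_minus -!RtoC_mult -!exp_plus; congr RtoC.
  have E3 : INR (3 * N)%N = 3 * INR N by rewrite mult_INR /=; ring.
  have -> : - 2 * INR N.+1 * (3 * s) = - 2 * INR (3 * N).+3 * s.
    by rewrite !S_INR E3; ring.
  have -> : - (2 * INR N.+1 - 1) * (3 * s) + - s = - 2 * INR (3 * N).+2 * s.
    by rewrite !S_INR E3; ring.
  have -> : - (2 * INR N.+1 - 1) * (3 * s) + s = - 2 * INR (3 * N).+1 * s.
    by rewrite !S_INR E3; ring.
  by ring.
rewrite -RtoC_mult /euler -exp_plus; congr (RtoC (exp _)); field.
Qed.

(** The heat equation at [z = 0] turns the logarithmic derivative of the Euler
    product into a relation between theta constants. *)
Lemma theta_const_sixth r : 0 < r ->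
  (9 * theta (/ 6) 2 (3 * r) 0 = RtoC (3 / 2 * Eis r) * theta (/ 6) 0 (3 * r) 0)%C.
Proof.
move=> r0; have r3 : 0 < 3 * r by lra.
have hre : theta (/ 6) 2 (3 * r) 0 = RtoC (Re (theta (/ 6) 2 (3 * r) 0)).
  pose f k := - sgnZ k * (IZR k + / 6) ^ 2 * exp (- (3 * r) * (IZR k + / 6) ^ 2).
  have E k : theta_term (/ 6) 2 (3 * r) 0 k = RtoC (f k).
    rewrite /theta_term /f; set x := _ + / 6.
    rewrite Cmult_0_r Cplus_0_r Cexp_RtoC; apply: Ceq => /=; ring.
  rewrite /theta (csum_ext E); apply: csum_real.
  exact: absum_ext E (absum_theta (/ 6) 2 0 r3).
have [M M0 hM] := theta_r_quad (/ 6) 0 0 r3.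
have d1 : is_derive (fun s => Re (theta (/ 6) 0 s 0)) (3 * r) (Re (theta (/ 6) 2 (3 * r) 0)).
  by apply: (@is_derive_Re (fun s => theta (/ 6) 0 s 0) _ _ M (3 * r / 2)); [lra|exact: hM].
have d2 : is_derive (fun s => Re (theta (/ 6) 0 (3 * s) 0)) r (3 * Re (theta (/ 6) 2 (3 * r) 0)).
  apply: (is_derive_comp (fun s => Re (theta (/ 6) 0 s 0)) (fun s => 3 * s)) d1 _.
  by auto_derive => //; ring.
have d3 : is_derive (fun s => exp (log_euler s - s / 12)) r
    (exp (log_euler r - r / 12) * (Eis r / 2)).
  have := is_derive_comp exp (fun s => log_euler s - s / 12) r _ _ (is_derive_exp _)
    (is_derive_minus _ _ _ _ _ (is_derive_log_euler r0)
      (_ : is_derive (fun s => s / 12) r (/ 12))).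
  rewrite /scal /minus /plus /opp /= /mult /=.
  have -> : (Eis r + 1 / 6) / 2 + - / 12 = Eis r / 2 by field.
  rewrite Rmult_comm; apply; auto_derive => //; field.
have d4 : is_derive (fun s => Re (theta (/ 6) 0 (3 * s) 0)) r
    (exp (log_euler r - r / 12) * (Eis r / 2)).
  apply: is_derive_ext_loc d3; exists (mkposreal _ r0) => s hs.
  have {}hs : Rabs (s - r) < r := hs.
  rewrite pentagonal //; by move: hs => /Rabs_def2; lra.
have := is_derive_unique _ _ _ d2; rewrite (is_derive_unique _ _ _ d4) => e.
rewrite hre pentagonal // -!RtoC_mult; congr RtoC; lra.
Qed.

(** The characteristic [1/2] makes even derivatives odd functions of [z]. *)
Lemma theta_const_half p r : 0 < r -> (-1) ^ p = 1 -> theta (/ 2) p r 0 = 0.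
Proof.
move=> r0 hp; have := @theta_opp 1 (/ 2) p r 0 r0 ltac:(field).
rewrite hp (_ : sgnZ 1 = -1) // Rmult_1_r (_ : (- 0)%C = 0); last by ring.
case: theta => u v [h1 h2]; apply: Ceq => /=; lra.
Qed.

(** Integer shifts and the sign of the characteristic reduce every [(n + 1/2) / 3]
    to [1/6] or [1/2]. *)
Lemma theta_const r n : 0 < r -> let h := (IZR n + / 2) / 3 in
  (9 * theta h 2 (3 * r) 0 = RtoC (3 / 2 * Eis r) * theta h 0 (3 * r) 0)%C.
Proof.
move=> r0 h; have r3 : 0 < 3 * r by lra.
have [j [c [hc hn]]] : exists j c, (c = 0 \/ c = 1 \/ c = -1)%Z /\ n = (3 * j + c)%Z.
  have := Z.mod_pos_bound n 3 ltac:(lia); have := Z.div_mod n 3 ltac:(lia).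
  set q := Z.div _ _; set m := Z.modulo _ _ => hq hm.
  case: (Z.eq_dec m 2) => m2; first by exists (q + 1)%Z, (-1)%Z; lia.
  by exists q, m; lia.
have -> : h = (IZR c + / 2) / 3 + IZR j by rewrite /h hn plus_IZR mult_IZR; field.
rewrite !theta_char_shift //.
have key : (9 * theta ((IZR c + / 2) / 3) 2 (3 * r) 0 =
    RtoC (3 / 2 * Eis r) * theta ((IZR c + / 2) / 3) 0 (3 * r) 0)%C.
  case: hc => [|[|]] ->.
  - have -> : (IZR 0 + / 2) / 3 = / 6 by field.
    exact: theta_const_sixth.
  - have -> : (IZR 1 + / 2) / 3 = / 2 by field.
    by rewrite !theta_const_half //=; ring.
  - have -> : (IZR (-1) + / 2) / 3 = - / 6 by field.
    rewrite !theta_char_opp //= !Rmult_1_r (_ : -1 * -1 = 1); last by ring.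
    by rewrite !Cmult_1_l; exact: theta_const_sixth.
set s := RtoC (sgnZ j).
transitivity (s * (9 * theta ((IZR c + / 2) / 3) 2 (3 * r) 0))%C; first by ring.
by rewrite key; ring.
Qed.

Lemma absum_prod3 (I J K : eqType) (a : I -> C) (b : J -> C) (c : K -> C) :
  absum a -> absum b -> absum c ->
  absum (fun p : (I * J) * K => a p.1.1 * b p.1.2 * c p.2)%C.
Proof. by move=> ha hb hc; exact: (absum_prod (absum_prod ha hb) hc). Qed.

Lemma csum_prod3 (I J K : eqType) (a : I -> C) (b : J -> C) (c : K -> C) :
  absum a -> absum b -> absum c ->
  csum (fun p : (I * J) * K => a p.1.1 * b p.1.2 * c p.2)%C = (csum a * csum b * csum c)%C.
Proof.
by move=> ha hb hc; rewrite (csum_prod (absum_prod ha hb) hc) csum_prod.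
Qed.

Lemma theta_termE h p r z k :
  theta_term h p r z k = ((Ci * RtoC (IZR k + h)) ^ p * theta_term h 0 r z k)%C.
Proof. by rewrite /theta_term; have -> : forall w, (w ^ 0)%C = 1 by []; ring. Qed.

(** The left side is the second derivative at [t = 0] of the product of the three
    theta functions at [x + t], [y + t], [z + t].  In the triple sum, put
    [k = (m + a, m + b, m)].  For fixed [a] and [b] the exponent splits
    orthogonally along [(1, 1, 1)]: as [x + y + z = 0], the variable [m] occurs
    only in [exp (- 3 r (m + h) ^ 2)] with [3 h = a + b + h1 + h2 + h3], and the
    sum over [m] vanishes by [theta_const]. *)
Lemma theta_trilinear (h1 h2 h3 r : R) (x y z : C) (n0 : Z) : 0 < r ->
  h1 + h2 + h3 = IZR n0 + / 2 -> (x + y + z = 0)%C ->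
  let T h w p := theta h p r w in
  (T h1 x 2%N * T h2 y 0%N * T h3 z 0%N + T h1 x 0%N * T h2 y 2%N * T h3 z 0%N
   + T h1 x 0%N * T h2 y 0%N * T h3 z 2%N
   + 2 * (T h1 x 1%N * T h2 y 1%N * T h3 z 0%N + T h1 x 1%N * T h2 y 0%N * T h3 z 1%N
          + T h1 x 0%N * T h2 y 1%N * T h3 z 1%N)
   = RtoC (3 / 2 * Eis r) * (T h1 x 0%N * T h2 y 0%N * T h3 z 0%N))%C.
Proof.
move=> r0 hn xyz T; have r3 : 0 < 3 * r by lra.
set c := RtoC (3 / 2 * Eis r).
pose S p q s (k : (Z * Z) * Z) := (theta_term h1 p r x k.1.1 *
  theta_term h2 q r y k.1.2 * theta_term h3 s r z k.2)%C.
have aS p q s : absum (S p q s) by apply: absum_prod3; apply: absum_theta.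
have cS p q s : csum (S p q s) = (T h1 x p * T h2 y q * T h3 z s)%C.
  by apply: csum_prod3; apply: absum_theta.
pose kap (k : (Z * Z) * Z) := (Ci * RtoC (IZR k.1.1 + h1) + Ci * RtoC (IZR k.1.2 + h2) +
  Ci * RtoC (IZR k.2 + h3))%C.
pose G k := ((kap k * kap k - c) * S 0%N 0%N 0%N k)%C.
have EG k : G k = (S 2%N 0%N 0%N k + (S 0%N 2%N 0%N k + (S 0%N 0%N 2%N k
   + (2 * (S 1%N 1%N 0%N k + (S 1%N 0%N 1%N k + S 0%N 1%N 1%N k))
   + (- c) * S 0%N 0%N 0%N k))))%C.
  rewrite /G /S !(theta_termE _ 1) !(theta_termE _ 2) /kap.
  set u := theta_term h1 0 _ _ _; set v := theta_term h2 0 _ _ _.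
  set w := theta_term h3 0 _ _ _; rewrite /=; ring.
have a1 := absumZ (- c) (aS 0%N 0%N 0%N).
have a2 := absumD (aS 1%N 0%N 1%N) (aS 0%N 1%N 1%N).
have a3 := absumD (aS 1%N 1%N 0%N) a2.
have a4 := absumD (absumZ 2 a3) a1.
have a5 := absumD (aS 0%N 0%N 2%N) a4.
have a6 := absumD (aS 0%N 2%N 0%N) a5.
have a7 := absumD (aS 2%N 0%N 0%N) a6.
have aG : absum G by apply: absum_ext a7 => k; rewrite EG.
have G0 : csum G = 0.
  pose e (p : (Z * Z) * Z) := ((p.2 + p.1.1)%Z, (p.2 + p.1.2)%Z, p.2).
  pose f (p : (Z * Z) * Z) := ((p.1.1 - p.2)%Z, (p.1.2 - p.2)%Z, p.2).
  have ef : cancel e f by case=> [[a b] m]; rewrite /e /f /=; congr (_, _, _); lia.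
  have fe : cancel f e by case=> [[a b] m]; rewrite /e /f /=; congr (_, _, _); lia.
  rewrite -(csum_reindex ef fe aG) (csum_fubini (absum_reindex ef aG)).
  rewrite -[RHS](csum0 (Z * Z)%type); apply: csum_ext => -[a b].
  pose N := (a + b + n0)%Z; pose h := (IZR N + / 2) / 3.
  have hN : 3 * h = IZR a + IZR b + (h1 + h2 + h3).
    by rewrite /h /N !plus_IZR hn; field.
  (* The component of the exponent orthogonal to (1, 1, 1). *)
  pose v1 := IZR a + h1 - h; pose v2 := IZR b + h2 - h; pose v3 := h3 - h.
  pose K := (RtoC (sgnZ a * sgnZ b * exp (- r * (v1 ^ 2 + v2 ^ 2 + v3 ^ 2))) *
    Cexp (Ci * RtoC v1 * x + Ci * RtoC v2 * y + Ci * RtoC v3 * z))%C.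
  have E m : G (e (a, b, m)) = (K * 9 * theta_term h 2 (3 * r) 0 m +
      - (K * c) * theta_term h 0 (3 * r) 0 m)%C.
    have -> : G (e (a, b, m)) = ((9 * (Ci * RtoC (IZR m + h)) ^ 2 - c) *
        (K * theta_term h 0 (3 * r) 0 m))%C.
      rewrite /G; congr (_ * _)%C.
        have -> : kap (e (a, b, m)) = (3 * (Ci * RtoC (IZR m + h)))%C.
          rewrite /kap /e /= !plus_IZR.
          transitivity (Ci * RtoC (IZR m + IZR a + h1 + (IZR m + IZR b + h2) + (IZR m + h3)))%C.
            by rewrite !RtoC_plus; ring.
          transitivity (Ci * RtoC (3 * (IZR m + h)))%C; last by rewrite RtoC_mult; ring.
          by congr (_ * RtoC _)%C; rewrite Rmult_plus_distr_l hN; ring.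
        by rewrite /=; ring.
      have c0 (w : C) : (w ^ 0)%C = 1 by [].
      rewrite /S /e /theta_term !c0 /= !sgnZ_add !plus_IZR /K.
      set X := IZR m + h.
      have -> : IZR m + IZR a + h1 = X + v1 by rewrite /X /v1; ring.
      have -> : IZR m + IZR b + h2 = X + v2 by rewrite /X /v2; ring.
      have -> : IZR m + h3 = X + v3 by rewrite /X /v3; ring.
      have vs : v1 + v2 + v3 = 0.
        rewrite /v1 /v2 /v3; lra.
      have e3 (u1 u2 u3 : C) (s1 s2 s3 : R) : (RtoC s1 * 1 * Cexp u1 * (RtoC s2 * 1 * Cexp u2) *
         (RtoC s3 * 1 * Cexp u3) = RtoC (s1 * s2 * s3) * Cexp (u1 + u2 + u3))%C.
        by rewrite !Cexp_add !RtoC_mult; ring.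
      have e4 (s1 t s2 : R) (u1 u2 : C) : (RtoC (s1 * exp t) * Cexp u1 * (RtoC s2 * 1 * Cexp u2) =
         RtoC (s1 * s2) * Cexp (RtoC t + u1 + u2))%C.
        by rewrite !Cexp_add !RtoC_mult Cexp_RtoC; ring.
      rewrite e3 e4; congr (RtoC _ * Cexp _)%C.
        have s1 : sgnZ m * sgnZ m = 1 by rewrite /sgnZ; case: Z.even; ring.
        transitivity (sgnZ m * sgnZ m * (sgnZ m * sgnZ a * sgnZ b)); first by ring.
        by rewrite s1; ring.
      have hz : z = (- (x + y))%C by rewrite -(Cplus_0_r (- (x + y))) -xyz; ring.
      have hv : v3 = - (v1 + v2) by lra.
      rewrite hz hv; apply: Ceq; case: (x) => x1 x2; case: (y) => y1 y2 /=; ring.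
    rewrite (theta_termE h 2); ring.
  have ah p := absum_theta h p 0 r3.
  rewrite (csum_ext E) csumD ?csumZ //; try exact: absumZ.
  have := theta_const N r0; rewrite -/h /= => hc.
  transitivity (K * (9 * theta h 2 (3 * r) 0 - c * theta h 0 (3 * r) 0))%C.
    by rewrite /theta; ring.
  by rewrite hc -/c; ring.
move: G0; rewrite (csum_ext EG) (csumD (aS 2%N 0%N 0%N) a6).
rewrite (csumD (aS 0%N 2%N 0%N) a5) (csumD (aS 0%N 0%N 2%N) a4) (csumD (absumZ 2 a3) a1).
rewrite (csumZ _ a3) (csumD (aS 1%N 1%N 0%N) a2) (csumD (aS 1%N 0%N 1%N) (aS 0%N 1%N 1%N)).
rewrite (csumZ _ (aS 0%N 0%N 0%N)) !cS => H.
by rewrite -[RHS]Cplus_0_r -H; ring.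
Qed.

(** * Logarithmic derivatives of the theta functions *)

Definition log_th (t : bool) (r x : R) : R := ln (Rabs (th t 0 r x)).
Definition dlog_th (t : bool) (r x : R) : R := th t 1 r x / th t 0 r x.
(** By the heat equation, also the derivative of [log_th] in [r]. *)
Definition heat_th (t : bool) (r x : R) : R := th t 2 r x / th t 0 r x.

Lemma log_th_opp t r x : 0 < r -> log_th t r (- x) = log_th t r x.
Proof.
move=> r0; rewrite /log_th th_opp // Rabs_mult -RPow_abs Rabs_Ropp Rabs_R1 pow1.
by rewrite Rmult_1_l.
Qed.

Lemma sign_pow (t : bool) : exists e, (e = 1 \/ e = -1) /\
  ((-1) ^ (t + 0) = e /\ (-1) ^ (t + 1) = - e /\ (-1) ^ (t + 2) = e).
Proof. by case: t; [exists (-1)|exists 1]; rewrite /=; intuition lra. Qed.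

Lemma dlog_th_opp t r x : 0 < r -> dlog_th t r (- x) = - dlog_th t r x.
Proof.
move=> r0; rewrite /dlog_th !th_opp //.
have [e [he [-> [-> _]]]] := sign_pow t; case: he => ->.
  by rewrite !Rmult_1_l /Rdiv; ring.
by rewrite (_ : -1 * th t 0 r x = - th t 0 r x) /Rdiv ?Rinv_opp; ring.
Qed.

Lemma heat_th_opp t r x : 0 < r -> heat_th t r (- x) = heat_th t r x.
Proof.
move=> r0; rewrite /heat_th !th_opp //.
have [e [he [-> [_ ->]]]] := sign_pow t; case: he => ->.
  by rewrite !Rmult_1_l /Rdiv; ring.
by rewrite (_ : -1 * th t 0 r x = - th t 0 r x) /Rdiv ?Rinv_opp; ring.
Qed.

Lemma is_derive_ln_abs (f : R -> R) x df : f x <> 0 -> is_derive f x df ->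
  is_derive (fun t => ln (Rabs (f t))) x (df / f x).
Proof.
move=> f0 hf.
have h0 : 0 < Rabs (f x) by apply: Rabs_pos_lt.
have := is_derive_comp ln (fun t => Rabs (f t)) x _ _ (is_derive_ln _ h0)
  (is_derive_Rabs f x df hf f0).
congr is_derive; rewrite /scal /= /mult /=.
case: (Rtotal_order (f x) 0) => [h|[//|h]].
  by rewrite sign_eq_m1 // Rabs_left //; field.
by rewrite sign_eq_1 // Rabs_pos_eq; [field|lra].
Qed.

Lemma is_derive_log_th t r x : 0 < r -> th t 0 r x <> 0 ->
  is_derive (log_th t r) x (dlog_th t r x).
Proof. by move=> r0 h; apply: is_derive_ln_abs => //; apply: is_derive_th_x. Qed.

Lemma is_derive_log_th_r t r x : 0 < r -> th t 0 r x <> 0 ->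
  is_derive (fun s => log_th t s x) r (heat_th t r x).
Proof.
by move=> r0 h; apply: (@is_derive_ln_abs (fun s => th t 0 s x)) => //; apply: is_derive_th_r.
Qed.

Lemma is_derive_dlog_th t r x : 0 < r -> th t 0 r x <> 0 ->
  is_derive (dlog_th t r) x (heat_th t r x - dlog_th t r x ^ 2).
Proof.
move=> r0 h.
have := is_derive_div _ _ _ _ _ (is_derive_th_x t 1 x r0) (is_derive_th_x t 0 x r0) h.
rewrite (_ : heat_th t r x - _ = (th t 2 r x * th t 0 r x - th t 1 r x * th t 1 r x)
  / th t 0 r x ^ 2) //; by rewrite /heat_th /dlog_th; field.
Qed.

(** [theta_trilinear] divided by the product of the three theta functions; it is the
    addition theorem of the Weierstrass zeta function.  The parity condition
    selects three [Theta1], or one [Theta1] and two [Theta3]. *)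
Lemma th_trilinear (t1 t2 t3 : bool) r x y z : 0 < r -> t1 (+) t2 (+) t3 ->
  x + y + z = 0 -> th t1 0 r x <> 0 -> th t2 0 r y <> 0 -> th t3 0 r z <> 0 ->
  heat_th t1 r x + heat_th t2 r y + heat_th t3 r z +
  2 * (dlog_th t1 r x * dlog_th t2 r y + dlog_th t2 r y * dlog_th t3 r z
       + dlog_th t3 r z * dlog_th t1 r x) = 3 / 2 * Eis r.
Proof.
move=> r0 ht xyz h1 h2 h3.
have [n hn] : exists n : Z, th_char t1 + th_char t2 + th_char t3 = IZR n + / 2.
  by move: ht; rewrite /th_char; case: (t1); case: (t2); case: (t3) => // _;
    [exists 1%Z|exists 0%Z|exists 0%Z|exists 0%Z]; field.
have xyz' : (RtoC x + RtoC y + RtoC z = 0)%C by rewrite -!RtoC_plus xyz.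
have /= := theta_trilinear r0 hn xyz'.
move=> /(f_equal (Cmult (th_unit t1 * th_unit t2 * th_unit t3)%C)) E.
have {E} : (Th t1 2 r x * Th t2 0 r y * Th t3 0 r z + Th t1 0 r x * Th t2 2 r y * Th t3 0 r z +
  Th t1 0 r x * Th t2 0 r y * Th t3 2 r z + 2 * (Th t1 1 r x * Th t2 1 r y * Th t3 0 r z +
  Th t1 1 r x * Th t2 0 r y * Th t3 1 r z + Th t1 0 r x * Th t2 1 r y * Th t3 1 r z) =
  RtoC (3 / 2 * Eis r) * (Th t1 0 r x * Th t2 0 r y * Th t3 0 r z))%C.
  move: E; rewrite /Th => E.
  match type of E with ?a = ?b => transitivity a; [ring|rewrite E] end.
  by ring.
rewrite !Th_real // -!RtoC_mult -!RtoC_plus -!RtoC_mult -!RtoC_plus => -[E].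
rewrite /heat_th /dlog_th.
set a := th t1 0 r x in h1 E *; set b := th t2 0 r y in h2 E *.
set d := th t3 0 r z in h3 E *.
apply: (Rmult_eq_reg_r (a * b * d)).
  by rewrite -E; field.
by repeat apply: Rmult_integral_contrapositive_currified.
Qed.

(** * The algebra of a neutral system of charges *)

Notation "\rsum_ ( i | P ) F" := (\big[Rplus/0]_(i | P) F)
  (at level 41, F at level 41, i at level 50).
Notation "\rsum_ i F" := (\big[Rplus/0]_i F) (at level 41, F at level 41, i at level 0).

Lemma rsum_distr (I : finType) (P : pred I) c (F : I -> R) :
  \rsum_(i | P i) (c * F i) = c * \rsum_(i | P i) F i.
Proof. by rewrite big_distrr. Qed.

Lemma rsum_add (I : finType) (P : pred I) (F G : I -> R) :
  \rsum_(i | P i) (F i + G i) = \rsum_(i | P i) F i + \rsum_(i | P i) G i.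
Proof. by rewrite big_split. Qed.

Definition pairs_sum (I : finType) (j : I) (F : I -> I -> R) : R :=
  \rsum_(b | b != j) \rsum_(d | (d != b) && (d != j)) F b d.

Section Charges.
Variables (I : finType) (j : I) (s : I -> R).
Hypotheses (s2 : forall b, s b * s b = 1) (s0 : \rsum_b s b = 0).

Lemma pairs_sum_ext (F G : I -> I -> R) :
  (forall b d, b != j -> d != j -> d != b -> F b d = G b d) ->
  pairs_sum j F = pairs_sum j G.
Proof.
move=> h; apply: eq_bigr => b bj; apply: eq_bigr => d /andP[db dj]; exact: h.
Qed.

Lemma pairs_sumD (F G : I -> I -> R) :
  pairs_sum j (fun b d => F b d + G b d) = pairs_sum j F + pairs_sum j G.
Proof. by rewrite -rsum_add; apply: eq_bigr => b _; rewrite rsum_add. Qed.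

Lemma pairs_sumZ c (F : I -> I -> R) :
  pairs_sum j (fun b d => c * F b d) = c * pairs_sum j F.
Proof. by rewrite -rsum_distr; apply: eq_bigr => b _; rewrite rsum_distr. Qed.

Lemma pairs_sum_swap (F : I -> I -> R) : pairs_sum j (fun b d => F d b) = pairs_sum j F.
Proof.
rewrite /pairs_sum (exchange_big_dep (fun d => d != j)) /=; last by move=> b d _ /andP[].
by apply: eq_bigr => b bj; apply: eq_bigl => d; rewrite bj andbT andbC (eq_sym d b).
Qed.

Lemma sum_charges_except b : b != j -> \rsum_(d | (d != b) && (d != j)) s d = - s j - s b.
Proof.
move=> bj; have := s0; rewrite (bigD1 j) //= (bigD1 b) //=.
rewrite (eq_bigl (fun d => (d != b) && (d != j))) => [|d]; last by rewrite andbC.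
by move=> h; apply: (Rplus_eq_reg_l (s j + s b)); rewrite Rplus_assoc h; ring.
Qed.

(** Neutrality: the charges other than those at [b] and [j] add up to [- s j - s b]. *)
Lemma pairs_sum_charges (g : I -> R) : pairs_sum j (fun b d => s b * s d * g b) =
  \rsum_(b | b != j) (- (s j * s b) - 1) * g b.
Proof.
apply: eq_bigr => b bj.
rewrite (eq_bigr (fun d => (s b * g b) * s d)) => [|d _]; last by ring.
rewrite rsum_distr sum_charges_except //.
rewrite -(s2 b); ring.
Qed.

Lemma sum_pairs_split (F : I -> I -> R) :
  \rsum_a \rsum_(b | b != a) F a b =
  \rsum_(b | b != j) (F j b + F b j) + pairs_sum j F.
Proof.
rewrite (bigD1 j) //= rsum_add Rplus_assoc; congr (_ + _).
rewrite -rsum_add; apply: eq_bigr => b bj.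
by rewrite (bigD1 j) //= eq_sym.
Qed.

Lemma sum_charges_number :
  \rsum_(b | b != j) 1 = \big[Rplus/0]_(b : I) 1 - 1.
Proof. by rewrite [in RHS](bigD1 j) //=; lra. Qed.

Variables (U H : I -> I -> R) (E : R).
Hypotheses (Uanti : forall b d, U b d = - U d b) (Hsym : forall b d, H b d = H d b).
Hypothesis trip : forall b d, b != j -> d != j -> d != b ->
  H j b + H b d + H d j + 2 * (U j b * U b d + U b d * U d j + U d j * U j b) = 3 / 2 * E.

(** Symmetrized in the two points, the left side is a combination of the products of
    two [U] that occur in [trip]. *)
Lemma pairs_trilinear :
  1 / 2 * pairs_sum j (fun b d => s b * s d * (U j b * U j d)) +
  pairs_sum j (fun b d => s b * s d * (U j b * U d b)) =
  1 / 4 * pairs_sum j (fun b d => s b * s d * H b d)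
  + 1 / 2 * pairs_sum j (fun b d => s b * s d * H j b)
  - 3 / 8 * E * pairs_sum j (fun b d => s b * s d * 1).
Proof.
set P1 := pairs_sum _ _; set P2 := pairs_sum _ _.
have e2 : P2 = pairs_sum j (fun b d => s b * s d * (U j d * U b d)).
  rewrite /P2 -pairs_sum_swap; apply: pairs_sum_ext => b d _ _ _; ring.
set Q1 := pairs_sum _ _; set Q2 := pairs_sum _ _; set Q3 := pairs_sum _ _.
have e3 : Q2 = pairs_sum j (fun b d => s b * s d * H j d).
  rewrite /Q2 -pairs_sum_swap; apply: pairs_sum_ext => b d _ _ _; ring.
have : 1 / 2 * P1 + (1 / 2 * P2 + 1 / 2 * P2) =
  1 / 4 * Q1 + (1 / 4 * Q2 + (1 / 4 * Q2 + (- (3 / 8 * E)) * Q3)).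
  rewrite {2}e2 {2}e3 /P1 /P2 /Q1 /Q2 /Q3 -!pairs_sumZ -!pairs_sumD.
  apply: pairs_sum_ext => b d bj dj db.
  have := trip bj dj db; rewrite (Hsym d j) (Uanti d j) (Uanti d b) => h.
  transitivity (s b * s d * (1 / 4 * H b d + 1 / 4 * H j b + 1 / 4 * H j d - 3 / 8 * E)).
    have -> : 3 / 8 * E = 1 / 4 * (3 / 2 * E) by field.
    by rewrite -h; field.
  by field.
lra.
Qed.

(** The equation at the point [j], with the partition function divided out: [D b] is
    the derivative of its logarithm at [b], [Q] the linear statistic divided by
    [4 r], [V] is [1 / (4 r)], and the left side is the derivative in [r]. *)
Lemma coulomb_identity (Q V : R) :
  let N := \big[Rplus/0]_(b : I) 1 in
  let D := fun b => - (s b * Q) + 1 / 2 * (\rsum_(d | d != b) (s b * s d * U d b)) in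
  (N / 8 + 3 * N * E / 8 + 2 * Q ^ 2
   + 1 / 4 * (\rsum_a \rsum_(b | b != a) (s a * s b * H a b)) =
  2 * (- V + 1 / 2 * (\rsum_(b | b != j) (s j * s b * (H j b - U j b ^ 2))) + D j ^ 2)
  + (\rsum_(b | b != j) (2 * U j b * D b + 1 / 2 * (H j b - U j b ^ 2)))
  + (2 * V + 3 / 4 * E + N / 8)).
Proof.
move=> N D.
set A := \rsum_(b | b != j) (s j * s b * H j b).
set B := \rsum_(b | b != j) (s j * s b * U j b ^ 2).
set A' := \rsum_(b | b != j) H j b.
set B' := \rsum_(b | b != j) (U j b ^ 2).
set P := \rsum_(b | b != j) (s b * U j b).
have tr := pairs_trilinear.
set P1 := pairs_sum j (fun b d => s b * s d * (U j b * U j d)) in tr.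
set P2 := pairs_sum j (fun b d => s b * s d * (U j b * U d b)) in tr.
set Q1 := pairs_sum j (fun b d => s b * s d * H b d) in tr.
rewrite !pairs_sum_charges in tr.
have q2 : \rsum_(b | b != j) (- (s j * s b) - 1) * H j b = - A - A'.
  have -> : - A - A' = -1 * A + -1 * A' by ring.
  by rewrite -!rsum_distr -rsum_add; apply: eq_bigr => b _; ring.
have q3 : \rsum_(b | b != j) (- (s j * s b) - 1) * 1 = 2 - N.
  have h1 : \rsum_(b | b != j) s b = - s j.
    by move: s0; rewrite (bigD1 j) //=; lra.
  transitivity (- s j * (\rsum_(b | b != j) s b) + -1 * (\rsum_(b | b != j) 1)).
    rewrite -(rsum_distr _ (- s j)) -(rsum_distr _ (-1)) -rsum_add.
    by apply: eq_bigr => b _; ring.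
  by rewrite h1 sum_charges_number -/N; have := s2 j; lra.
have eD : D j = - (s j * Q) - 1 / 2 * (s j * P).
  have e : \rsum_(d | d != j) (s j * s d * U d j) = -1 * (s j * P).
    rewrite /P -!rsum_distr; apply: eq_bigr => b _; rewrite (Uanti b j); ring.
  by rewrite /D e; field.
have eP : P ^ 2 = B' + P1.
  rewrite /= Rmult_1_r {1}/P big_distrl /= /B' /P1 /pairs_sum -rsum_add.
  apply: eq_bigr => b bj; rewrite -rsum_distr (bigD1 b) //=; congr (_ + _).
    by transitivity (s b * s b * U j b ^ 2); [ring|rewrite s2; ring].
  rewrite (eq_bigl (fun d => (d != b) && (d != j))) => [|d]; last by rewrite andbC.
  by apply: eq_bigr => d _; ring.
have e1 : \rsum_a \rsum_(b | b != a) (s a * s b * H a b) = 2 * A + Q1.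
  rewrite sum_pairs_split -/Q1 /A -rsum_distr; congr (_ + _); apply: eq_bigr => b _.
  by rewrite (Hsym b j); ring.
have e2 : \rsum_(b | b != j) (s j * s b * (H j b - U j b ^ 2)) = A - B.
  have -> : A - B = A + -1 * B by ring.
  by rewrite -!rsum_distr -rsum_add; apply: eq_bigr => b _; ring.
have e3 : \rsum_(b | b != j) (2 * U j b * D b + 1 / 2 * (H j b - U j b ^ 2)) =
    - (2 * Q) * P + B + P2 + 1 / 2 * A' + - (1 / 2) * B'.
  rewrite /P /B /P2 /A' /B' /pairs_sum -!rsum_distr -!rsum_add; apply: eq_bigr => b bj.
  rewrite /D (bigD1 j) //=; last by rewrite eq_sym.
  rewrite (_ : \rsum_(d | (d != b) && (d != j)) (s b * s d * (U j b * U d b)) =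
    U j b * \rsum_(d | (d != b) && (d != j)) (s b * s d * U d b)); first by field.
  by rewrite -rsum_distr; apply: eq_bigr => d _; ring.
rewrite e1 e2 e3 eD; rewrite q2 q3 in tr.
have sj := s2 j.
have -> : (- (s j * Q) - 1 / 2 * (s j * P)) ^ 2 = (s j * s j) * (Q ^ 2 + Q * P + 1 / 4 * P ^ 2).
  by field.
rewrite sj eP; lra.
Qed.
End Charges.

(** * The energy of a system of charges and its derivatives *)

Lemma is_derive_rsum (I : finType) (P : pred I) (F : I -> R -> R) (d : I -> R) x :
  (forall i, P i -> is_derive (F i) x (d i)) ->
  is_derive (fun t => \rsum_(i | P i) F i t) x (\rsum_(i | P i) d i).
Proof.
move=> h; rewrite -[X in is_derive _ _ X]big_filter.
apply: (is_derive_ext (fun t => \big[Rplus/0]_(i <- [seq i <- index_enum I | P i]) F i t)).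
  by move=> t; rewrite big_filter.
have {h} : forall i, i \in [seq i <- index_enum I | P i] -> is_derive (F i) x (d i).
  by move=> i; rewrite mem_filter => /andP[/h].
elim: [seq i <- _ | _] => [|i s IH] h.
  rewrite big_nil; apply: (is_derive_ext (fun _ => 0)); first by move=> t; rewrite big_nil.
  exact: is_derive_const.
rewrite big_cons; apply: (is_derive_ext (fun t => F i t + \big[Rplus/0]_(i <- s) F i t)).
  by move=> t; rewrite big_cons.
apply: is_derive_plus; first by apply: h; rewrite inE eqxx.
by apply: IH => k ks; apply: h; rewrite inE ks orbT.
Qed.

Lemma locally_all (T : finType) (P : T -> R -> Prop) (x : R) :
  (forall i, locally x (P i)) -> locally x (fun t => forall i, P i t).
Proof.
move=> h; have : locally x (fun t => forall i, i \in enum T -> P i t).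
  elim: (enum T) => [|i s IH]; first exact: filter_forall.
  apply: filter_imp (filter_and _ _ (h i) IH) => t [h1 h2] k.
  by rewrite inE => /orP[/eqP ->|/h2].
by apply: filter_imp => t ht i; apply: ht; rewrite mem_enum.
Qed.

Lemma locally_neq0 (f : R -> R) x df : is_derive f x df -> f x <> 0 ->
  locally x (fun t => f t <> 0).
Proof.
move=> hf f0; have hc : continuous f x by apply: ex_derive_continuous; exists df.
exact: (hc (fun y => y <> 0) (open_neq 0 (f x) f0)).
Qed.

(** The form [f2 + f1 ^ 2] of the second derivative is where the squares of the first
    derivatives in the equations come from. *)
Lemma exp_derivatives (Z f f1 : R -> R) (x f2 : R) :
  locally x (fun t => Z t = exp (f t)) -> locally x (fun t => is_derive f t (f1 t)) ->
  is_derive f1 x f2 ->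
  [/\ is_derive Z x (Z x * f1 x), ex_derive_n Z 2 x &
      Derive_n Z 2 x = Z x * (f2 + f1 x ^ 2)].
Proof.
move=> hZ hf hf1.
have hd : locally x (fun t => is_derive Z t (exp (f t) * f1 t)).
  apply: filter_imp (filter_and _ _ (locally_locally _ _ hZ) hf) => t [h1 h2].
  apply: (is_derive_ext_loc (fun t => exp (f t))).
    by apply: filter_imp h1 => u ->.
  have := is_derive_comp exp f t _ _ (is_derive_exp _) h2.
  by rewrite /scal /= /mult /= Rmult_comm.
have Zx : Z x = exp (f x) := locally_singleton _ _ hZ.
have h2 : is_derive (Derive Z) x (Z x * (f2 + f1 x ^ 2)).
  apply: (is_derive_ext_loc (fun t => exp (f t) * f1 t)).
    by apply: filter_imp hd => t /is_derive_unique.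
  have := is_derive_mult (fun t => exp (f t)) f1 x _ _ (is_derive_comp exp f x _ _
    (is_derive_exp _) (locally_singleton _ _ hf)) hf1 Rmult_comm.
  rewrite /scal /plus /= /mult /= Zx.
  by rewrite (_ : f1 x * exp (f x) * f1 x + exp (f x) * f2 = exp (f x) * (f2 + f1 x * (f1 x * 1))) //; ring.
split.
- by rewrite Zx; exact: (locally_singleton _ _ hd).
- by exists (Z x * (f2 + f1 x ^ 2)).
- exact: is_derive_unique.
Qed.

Section Energy.
Variables (I : finType) (sd : I -> bool) (s : I -> R) (c : R).

Definition move_to (x : I -> R) (j : I) (t : R) : I -> R :=
  fun i => if i == j then t else x i.

Definition same (a b : I) : bool := sd a == sd b.

Definition linear_stat (x : I -> R) : R := (\rsum_a (s a * x a)) - c.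

(** Every pair is listed twice, hence the factor [1/4] in place of [1/2]; likewise
    [N] is twice the number [n] of points on a side. *)
Definition energy (r : R) (x : I -> R) : R :=
  let N := \big[Rplus/0]_(a : I) 1 in
  N * r / 16 + 3 / 4 * N * log_euler r - linear_stat x ^ 2 / (8 * r)
  + 1 / 4 * (\rsum_a \rsum_(b | b != a) (s a * s b * log_th (same a b) r (x b - x a))).

Definition interaction (r : R) (x : I -> R) (a b : I) : R :=
  dlog_th (same a b) r (x b - x a).
Definition heat (r : R) (x : I -> R) (a b : I) : R :=
  heat_th (same a b) r (x b - x a).

Definition force (r : R) (x : I -> R) (j : I) : R :=
  - (s j * (linear_stat x / (4 * r)))
  + 1 / 2 * (\rsum_(d | d != j) (s j * s d * interaction r x d j)).

Definition regular (r : R) (x : I -> R) : Prop :=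
  forall a b, b != a -> th (same a b) 0 r (x b - x a) <> 0.

Lemma move_to_id x j : move_to x j (x j) = x.
Proof. by apply: functional_extensionality => i; rewrite /move_to; case: eqP => [->|]. Qed.

Lemma move_to_move_to x j t u : move_to (move_to x j t) j u = move_to x j u.
Proof. by apply: functional_extensionality => i; rewrite /move_to; case: eqP. Qed.

Lemma move_to_same x j t : move_to x j t j = t.
Proof. by rewrite /move_to eqxx. Qed.

Let dl (j a : I) : R := if a == j then 1 else 0.

Lemma is_derive_move_to x j a :
  is_derive (fun t => move_to x j t a) (x j) (dl j a).
Proof.
by rewrite /move_to /dl; case: eqP => _; [exact: is_derive_id|exact: is_derive_const].
Qed.

Lemma is_derive_move_to_diff (f : R -> R) df x j a b :
  is_derive f (x b - x a) df ->
  is_derive (fun t => f (move_to x j t b - move_to x j t a)) (x j) ((dl j b - dl j a) * df).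
Proof.
move=> hf; have hd := is_derive_minus _ _ _ _ _ (is_derive_move_to x j b) (is_derive_move_to x j a).
have {}hf : is_derive f (move_to x j (x j) b - move_to x j (x j) a) df by rewrite !move_to_id.
exact: (is_derive_comp f (fun t => move_to x j t b - move_to x j t a) _ _ _ hf hd).
Qed.

Lemma locally_regular r x j : 0 < r -> regular r x ->
  locally (x j) (fun t => regular r (move_to x j t)).
Proof.
move=> r0 hx; apply: locally_all => a; apply: locally_all => b.
case: (boolP (b == a)) => [_|ba]; first exact: filter_forall.
have := is_derive_move_to_diff j (is_derive_th_x (same a b) 0 (x b - x a) r0).
move/locally_neq0; rewrite move_to_id => /(_ (hx a b ba)).
exact: filter_imp.
Qed.

Lemma is_derive_linear_stat x j :
  is_derive (fun t => linear_stat (move_to x j t)) (x j) (s j).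
Proof.
have h : is_derive (fun t => \rsum_a (s a * move_to x j t a)) (x j) (\rsum_a (s a * dl j a)).
  apply: (is_derive_rsum (P := xpredT)) => a _; apply: is_derive_scal.
  exact: is_derive_move_to.
have e : \rsum_a (s a * dl j a) = s j.
  rewrite (bigD1 j) //= big1 => [|a /negbTE aj]; first by rewrite /dl eqxx; ring.
  by rewrite /dl aj; ring.
rewrite e in h; have := is_derive_minus _ _ _ _ _ h (is_derive_const c (x j)).
by rewrite /minus /plus /opp /zero /= Ropp_0 Rplus_0_r.
Qed.

Lemma interaction_anti r x a b : 0 < r -> interaction r x a b = - interaction r x b a.
Proof.
move=> r0; rewrite /interaction /same eq_sym -dlog_th_opp //; congr dlog_th; ring.
Qed.

Lemma heat_sym r x a b : 0 < r -> heat r x a b = heat r x b a.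
Proof.
move=> r0; rewrite /heat /same eq_sym -heat_th_opp //; congr heat_th; ring.
Qed.

Lemma is_derive_energy r x j : 0 < r -> regular r x ->
  is_derive (fun t => energy r (move_to x j t)) (x j) (force r x j).
Proof.
move=> r0 hx.
have h1 : is_derive (fun t => linear_stat (move_to x j t) ^ 2 / (8 * r)) (x j)
    (s j * (linear_stat x / (4 * r))).
  have := is_derive_pow _ 2 _ _ (is_derive_linear_stat x j).
  rewrite move_to_id => /(is_derive_scal _ _ (/ (8 * r))) h.
  apply: (is_derive_ext (fun t => / (8 * r) * linear_stat (move_to x j t) ^ 2)).
    by move=> t; rewrite /Rdiv Rmult_comm.
  have -> : s j * (linear_stat x / (4 * r)) = / (8 * r) * (INR 2 * s j * linear_stat x ^ 1).
    by rewrite /=; field; lra.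
  exact: h.
have h2 : is_derive (fun t => \rsum_a \rsum_(b | b != a) (s a * s b *
      log_th (same a b) r (move_to x j t b - move_to x j t a))) (x j)
    (\rsum_a \rsum_(b | b != a) (s a * s b * ((dl j b - dl j a) * interaction r x a b))).
  apply: (is_derive_rsum (P := xpredT)) => a _; apply: is_derive_rsum => b ba.
  apply: is_derive_scal; apply: is_derive_move_to_diff.
  by apply: is_derive_log_th => //; apply: hx.
have e2 : \rsum_a \rsum_(b | b != a) (s a * s b * ((dl j b - dl j a) * interaction r x a b)) =
    2 * (\rsum_(d | d != j) (s j * s d * interaction r x d j)).
  rewrite (sum_pairs_split j) -rsum_distr.
  rewrite (_ : pairs_sum _ _ = 0) ?Rplus_0_r.
    apply: eq_bigr => b /negbTE bj; rewrite /dl bj eqxx (interaction_anti x j b r0); ring.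
  rewrite /pairs_sum big1 // => a /negbTE aj; rewrite big1 // => b /andP[_ /negbTE bj].
  by rewrite /dl aj bj; ring.
rewrite e2 in h2.
have := is_derive_plus _ _ _ _ _ (is_derive_minus _ _ _ _ _
  (is_derive_const ((\big[Rplus/0]_(a : I) 1) * r / 16 + 3 / 4 * (\big[Rplus/0]_(a : I) 1) * log_euler r) (x j))
  h1) (is_derive_scal _ _ (1 / 4) _ h2).
rewrite /minus /plus /opp /zero /= /force Rplus_0_l.
rewrite (_ : 1 / 4 * (2 * _) = 1 / 2 * (\rsum_(d | d != j) (s j * s d * interaction r x d j))) //.
by field.
Qed.

Lemma is_derive_force r x j : 0 < r -> regular r x -> s j * s j = 1 ->
  is_derive (fun t => force r (move_to x j t) j) (x j)
    (- (1 / (4 * r)) + 1 / 2 * (\rsum_(b | b != j)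
       (s j * s b * (heat r x j b - interaction r x j b ^ 2)))).
Proof.
move=> r0 hx sj.
have h1 : is_derive (fun t => - (s j * (linear_stat (move_to x j t) / (4 * r)))) (x j)
    (- (1 / (4 * r))).
  have := is_derive_scal _ _ (- (s j / (4 * r))) _ (is_derive_linear_stat x j) => h.
  have E t : - (s j / (4 * r)) * linear_stat (move_to x j t) =
    - (s j * (linear_stat (move_to x j t) / (4 * r))) by rewrite /Rdiv; ring.
  apply: is_derive_ext E _; have -> : - (1 / (4 * r)) = - (s j / (4 * r)) * s j.
    by rewrite -sj; field; lra.
  exact: h.
have h2 : is_derive (fun t => \rsum_(d | d != j)
      (s j * s d * interaction r (move_to x j t) d j)) (x j)
    (\rsum_(d | d != j) (s j * s d * ((dl j j - dl j d) * (heat r x d j - interaction r x d j ^ 2)))).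
  apply: is_derive_rsum => d dj; apply: is_derive_scal.
  apply: is_derive_move_to_diff; apply: is_derive_dlog_th => //.
  by apply: hx; rewrite eq_sym.
have := is_derive_plus _ _ _ _ _ h1 (is_derive_scal _ _ (1 / 2) _ h2).
rewrite (_ : (\rsum_(d | d != j) (s j * s d * ((dl j j - dl j d) *
    (heat r x d j - interaction r x d j ^ 2)))) =
  (\rsum_(b | b != j) (s j * s b * (heat r x j b - interaction r x j b ^ 2)))) //.
apply: eq_bigr => d /negbTE dj; rewrite /dl eqxx dj (heat_sym x d j r0).
by rewrite (interaction_anti x d j r0); ring.
Qed.

Lemma is_derive_energy_r r x : 0 < r -> regular r x ->
  is_derive (fun t => energy t x) r
    (let N := \big[Rplus/0]_(a : I) 1 in
     N / 8 + 3 * N * Eis r / 8 + 2 * (linear_stat x / (4 * r)) ^ 2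
     + 1 / 4 * (\rsum_a \rsum_(b | b != a) (s a * s b * heat r x a b))).
Proof.
move=> r0 hx; set N := \big[_/_]_(a : I) 1; move=> /=.
have h1 : is_derive (fun t => N * t / 16) r (N / 16) by auto_derive => //; field.
have h2 := is_derive_scal _ _ (3 / 4 * N) _ (is_derive_log_euler r0).
have h3 : is_derive (fun t => linear_stat x ^ 2 / (8 * t)) r (- (linear_stat x ^ 2 / (8 * r ^ 2))).
  by auto_derive; [lra|field; lra].
have h4 : is_derive (fun t => \rsum_a \rsum_(b | b != a) (s a * s b *
      log_th (same a b) t (x b - x a))) r
    (\rsum_a \rsum_(b | b != a) (s a * s b * heat r x a b)).
  apply: (is_derive_rsum (P := xpredT)) => a _; apply: is_derive_rsum => b ba.
  by apply: is_derive_scal; apply: is_derive_log_th_r => //; apply: hx.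
have := is_derive_plus _ _ _ _ _ (is_derive_minus _ _ _ _ _ (is_derive_plus _ _ _ _ _ h1 h2) h3)
  (is_derive_scal _ _ (1 / 4) _ h4).
rewrite /minus /plus /opp /=.
set W := 1 / 4 * _.
rewrite (_ : N / 16 + _ + - - _ + W = N / 8 + 3 * N * Eis r / 8 +
  2 * (linear_stat x / (4 * r) * (linear_stat x / (4 * r) * 1)) + W) //.
by field; lra.
Qed.
End Energy.

(** * The partition functions as exponentials of an energy *)

Definition side (n : nat) (i : 'I_n + 'I_n) : bool := if i is inl _ then true else false.

(** Opposite charges on the two sides make the system neutral and put the [Theta3]
    factors into the denominators. *)
Definition charge (n : nat) (e : 'I_n -> R) (i : 'I_n + 'I_n) : R :=
  match i with inl k => e k | inr k => - e k end.

Definition join (n : nat) (a b : 'I_n -> R) (i : 'I_n + 'I_n) : R :=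
  match i with inl k => a k | inr k => b k end.

Lemma sum_ord_one n : \big[Rplus/0]_(i < n) 1 = INR n.
Proof.
elim: n => [|n IH]; first by rewrite big_ord0.
by rewrite big_ord_recr S_INR -IH.
Qed.

Lemma sum_sides n (P : pred ('I_n + 'I_n)) (F : 'I_n + 'I_n -> R) :
  \rsum_(i | P i) F i = (\rsum_(k | P (inl k)) F (inl k)) + (\rsum_(k | P (inr k)) F (inr k)).
Proof. by rewrite big_sumType. Qed.

Lemma sum_charges n (e : 'I_n -> R) : \rsum_i charge e i = 0.
Proof.
rewrite (sum_sides xpredT) /= -rsum_add big1 // => i _; ring.
Qed.

Lemma sum_sides_one n : \big[Rplus/0]_(i : 'I_n + 'I_n) 1 = 2 * INR n.
Proof. by rewrite (sum_sides xpredT) sum_ord_one; ring. Qed.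

Lemma sum_ordered_pairs n (F : 'I_n -> 'I_n -> R) :
  \rsum_i \rsum_(k | k != i) F i k =
  \big[Rplus/0]_(i < n) \big[Rplus/0]_(k < n | (i < k)%N) (F i k + F k i).
Proof.
transitivity ((\big[Rplus/0]_(i < n) \big[Rplus/0]_(k < n | (i < k)%N) F i k) +
   (\big[Rplus/0]_(i < n) \big[Rplus/0]_(k < n | (k < i)%N) F i k)).
  rewrite -(@rsum_add _ xpredT); apply: eq_bigr => i _.
  rewrite (bigID (fun k : 'I_n => (i < k)%N)) /=; congr (_ + _); apply: eq_bigl => k.
    by case: (ltnP i k) => h; rewrite ?andbF // andbT; apply: contraTneq h => ->; rewrite ltnn.
  by rewrite -leqNgt ltn_neqAle.
rewrite [X in _ + X](exchange_big_dep xpredT) //=.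
rewrite -(@rsum_add _ xpredT); apply: eq_bigr => i _; by rewrite rsum_add.
Qed.

Lemma prod_exp (I : Type) (s : seq I) (P : pred I) (F : I -> R) :
  \big[Rmult/1]_(i <- s | P i) exp (F i) = exp (\big[Rplus/0]_(i <- s | P i) F i).
Proof. by rewrite (big_morph exp exp_plus exp_0). Qed.

Lemma Rprod_inf_euler r p : 0 < r ->
  Rprod_inf (fun m => Rpower (1 - exp (- 2 * INR m * r)) p) = exp (p * log_euler r).
Proof.
move=> r0; rewrite /Rprod_inf.
rewrite (is_lim_seq_unique _ (exp (p * log_euler r))) //.
apply: (is_lim_seq_ext (fun N => exp (p * \big[Rplus/0]_(1 <= m < N.+1)
    ln (1 - exp (- 2 * INR m * r))))).
  by move=> N; rewrite big_distrr /= -prod_exp.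
apply: is_lim_seq_continuous.
  exact/derivable_continuous_pt/derivable_pt_exp.
exact: (is_lim_seq_scal_l _ p _ (log_euler_lim r0)).
Qed.

Lemma Cmod_Theta1_gt0 r x : 0 < r -> th true 0 r x <> 0 ->
  0 < Cmod (Theta1 r (RtoC x)) /\ ln (Cmod (Theta1 r (RtoC x))) = log_th true r x.
Proof.
move=> r0 h; rewrite Theta1_Th // Th_real // Cmod_R; split => //.
exact: Rabs_pos_lt.
Qed.

Lemma Cmod_Theta3_gt0 r x : 0 < r ->
  0 < Cmod (Theta3 r (RtoC x)) /\ ln (Cmod (Theta3 r (RtoC x))) = log_th false r x.
Proof.
move=> r0; rewrite Theta3_Th // Th_real // Cmod_R; split => //.
by apply: Rabs_pos_lt; have := th3_gt0 x r0; lra.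
Qed.

Lemma gas_partition n (e : 'I_n -> R) (c r : R) (a b : 'I_n -> R) :
  0 < r -> (forall j, e j * e j = 1) -> regular (@side n) r (join a b) ->
  exp (INR n * r / 8 - 1 / (8 * r) * ((\big[Rplus/0]_(j < n) (e j * (a j - b j))) - c) ^ 2) *
  Rprod_inf (fun m => Rpower (1 - exp (- 2 * INR m * r)) (3 * INR n / 2)) *
  \big[Rmult/1]_(j < n)
    Rpower (Cmod (Theta3 r (RtoC (b j - a j)))) (- (1 / 2)) *
  \big[Rmult/1]_(i < n) \big[Rmult/1]_(k < n | (i < k)%N)
    Rpower ((Cmod (Theta1 r (RtoC (a k - a i))) *
             Cmod (Theta1 r (RtoC (b k - b i)))) /
            (Cmod (Theta3 r (RtoC (b k - a i))) *
             Cmod (Theta3 r (RtoC (b i - a k)))))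
           (1 / 2 * (e i * e k)) =
  exp (energy (@side n) (charge e) c r (join a b)).
Proof.
move=> r0 e2 hreg.
rewrite Rprod_inf_euler //.
have -> : \big[Rmult/1]_(j < n) Rpower (Cmod (Theta3 r (RtoC (b j - a j)))) (- (1 / 2)) =
    exp (\rsum_j (- (1 / 2) * log_th false r (b j - a j))).
  rewrite -prod_exp; apply: eq_bigr => j _; rewrite /Rpower.
  by have [_ ->] := Cmod_Theta3_gt0 (b j - a j) r0.
pose la i k := log_th true r (a k - a i); pose lb i k := log_th true r (b k - b i).
pose lm i k := log_th false r (b k - a i).
pose T i k := 1 / 2 * (e i * e k) * (la i k + lb i k - lm i k - lm k i).
have -> : \big[Rmult/1]_(i < n) \big[Rmult/1]_(k < n | (i < k)%N)
    Rpower ((Cmod (Theta1 r (RtoC (a k - a i))) * Cmod (Theta1 r (RtoC (b k - b i)))) /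
            (Cmod (Theta3 r (RtoC (b k - a i))) * Cmod (Theta3 r (RtoC (b i - a k)))))
           (1 / 2 * (e i * e k)) =
    exp (\big[Rplus/0]_(i < n) \big[Rplus/0]_(k < n | (i < k)%N) T i k).
  rewrite -prod_exp; apply: eq_bigr => i _; rewrite -prod_exp; apply: eq_bigr => k ik.
  have ki : k != i by apply: contraTneq ik => ->; rewrite ltnn.
  have [A0 eA] : 0 < Cmod (Theta1 r (RtoC (a k - a i))) /\
      ln (Cmod (Theta1 r (RtoC (a k - a i)))) = la i k :=
    Cmod_Theta1_gt0 r0 (hreg (inl i) (inl k) ki).
  have [B0 eB] : 0 < Cmod (Theta1 r (RtoC (b k - b i))) /\
      ln (Cmod (Theta1 r (RtoC (b k - b i)))) = lb i k :=
    Cmod_Theta1_gt0 r0 (hreg (inr i) (inr k) ki).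
  have [C0 eC] := Cmod_Theta3_gt0 (b k - a i) r0.
  have [D0 eD] := Cmod_Theta3_gt0 (b i - a k) r0.
  rewrite /Rpower /T -eA -eB /lm -eC -eD.
  congr (exp (_ * _)); rewrite ln_div; try exact: Rmult_lt_0_compat.
  by rewrite !ln_mult //=; ring.
rewrite -!exp_plus; congr exp.
rewrite /energy sum_sides_one.
have -> : linear_stat (charge e) c (join a b) = (\big[Rplus/0]_(j < n) (e j * (a j - b j))) - c.
  rewrite /linear_stat (sum_sides xpredT) /= -rsum_add; congr (_ - _).
  by apply: eq_bigr => j _; ring.
set S := (_ - c) ^ 2.
have -> : \big[Rplus/0]_(x : 'I_n + 'I_n) \big[Rplus/0]_(y | y != x) (charge e x * charge e y *
     log_th (same (@side n) x y) r (join a b y - join a b x)) =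
   (\rsum_j (-2 * log_th false r (b j - a j))) + 4 * (\big[Rplus/0]_(i < n) \big[Rplus/0]_(k < n | (i < k)%N) T i k).
  rewrite (sum_sides xpredT) /=.
  under eq_bigr => i _ do rewrite (sum_sides (fun y => y != inl i)) /=.
  under [X in _ + X]eq_bigr => i _ do rewrite (sum_sides (fun y => y != inr i)) /=.
  rewrite !(@rsum_add _ xpredT).
  have s12 i k : same (@side n) (inl i) (inr k) = false by [].
  have s21 i k : same (@side n) (inr i) (inl k) = false by [].
  have s11 i k : same (@side n) (inl i) (inl k) = true by [].
  have s22 i k : same (@side n) (inr i) (inr k) = true by [].
  pose W i k := e i * e k * (la i k + lb i k - lm i k - lm k i).
  transitivity (\big[Rplus/0]_(i < n) (-2 * lm i i + \big[Rplus/0]_(k < n | k != i) W i k)).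
    rewrite -!(@rsum_add _ xpredT); apply: eq_bigr => i _.
    rewrite [X in _ + X + _](bigD1 i) //= [X in _ + (X + _)](bigD1 i) //=.
    have -> : e i * - e i * log_th (same (@side n) (inl i) (inr i)) r (b i - a i) = - lm i i.
      by rewrite -[e i * - e i]Ropp_mult_distr_r e2 /lm ?s12 ?s21; ring.
    have -> : - e i * e i * log_th (same (@side n) (inr i) (inl i)) r (a i - b i) = - lm i i.
      rewrite -[- e i * e i]Ropp_mult_distr_l e2 /lm ?s12 ?s21.
      by rewrite -log_th_opp // Ropp_minus_distr; ring.
    set X1 := \big[_/_]_(_ | _) _; set X2 := \big[_/_]_(_ | _) _.
    set X3 := \big[_/_]_(_ | _) _; set X4 := \big[_/_]_(_ | _) _.
    transitivity (-2 * lm i i + (X1 + X2 + (X3 + X4))); first by ring.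
    congr (_ + _); rewrite /X1 /X2 /X3 /X4 -!rsum_add; apply: eq_bigr => k ki.
    rewrite /W /la /lb /lm s12 s21 s11 s22 -(@log_th_opp _ r (a k - b i)) // Ropp_minus_distr.
    by ring.
  rewrite (@rsum_add _ xpredT) sum_ordered_pairs; congr (_ + _).
  rewrite -(@rsum_distr _ xpredT); apply: eq_bigr => i _; rewrite -rsum_distr.
  apply: eq_bigr => k _; rewrite /W /T.
  have -> : la k i = la i k by rewrite /la -log_th_opp // Ropp_minus_distr.
  have -> : lb k i = lb i k by rewrite /lb -log_th_opp // Ropp_minus_distr.
  by field.
have -> : \rsum_j (-2 * log_th false r (b j - a j)) = -2 * (\rsum_j log_th false r (b j - a j)).
  exact: (@rsum_distr _ xpredT).
have -> : \rsum_j (- (1 / 2) * log_th false r (b j - a j)) =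
    - (1 / 2) * (\rsum_j log_th false r (b j - a j)).
  exact: (@rsum_distr _ xpredT).
by field; lra.
Qed.

Lemma Zann_energy n (r : R) (a b : 'I_n -> R) : 0 < r -> regular (@side n) r (join a b) ->
  Zann r a b = exp (energy (@side n) (charge (fun j : 'I_n => (-1) ^ j.+1)) 0 r (join a b)).
Proof.
move=> r0 hreg.
have sq m : (-1) ^ m * (-1) ^ m = 1.
  by rewrite -Rpow_mult_distr (_ : -1 * -1 = 1) ?pow1 //; ring.
rewrite -gas_partition // /Zann Rminus_0_r; congr (_ * _).
apply: eq_bigr => i _; apply: eq_bigr => k ik; congr (Rpower _ (_ * _)).
rewrite -{2}(subnK (ltnW ik)) -addnS pow_add -Rmult_assoc (Rmult_comm (_ ^ i.+1)).
by rewrite Rmult_assoc sq Rmult_1_r.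
Qed.

Lemma Zcro_energy n l (r : R) (a b : 'I_n -> R) : 0 < r -> regular (@side n) r (join a b) ->
  Zcro l r a b = exp (energy (@side n) (charge (fun j : 'I_n => 1))
    (2 * INR n * PI * IZR l) r (join a b)).
Proof.
move=> r0 hreg; rewrite -gas_partition // => [|j]; last by ring.
rewrite /Zcro; congr (exp (_ - _ * (_ - _) ^ 2) * _ * _ * _).
  by apply: eq_bigr => j _; rewrite Rmult_1_l.
by apply: eq_bigr => i _; apply: eq_bigr => k _; rewrite !Rmult_1_r.
Qed.

(** Any two points lie between the first and the last one. *)
Lemma Xn_diff n (x : 'I_n -> R) (i k : 'I_n) : Xn x -> (i < k)%N -> 0 < x k - x i < 2 * PI.
Proof.
move=> [inc per] ik; have := inc _ _ ik.
have n0 : (0 < n)%N := leq_ltn_trans (leq0n _) (ltn_ord i).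
pose o := Ordinal n0; have hl : (n.-1 < n)%N by rewrite prednK.
pose m := Ordinal hl.
have h := per o m erefl erefl.
have hi : x o <= x i.
  case: (posnP i) => i0; last by apply/Rlt_le/inc.
  by rewrite (_ : o = i); [lra|apply: val_inj].
have hk : x k <= x m.
  have : (k <= m)%N by rewrite /= -ltnS prednK.
  rewrite leq_eqVlt => /orP[/eqP km|km]; last by apply/Rlt_le/inc.
  by rewrite (_ : k = m); [lra|apply: val_inj].
lra.
Qed.

Lemma Xn_regular n r (a b : 'I_n -> R) : 0 < r -> Xn a -> Xn b ->
  regular (@side n) r (join a b).
Proof.
move=> r0 ha hb.
have key (x : 'I_n -> R) (i k : 'I_n) : Xn x -> k != i -> th true 0 r (x k - x i) <> 0.
  move=> hx ki; case: (ltngtP i k) => h.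
  - by have := th1_gt0 r0 (Xn_diff hx h); lra.
  - have := th1_gt0 r0 (Xn_diff hx h); rewrite -Ropp_minus_distr th_opp //= => ?; lra.
  - by move: ki; rewrite (_ : k = i) ?eqxx //; apply: val_inj.
move=> [i|i] [k|k] ki /=.
- exact: key.
- by change (th false 0 r (b k - a i) <> 0); have := th3_gt0 (b k - a i) r0; lra.
- by change (th false 0 r (a k - b i) <> 0); have := th3_gt0 (a k - b i) r0; lra.
- exact: key.
Qed.

(** * The system of equations *)

Definition HTheta (t : bool) : R -> C -> C := if t then HTheta1 else HTheta3.

Lemma HTheta_Th t r z : 0 < r -> HTheta t r z = (2 * (Th t 1 r z / Th t 0 r z))%C.
Proof.
move=> r0; case: t; rewrite /HTheta ?/HTheta1 ?/HTheta3.
  rewrite Theta1_Th //; congr (_ * (_ / _))%C; apply: is_C_derive_unique.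
  apply: is_derive_ext (is_derive_Th true 0 z r0) => w; by rewrite Theta1_Th.
rewrite Theta3_Th //; congr (_ * (_ / _))%C; apply: is_C_derive_unique.
apply: is_derive_ext (is_derive_Th false 0 z r0) => w; by rewrite Theta3_Th.
Qed.

Lemma HTheta_real t r x : 0 < r -> th t 0 r x <> 0 ->
  HTheta t r (RtoC x) = RtoC (2 * dlog_th t r x).
Proof.
by move=> r0 h; rewrite HTheta_Th // !Th_real // -RtoC_div // -RtoC_mult.
Qed.

Lemma dHTheta_real t r x : 0 < r -> th t 0 r x <> 0 ->
  C_derive (HTheta t r) (RtoC x) = RtoC (2 * (heat_th t r x - dlog_th t r x ^ 2)).
Proof.
move=> r0 h; apply: is_C_derive_unique.
have h0 : Th t 0 r (RtoC x) <> 0 by rewrite Th_real // => -[].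
have hd := is_derive_Cdiv (is_derive_Th t 1 (RtoC x) r0) (is_derive_Th t 0 (RtoC x) r0) h0.
apply: (is_derive_ext (fun w => 2 * (Th t 1 r w / Th t 0 r w))%C).
  by move=> w; rewrite HTheta_Th.
move/C_is_derive_absring: hd => hd; apply/C_is_derive_absring.
have := is_derive_mult _ _ _ _ _ (@is_derive_const _ (AbsRing_NormedModule C_AbsRing)
  (RtoC 2) (RtoC x)) hd Cmult_comm.
rewrite /plus /mult /zero /= !Th_real //.
set u := (0 * _ + _)%C; rewrite (_ : u = RtoC (2 * (heat_th t r x - dlog_th t r x ^ 2))) //.
rewrite /u /heat_th /dlog_th Cmult_0_l Cplus_0_l -!RtoC_mult -RtoC_minus -RtoC_div.
  by rewrite -!RtoC_mult; congr RtoC; rewrite /=; field.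
exact: Rmult_integral_contrapositive_currified.
Qed.

Lemma Csum_RtoC (I : finType) (P : pred I) (f : I -> C) (g : I -> R) :
  (forall i, P i -> f i = RtoC (g i)) ->
  \big[Cplus/RtoC 0]_(i | P i) f i = RtoC (\rsum_(i | P i) g i).
Proof.
move=> h; rewrite (eq_bigr (fun i => RtoC (g i))) //.
by rewrite (big_morph RtoC (id1 := RtoC 0) (op1 := Cplus)) // => x y; rewrite RtoC_plus.
Qed.

Section System.
Variables (n : nat) (Zf : R -> ('I_n -> R) -> ('I_n -> R) -> R).
Variables (e : 'I_n -> R) (c : R).
Hypothesis e2 : forall j, e j * e j = 1.
Hypothesis hZ : forall r a b, 0 < r -> regular (@side n) r (join a b) ->
  Zf r a b = exp (energy (@side n) (charge e) c r (join a b)).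
Variables (r : R) (a b : 'I_n -> R).
Hypotheses (r0 : 0 < r) (ha : Xn a) (hb : Xn b).

Let sd := @side n.
Let s := charge e.
Let x := join a b.
Let hx : regular sd r x := Xn_regular r0 ha hb.

Let s2 : forall j, s j * s j = 1.
Proof. by case=> k; rewrite /s /=; have := e2 k; lra. Qed.

Definition second_log (j : 'I_n + 'I_n) : R := - (1 / (4 * r)) + 1 / 2 * (\rsum_(k | k != j)
  (s j * s k * (heat sd r x j k - interaction sd r x j k ^ 2))) + force sd s c r x j ^ 2.

Lemma Zf_derivatives j (f : R -> R) :
  (forall t, f t = Zf r (fun k => move_to x j t (inl k)) (fun k => move_to x j t (inr k))) ->
  [/\ is_derive f (x j) (Zf r a b * force sd s c r x j),
      ex_derive_n f 2 (x j) &
      Derive_n f 2 (x j) = Zf r a b * second_log j].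
Proof.
move=> hf.
have jn y : join (fun k => y (inl k)) (fun k => y (inr k)) = y :> ('I_n + 'I_n -> R).
  by apply: functional_extensionality => -[].
have hl := locally_regular j r0 hx.
have Zx : f (x j) = Zf r a b.
  by rewrite hf move_to_id; congr Zf; apply: functional_extensionality.
rewrite -Zx.
have := @exp_derivatives f (fun t => energy sd s c r (move_to x j t))
  (fun t => force sd s c r (move_to x j t) j) (x j) _ _ _ (is_derive_force c r0 hx (s2 j)).
rewrite move_to_id; apply.
  by apply: filter_imp hl => t ht; rewrite hf hZ // jn.
apply: filter_imp hl => t ht.
have := is_derive_energy s c j r0 ht; rewrite move_to_same.
by apply: is_derive_ext => u; rewrite move_to_move_to.
Qed.

Lemma upd_inl k t : Zf r (upd a k t) b =
  Zf r (fun i => move_to x (inl k) t (inl i)) (fun i => move_to x (inl k) t (inr i)).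
Proof. by congr Zf; apply: functional_extensionality. Qed.

Lemma upd_inr k t : Zf r a (upd b k t) =
  Zf r (fun i => move_to x (inr k) t (inl i)) (fun i => move_to x (inr k) t (inr i)).
Proof. by congr Zf; apply: functional_extensionality. Qed.

Lemma Zf_derive_r : is_derive (fun t => Zf t a b) r (Zf r a b *
  (2 * INR n / 8 + 3 * (2 * INR n) * Eis r / 8 + 2 * (linear_stat s c x / (4 * r)) ^ 2
     + 1 / 4 * (\rsum_i \rsum_(k | k != i) (s i * s k * heat sd r x i k)))).
Proof.
rewrite hZ // -sum_sides_one.
apply: (is_derive_ext_loc (fun t => exp (energy sd s c t x))).
  exists (mkposreal _ r0) => t ht.
  have {}ht : Rabs (t - r) < r := ht.
  have t0 : 0 < t by move: ht => /Rabs_def2; lra.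
  by rewrite hZ //; exact: Xn_regular.
have := is_derive_comp exp (fun t => energy sd s c t x) r _ _ (is_derive_exp _)
  (is_derive_energy_r s c r0 hx).
by rewrite /scal /= /mult /= Rmult_comm.
Qed.

Lemma Zf_gt0 : 0 < Zf r a b.
Proof. by rewrite hZ //; apply: exp_pos. Qed.

Lemma Zf_equation (j : 'I_n + 'I_n) :
  RtoC (Derive (fun t => Zf t a b) r / Zf r a b) =
  (2 * RtoC (second_log j)
   + \big[Cplus/RtoC 0]_(k | k != j) (HTheta (same sd j k) r (RtoC (x k - x j)) *
        RtoC (force sd s c r x k)
      + 1 / 4 * C_derive (HTheta (same sd j k) r) (RtoC (x k - x j)))
   + RtoC (1 / (2 * r) + 3 / 4 * Eis r + INR n / 4))%C.
Proof.
have Z0 := Zf_gt0.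
rewrite (is_derive_unique _ _ _ Zf_derive_r).
rewrite (@Csum_RtoC _ _ _ (fun k => 2 * interaction sd r x j k * force sd s c r x k +
   1 / 2 * (heat sd r x j k - interaction sd r x j k ^ 2))); last first.
  move=> k kj; have h := hx kj.
  rewrite HTheta_real // dHTheta_real // /interaction /heat.
  have -> : (1 / 4 = RtoC (1 / 4))%C by rewrite RtoC_div //; lra.
  by rewrite -!RtoC_mult -RtoC_plus; congr RtoC; field.
rewrite -RtoC_mult -!RtoC_plus; congr RtoC.
have -> : forall D, Zf r a b * D / Zf r a b = D by move=> D; field; lra.
have := @coulomb_identity _ j s s2 (sum_charges e) (interaction sd r x) (heat sd r x) (Eis r)
  (fun i k => interaction_anti sd x i k r0) (fun i k => heat_sym sd x i k r0) _
  (linear_stat s c x / (4 * r)) (1 / (4 * r)).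
rewrite sum_sides_one => ->; last first.
  move=> i k ij kj ki; rewrite /heat /interaction.
  apply: th_trilinear => //; first by rewrite /same; case: (sd i); case: (sd j); case: (sd k).
  - by ring.
  - exact: hx.
  - exact: hx.
  - by apply: hx; rewrite eq_sym.
rewrite /second_log; congr (_ + _); field; lra.
Qed.

Lemma Zf_system :
  (ex_derive (fun t => Zf t a b) r /\
   forall j : 'I_n,
     [/\ ex_partial (fun y => Zf r y b) j a,
         ex_partial2 (fun y => Zf r y b) j a,
         ex_partial (fun y => Zf r a y) j b
       & ex_partial2 (fun y => Zf r a y) j b]) /\
  forall j : 'I_n,
    (RtoC (Derive (fun t => Zf t a b) r / Zf r a b) =
      2 * RtoC (partial2 (fun y => Zf r y b) j a / Zf r a b)
      + \big[Cplus/RtoC 0]_(k < n | k != j)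
          (HTheta1 r (RtoC (a k - a j))
             * RtoC (partial (fun y => Zf r y b) k a / Zf r a b)
           + 1 / 4 * C_derive (HTheta1 r) (RtoC (a k - a j)))
      + \big[Cplus/RtoC 0]_(k < n)
          (HTheta3 r (RtoC (b k - a j))
             * RtoC (partial (fun y => Zf r a y) k b / Zf r a b)
           + 1 / 4 * C_derive (HTheta3 r) (RtoC (b k - a j)))
      + RtoC (1 / (2 * r) + 3 / 4 * Eis r + INR n / 4))%C
    /\
    (RtoC (Derive (fun t => Zf t a b) r / Zf r a b) =
      2 * RtoC (partial2 (fun y => Zf r a y) j b / Zf r a b)
      + \big[Cplus/RtoC 0]_(k < n | k != j)
          (HTheta1 r (RtoC (b k - b j))
             * RtoC (partial (fun y => Zf r a y) k b / Zf r a b)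
           + 1 / 4 * C_derive (HTheta1 r) (RtoC (b k - b j)))
      + \big[Cplus/RtoC 0]_(k < n)
          (HTheta3 r (RtoC (a k - b j))
             * RtoC (partial (fun y => Zf r y b) k a / Zf r a b)
           + 1 / 4 * C_derive (HTheta3 r) (RtoC (a k - b j)))
      + RtoC (1 / (2 * r) + 3 / 4 * Eis r + INR n / 4))%C.
Proof.
have Z0 := Zf_gt0.
have cancel D : Zf r a b * D / Zf r a b = D by field; lra.
have dl k := Zf_derivatives (upd_inl k); have dr k := Zf_derivatives (upd_inr k).
have p1l k : partial (fun y => Zf r y b) k a / Zf r a b = force sd s c r x (inl k).
  by rewrite /partial; have [/is_derive_unique -> _ _] := dl k.
have p1r k : partial (fun y => Zf r a y) k b / Zf r a b = force sd s c r x (inr k).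
  by rewrite /partial; have [/is_derive_unique -> _ _] := dr k.
have p2l k : partial2 (fun y => Zf r y b) k a / Zf r a b = second_log (inl k).
  by rewrite /partial2; have [_ _ ->] := dl k.
have p2r k : partial2 (fun y => Zf r a y) k b / Zf r a b = second_log (inr k).
  by rewrite /partial2; have [_ _ ->] := dr k.
split.
  split; first by eexists; exact: Zf_derive_r.
  move=> j; have [h1 h2 _] := dl j; have [h3 h4 _] := dr j.
  by split => //; eexists; [exact: h1|exact: h3].
move=> j; split.
  rewrite (Zf_equation (inl j)) p2l big_sumType Cplus_assoc; congr (_ + _ + _ + _)%C.
  - by apply: eq_bigr => k _; rewrite p1l.
  - by apply: eq_bigr => k _; rewrite p1r.
rewrite (Zf_equation (inr j)) p2r big_sumType.
have E (u v w t : C) : (u + (v + w) + t = u + w + v + t)%C by ring.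
rewrite E; congr (_ + _ + _ + _)%C; apply: eq_bigr => k _; first by rewrite p1r.
by rewrite p1l.
Qed.
End System.

Theorem proposition1p1 (n : nat) (l : Z) (hn : (1 <= n)%N)
    (Zf : R -> ('I_n -> R) -> ('I_n -> R) -> R)
    (hZ : Zf = @Zann n \/ Zf = @Zcro n l)
    (r : R) (hr : 0 < r)
    (a b : 'I_n -> R) (ha : Xn a) (hb : Xn b) :
  (ex_derive (fun s => Zf s a b) r /\
   forall j : 'I_n,
     [/\ ex_partial (fun x => Zf r x b) j a,
         ex_partial2 (fun x => Zf r x b) j a,
         ex_partial (fun y => Zf r a y) j b
       & ex_partial2 (fun y => Zf r a y) j b]) /\
  forall j : 'I_n,
    (RtoC (Derive (fun s => Zf s a b) r / Zf r a b) =
      2 * RtoC (partial2 (fun x => Zf r x b) j a / Zf r a b)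
      + \big[Cplus/RtoC 0]_(k < n | k != j)
          (HTheta1 r (RtoC (a k - a j))
             * RtoC (partial (fun x => Zf r x b) k a / Zf r a b)
           + 1 / 4 * C_derive (HTheta1 r) (RtoC (a k - a j)))
      + \big[Cplus/RtoC 0]_(k < n)
          (HTheta3 r (RtoC (b k - a j))
             * RtoC (partial (fun y => Zf r a y) k b / Zf r a b)
           + 1 / 4 * C_derive (HTheta3 r) (RtoC (b k - a j)))
      + RtoC (1 / (2 * r) + 3 / 4 * Eis r + INR n / 4))%C
    /\
    (RtoC (Derive (fun s => Zf s a b) r / Zf r a b) =
      2 * RtoC (partial2 (fun y => Zf r a y) j b / Zf r a b)
      + \big[Cplus/RtoC 0]_(k < n | k != j)
          (HTheta1 r (RtoC (b k - b j))
             * RtoC (partial (fun y => Zf r a y) k b / Zf r a b)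
           + 1 / 4 * C_derive (HTheta1 r) (RtoC (b k - b j)))
      + \big[Cplus/RtoC 0]_(k < n)
          (HTheta3 r (RtoC (a k - b j))
             * RtoC (partial (fun x => Zf r x b) k a / Zf r a b)
           + 1 / 4 * C_derive (HTheta3 r) (RtoC (a k - b j)))
      + RtoC (1 / (2 * r) + 3 / 4 * Eis r + INR n / 4))%C.
Proof.
case: hZ => ->.
  apply: (Zf_system (e := fun j : 'I_n => (-1) ^ j.+1) (c := 0)) => //.
    by move=> j; rewrite -Rpow_mult_distr (_ : -1 * -1 = 1) ?pow1 //; ring.
  exact: Zann_energy.
apply: (Zf_system (e := fun j : 'I_n => 1) (c := 2 * INR n * PI * IZR l)) => //.
  by move=> j; ring.
exact: Zcro_energy.
Qed.
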